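(* The notion of an $\hat{\mathcal S}$-logarithmic vertex algebra is equivalent to that of an $\mathcal S$-logarithmic vertex algebra. That is: (a) if $(V,\boldsymbol1,T,Y,\hat{\mathcal S})$ is an $\hat{\mathcal S}$-logarithmic vertex algebra and $\mathcal S$ is the linear operator on $V\otimes V$ given by $$\mathcal S(a\otimes b)=\hat{\mathcal S}\bigl(Y(a,z_1)\otimes Y(b,z_2)\bigr)(\boldsymbol1\otimes\boldsymbol1)\big|_{z_1=z_2=0},$$ then $(V,\boldsymbol1,T,Y,\mathcal S)$ is an $\mathcal S$-logarithmic vertex algebra; (b) conversely, if $(V,\boldsymbol1,T,Y,\mathcal S)$ is an $\mathcal S$-logarithmic vertex algebra and $\hat{\mathcal S}=(\mathrm{ad}\otimes\mathrm{ad})(\mathcal S)$, extended to $\mathrm{LF}(V)\otimes\mathrm{LF}(V)$ by acting on the coefficients of the logarithmic fields, then $(V,\boldsymbol1,T,Y,\hat{\mathcal S})$ is an $\hat{\mathcal S}$-logarithmic vertex algebra.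
   Context: Conventions. All superspaces, tensor products and Hom's are over $\mathbb C$; $p(v)$ is the parity; formulas with $p$ are for homogeneous elements, extended linearly. $(\phi\otimes\psi)(a\otimes b)=(-1)^{p(\psi)p(a)}\phi(a)\otimes\psi(b)$; $[\cdot,\cdot]$ is the supercommutator, $\mathrm{ad}(a)b=[a,b]$; $P(a\otimes b)=(-1)^{p(a)p(b)}b\otimes a$; $I$ is the identity operator. $z,z_1,z_2,\dots$ and $\zeta,\zeta_1,\zeta_2,\dots$ are commuting even formal variables ($\zeta_i$ plays the role of $\log z_i$; setting $z_1=z$ also sets $\zeta_1=\zeta$). $D_z=\partial_z+z^{-1}\partial_\zeta$, $z_{12}=z_1-z_2$, $x^{(k)}=x^k/k!$ for $k\ge0$ and $x^{(k)}=0$ for $k<0$. $\vartheta_{12}=\zeta_1-\sum_{n\ge1}\frac1n z_1^{-n}z_2^n$, $\vartheta_{21}=\zeta_2-\sum_{n\ge1}\frac1n z_1^{n}z_2^{-n}$. Logarithmic fields. $\mathrm{LF}(V)=\mathrm{Hom}(V,V(\!(z)\!)[\zeta])$, with its natural superspace structure; elements are written $a(z)=a(z,\zeta)$. Braiding map. A braiding map on a superspace $U$ is an even element $\mathcal S=\sum_i\phi_i\otimes\psi_i\in\mathrm{End}(U)\otimes\mathrm{End}(U)$ (finite sum) with $\mathcal SP=P\mathcal S$ and $[\mathcal S_{12},\mathcal S_{23}]=[\mathcal S_{13},\mathcal S_{23}]=[\mathcal S_{12},\mathcal S_{13}]=0$ on $U^{\otimes3}$, where $\mathcal S_{12}=\mathcal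 S\otimes I$, $\mathcal S_{23}=I\otimes\mathcal S$, $\mathcal S_{13}=(I\otimes P)\mathcal S_{12}(I\otimes P)$. $(\mathrm{ad}\otimes\mathrm{ad})(\mathcal S)=\sum_i\mathrm{ad}(\phi_i)\otimes\mathrm{ad}(\psi_i)$, acting by $(\mathrm{ad}(a)\otimes\mathrm{ad}(b))(c\otimes d)=(-1)^{p(b)p(c)}[a,c]\otimes[b,d]$. Locality with respect to $\hat{\mathcal S}$. Write $\hat{\mathcal S}=\sum_{i}\Phi_i\otimes\Psi_i$ with the $\Phi_i$ linearly independent, the $\Psi_i$ linearly independent, $p(\Phi_i)=p(\Psi_i)$; it acts on $a(z_1)\otimes b(z_2)$ by $\sum_i(-1)^{p(\Psi_i)p(a)}(\Phi_ia)(z_1)\otimes(\Psi_ib)(z_2)$. Let $\mu(a(z_1)\otimes b(z_2))=a(z_1)b(z_2)$. A subspace $\mathcal V\subset\mathrm{LF}(V)$ is $\hat{\mathcal S}$-local if: (i) $\Phi_i\mathcal V\subset\mathcal V$ and $\Psi_i\mathcal V\subset\mathcal V$ for all $i$; (ii) for all $a,b\in\mathcal V$ there is $r\ge1$ with $\hat{\mathcal S}^r(a\otimes b)=0$; (iii) for all $a,b\in\mathcal V$ there is an integer $N\ge0$ with $\mu(z_{12}^Ne^{\vartheta_{12}\hat{\mathcal S}}a(z_1)\otimes b(z_2))=(-1)^{p(a)p(b)}\mu(z_{12}^Ne^{\vartheta_{21}\hat{\mathcal S}}b(z_2)\otimes a(z_1))$. For $a,b$ in such $\mathcal V$ and $n\in\mathbb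 Z$, the product $\hat\mu_{(n)}(a\otimes b)=a_{(n+\hat{\mathcal S})}b\in\mathrm{LF}(V)$ is $$\bigl(a(z)_{(n+\hat{\mathcal S})}b(z)\bigr)v=D_{z_1}^{(N-1-n)}\mu\bigl(z_{12}^Ne^{\vartheta_{12}\hat{\mathcal S}}a(z_1)\otimes b(z_2)\bigr)v\Big|_{z_1=z_2=z,\ \zeta_1=\zeta_2=\zeta}$$ with $N$ as in (iii) (independent of $N$). $\hat{\mathcal S}$-logarithmic vertex algebra $(V,\boldsymbol1,T,Y,\hat{\mathcal S})$: a superspace $V$, an even vector $\boldsymbol1$, an even $T\in\mathrm{End}(V)$, an even linear map $Y_z:V\to\mathrm{LF}(V)$, $a\mapsto Y(a,z)$, and a braiding map $\hat{\mathcal S}$ on $Y_z(V)$ such that: (vacuum) $Y(\boldsymbol1,z)=I$, $Y(a,z)\boldsymbol1\in V[\![z]\!]$, $Y(a,z)\boldsymbol1|_{z=0}=a$, $T\boldsymbol1=0$; (covariance) $[\mathrm{ad}(T)\otimes I,\hat{\mathcal S}]=[D_z\otimes I,\hat{\mathcal S}]=0$, $[T,Y(a,z)]=D_zY(a,z)$; (locality) $Y_z(V)$ is $\hat{\mathcal S}$-local; (hexagon) for all $n\in\mathbb Z$, $\hat{\mathcal S}(\hat\mu_{(n)}\otimes I)=(\hat\mu_{(n)}\otimes I)(\hat{\mathcal S}_{13}+\hat{\mathcal S}_{23})$ on $Y_z(V)^{\otimes3}$. $\mathcal S$-logarithmic vertex algebra $(V,\boldsymbol1,T,Y,\mathcal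 S)$: a superspace $V$, an even vector $\boldsymbol1$, an even $T\in\mathrm{End}(V)$, an even linear map $Y_z:V\to\mathrm{LF}(V)$, $a\mapsto Y(a,z)$, and a braiding map $\mathcal S$ on $V$ such that, with $Y(z)(a\otimes b):=Y(a,z)b$: (vacuum) $Y(\boldsymbol1,z)=I$, $Y(a,z)\boldsymbol1\in V[\![z]\!]$, $Y(a,z)\boldsymbol1|_{z=0}=a$, $T\boldsymbol1=0$; (covariance) $[T,Y(a,z)]=D_zY(a,z)$; (nilpotence) $\mathcal S$ is locally nilpotent on $V\otimes V$; (locality) for all $a,b\in V$ there is $N\in\mathbb Z_+$ such that for all $c\in V$, $$Y(z_1)(I\otimes Y(z_2))z_{12}^Ne^{\vartheta_{12}\mathcal S_{12}}(a\otimes b\otimes c)=(-1)^{p(a)p(b)}Y(z_2)(I\otimes Y(z_1))z_{12}^Ne^{\vartheta_{21}\mathcal S_{12}}(b\otimes a\otimes c);$$ (hexagon) $\mathcal S(Y(z)\otimes I)=(Y(z)\otimes I)(\mathcal S_{13}+\mathcal S_{23})$ on $V^{\otimes3}$. *)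

(* Defs.v *)
From HB Require Import structures.
From mathcomp Require Import all_boot all_order all_algebra.
From mathcomp Require Import boolp classical_sets functions fsbigop reals.
From mathcomp Require Import complex.

Set Implicit Arguments.
Unset Strict Implicit.
Unset Printing Implicit Defensive.
Import Order.TTheory GRing.Theory Num.Theory.
Local Open Scope ring_scope.
Local Open Scope quotient_scope.

Section Hom.
Context {K : fieldType} {U W : lmodType K}.

Definition mklin (f : U -> W) (fl : linear f) : {linear U -> W} :=
  HB.pack f (GRing.isLinear.Build K U W *:%R f fl).

Lemma linext (f g : {linear U -> W}) : f =1 g -> f = g.
Proof.
case: f g => [f [[[f1 f2]] [f3]]] [g [[[g1 g2]] [g3]]] /= /funext fg.
subst g; congr GRing.Linear.Pack.
by rewrite (Prop_irrelevance f1 g1) (Prop_irrelevance f2 g2)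
  (Prop_irrelevance f3 g3).
Qed.

HB.instance Definition _ := gen_eqMixin {linear U -> W}.
HB.instance Definition _ := gen_choiceMixin {linear U -> W}.

Let zero_lin : linear (fun _ : U => 0 : W).
Proof. by move=> k u v; rewrite scaler0 addr0. Qed.
Let opp_lin (f : {linear U -> W}) : linear (fun u => - f u).
Proof. by move=> k u v; rewrite linearP opprD scalerN. Qed.
Let add_lin (f g : {linear U -> W}) : linear (fun u => f u + g u).
Proof. by move=> k u v; rewrite !linearP scalerDr addrACA. Qed.
Let scale_lin a (f : {linear U -> W}) : linear (fun u => a *: f u).
Proof. by move=> k u v; rewrite linearP scalerDr !scalerA mulrC. Qed.

Let hadd (f g : {linear U -> W}) := mklin (add_lin f g).
Let hopp (f : {linear U -> W}) := mklin (opp_lin f).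
Let hscale a (f : {linear U -> W}) := mklin (scale_lin a f).

Let haddA : associative hadd.
Proof. by move=> f g h; apply: linext => u /=; rewrite addrA. Qed.
Let haddC : commutative hadd.
Proof. by move=> f g; apply: linext => u /=; rewrite addrC. Qed.
Let hadd0 : left_id (mklin zero_lin) hadd.
Proof. by move=> f; apply: linext => u /=; rewrite add0r. Qed.
Let haddN : left_inverse (mklin zero_lin) hopp hadd.
Proof. by move=> f; apply: linext => u /=; rewrite addNr. Qed.
HB.instance Definition _ :=
  GRing.isZmodule.Build {linear U -> W} haddA haddC hadd0 haddN.

Let hscaleA a b f : hscale a (hscale b f) = hscale (a * b) f.
Proof. by apply: linext => u /=; rewrite scalerA. Qed.
Let hscale1 : left_id 1 hscale.
Proof. by move=> f; apply: linext => u /=; rewrite scale1r. Qed.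
Let hscaleDr : right_distributive hscale +%R.
Proof. by move=> a f g; apply: linext => u /=; rewrite scalerDr. Qed.
Let hscaleDl f : {morph hscale^~ f : a b / a + b}.
Proof. by move=> a b; apply: linext => u /=; rewrite scalerDl. Qed.
HB.instance Definition _ := GRing.Zmodule_isLmodule.Build K {linear U -> W}
  hscaleA hscale1 hscaleDr hscaleDl.

Lemma lin0E u : (0 : {linear U -> W}) u = 0. Proof. by []. Qed.
Lemma linDE (f g : {linear U -> W}) u : (f + g) u = f u + g u.
Proof. by []. Qed.
Lemma linNE (f : {linear U -> W}) u : (- f) u = - f u.
Proof. by []. Qed.
Lemma linZE a (f : {linear U -> W}) u : (a *: f) u = a *: f u.
Proof. by []. Qed.
End Hom.

(* A superspace is a vector space with the two projections onto its even     *)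
(* (false) and odd (true) components.                                        *)
HB.mixin Record isSuper (K : fieldType) V of GRing.Lmodule K V := {
  spr : bool -> V -> V;
  spr_is_linear : forall i, linear (spr i);
  sprK : forall i j v, spr i (spr j v) = if i == j then spr j v else 0;
  spr_sum : forall v, spr false v + spr true v = v
}.

#[short(type="superType")]
HB.structure Definition Super (K : fieldType) :=
  {V of isSuper K V & GRing.Lmodule K V}.

HB.instance Definition _ (K : fieldType) (V : superType K) i :=
  GRing.isLinear.Build K V V *:%R (@spr K V i) (spr_is_linear i).

Definition has_parity (K : fieldType) (V : superType K) (i : bool) (v : V) :=
  spr i v = v.

Section SuperHom.
Context {K : fieldType} {V W : superType K}.

(* the parity-i part of f sends V_j to W_{i+j} *)
Let hspr_lin i (f : {linear V -> W}) :
  linear (fun v => spr i (f (spr false v)) + spr (~~ i) (f (spr true v))).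
Proof. by move=> k u v; rewrite !linearP scalerDr addrACA. Qed.
Let hspr i f := mklin (hspr_lin i f).
Let hspr_linear i : linear (hspr i).
Proof.
move=> k f g; apply: linext => v /=.
by rewrite !linearP scalerDr addrACA.
Qed.
Let hsprK i j f : hspr i (hspr j f) = if i == j then hspr j f else 0.
Proof.
apply: linext => v /=; rewrite !linearD /= !sprK /= !linear0 /= ?addr0 ?add0r.
by case: i j => [] [] /=; rewrite ?linear0 ?lin0E ?addr0 ?add0r /= ?sprK //=
  ?linear0 ?addr0 ?add0r.
Qed.
Let hspr_sum f : hspr false f + hspr true f = f.
Proof.
apply: linext => v; rewrite linDE /=.
by rewrite addrACA spr_sum [X in _ + X]addrC spr_sum -linearD spr_sum.
Qed.
HB.instance Definition _ :=
  isSuper.Build K {linear V -> W} hspr_linear hsprK hspr_sum.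
End SuperHom.

Record evenHom (K : fieldType) (V W : superType K) := EvenHom {
  evenHom_lin :> {linear V -> W};
  evenHomP : forall i v, evenHom_lin (spr i v) = spr i (evenHom_lin v)
}.

Section GradedSubspace.
Context {K : fieldType} {W : superType K}.

Record gsub := Gsub {
  gmem :> W -> Prop;
  gsub0 : gmem 0;
  gsub_lin : forall k u v, gmem u -> gmem v -> gmem (k *: u + v);
  gsub_spr : forall i u, gmem u -> gmem (spr i u)
}.

Variable U : gsub.
Definition gpred : {pred W} := fun w => `[< U w >].

Record gsub_type := GsubType { gval : W; _ : gval \in gpred }.
HB.instance Definition _ := [isSub for gval].
HB.instance Definition _ := [Choice of gsub_type by <:].

Let gpred_closed : subsemimod_closed gpred.
Proof.
split.
  split=> [|u v /asboolP Uu /asboolP Uv]; apply/asboolP; first exact: gsub0.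
  by rewrite -[u]scale1r; exact: gsub_lin.
move=> k u /asboolP Uu; apply/asboolP; rewrite -[k *: u]addr0.
by apply: gsub_lin => //; exact: gsub0.
Qed.
HB.instance Definition _ :=
  GRing.SubChoice_isSubLmodule.Build K W gpred gsub_type gpred_closed.

Let gspr_subproof i (u : gsub_type) : spr i (val u) \in gpred.
Proof. by apply/asboolP/gsub_spr/asboolP; exact: (valP u). Qed.
Let gspr i (u : gsub_type) : gsub_type := GsubType (gspr_subproof i u).
Let gspr_linear i : linear (gspr i).
Proof. by move=> k u v; apply: val_inj; rewrite /= !linearP. Qed.
Let gsprK i j u : gspr i (gspr j u) = if i == j then gspr j u else 0.
Proof. by apply: val_inj; rewrite /= sprK; case: eqP. Qed.
Let gspr_sum u : gspr false u + gspr true u = u.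
Proof. by apply: val_inj; rewrite /= spr_sum. Qed.
HB.instance Definition _ :=
  isSuper.Build K gsub_type gspr_linear gsprK gspr_sum.

Let gval_linear : linear gval.
Proof. by move=> k u v; rewrite -[gval]/(val) linearP. Qed.
Definition gincl : {linear gsub_type -> W} := mklin gval_linear.
End GradedSubspace.
Coercion gsub_type : gsub >-> Sortclass.
Arguments gsub {K} W.
Arguments gincl {K W} U.

Section Image.
Context {K : fieldType} {V W : superType K} (f : evenHom V W).

Definition image_gsub : gsub W.
Proof.
apply: (@Gsub K W (fun w => exists v, f v = w)).
- by exists 0; rewrite linear0.
- by move=> k _ _ [u <-] [v <-]; exists (k *: u + v); rewrite linearP.
- by move=> i _ [u <-]; exists (spr i u); rewrite evenHomP.
Defined.

Lemma image_mem v : f v \in gpred image_gsub.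
Proof. by apply/asboolP; exists v. Qed.
Let corestr_linear : linear (fun v => GsubType (image_mem v)).
Proof. by move=> k u v; apply: val_inj; rewrite /= linearP. Qed.
Definition corestr : {linear V -> image_gsub} := mklin corestr_linear.
End Image.

Definition bilin (K : fieldType) (U W M : lmodType K) (B : U -> W -> M) :=
  (forall w, linear (B^~ w)) /\ (forall u, linear (B u)).

Definition lcomp (K : fieldType) (U W M : lmodType K) (g : {linear W -> M})
  (f : {linear U -> W}) : {linear U -> M} := g \o f.

Lemma lcompE (K : fieldType) (U W M : lmodType K) (g : {linear W -> M})
  (f : {linear U -> W}) u : lcomp g f u = g (f u).
Proof. by []. Qed.

Lemma lcomp_bilin (K : fieldType) (U W M : lmodType K) :
  bilin (@lcomp K U W M).
Proof.
by split=> [f|g] k a b; apply: linext => u //; exact: (linearP g).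
Qed.

(* The tensor product: formal sums of pairs (u, w), two of them being equal  *)
(* when every bilinear map gives them the same value.                        *)
Section Tensor.
Context {K : fieldType} {U W : lmodType K}.

Definition bsum (M : lmodType K) (B : U -> W -> M) (s : seq (U * W)) : M :=
  \sum_(p <- s) B p.1 p.2.

Definition teqv (s t : seq (U * W)) : bool :=
  `[< forall (M : lmodType K) (B : U -> W -> M), bilin B ->
      bsum B s = bsum B t >].

Let teqv_refl : reflexive teqv. Proof. by move=> s; apply/asboolP. Qed.
Let teqv_sym : symmetric teqv.
Proof.
by move=> s t; apply/asboolP/asboolP => h M B bB; rewrite (h M B bB).
Qed.
Let teqv_trans : transitive teqv.
Proof.
move=> t s r /asboolP h1 /asboolP h2; apply/asboolP => M B bB.
by rewrite (h1 M B bB) (h2 M B bB).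
Qed.
Canonical teqv_equiv := EquivRel teqv teqv_refl teqv_sym teqv_trans.

Definition tensor := {eq_quot teqv}.
HB.instance Definition _ := Choice.on tensor.

Definition tensor_ev (M : lmodType K) (B : U -> W -> M) (x : tensor) : M :=
  bsum B (repr x).

Lemma tensor_ev_pi (M : lmodType K) (B : U -> W -> M) s :
  bilin B -> tensor_ev B (\pi_tensor s) = bsum B s.
Proof.
move=> bB; have /eqmodP/asboolP h : \pi_tensor (repr (\pi_tensor s)) = \pi s.
  exact: reprK.
exact: h.
Qed.

Lemma tensorP (x y : tensor) :
  (forall (M : lmodType K) (B : U -> W -> M), bilin B ->
     tensor_ev B x = tensor_ev B y) <-> x = y.
Proof.
split=> [h|-> //]; rewrite -[x]reprK -[y]reprK.
by apply/eqmodP/asboolP => M B /h.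
Qed.

Let tadd (x y : tensor) : tensor := \pi_tensor (repr x ++ repr y).
Let tscale (k : K) (x : tensor) : tensor :=
  \pi_tensor [seq (k *: p.1, p.2) | p <- repr x].
Let tzero : tensor := \pi_tensor [::].
Let topp := tscale (-1).

Section Ev.
Variables (M : lmodType K) (B : U -> W -> M) (bB : bilin B).
Let Bl w := mklin (bB.1 w).
Let ev_add x y : tensor_ev B (tadd x y) = tensor_ev B x + tensor_ev B y.
Proof. by rewrite tensor_ev_pi // /bsum big_cat. Qed.
Let ev_scale k x : tensor_ev B (tscale k x) = k *: tensor_ev B x.
Proof.
rewrite tensor_ev_pi // /bsum big_map scaler_sumr; apply: eq_bigr => p _ /=.
exact: (linearZ_LR (Bl p.2)).
Qed.
Let ev_zero : tensor_ev B tzero = 0.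
Proof. by rewrite tensor_ev_pi // /bsum big_nil. Qed.
Let ev_opp x : tensor_ev B (topp x) = - tensor_ev B x.
Proof. by rewrite ev_scale scaleN1r. Qed.
Definition tensor_evE := (ev_add, ev_opp, ev_scale, ev_zero).
End Ev.

Let taddA : associative tadd.
Proof. by move=> x y z; apply/tensorP => M B bB; rewrite !tensor_evE ?addrA. Qed.
Let taddC : commutative tadd.
Proof. by move=> x y; apply/tensorP => M B bB; rewrite !tensor_evE // addrC. Qed.
Let tadd0 : left_id tzero tadd.
Proof. by move=> x; apply/tensorP => M B bB; rewrite !tensor_evE // add0r. Qed.
Let taddN : left_inverse tzero topp tadd.
Proof. by move=> x; apply/tensorP => M B bB; rewrite !tensor_evE // addNr. Qed.
HB.instance Definition _ := GRing.isZmodule.Build tensor taddA taddC tadd0 taddN.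

Let tscaleA a b x : tscale a (tscale b x) = tscale (a * b) x.
Proof. by apply/tensorP => M B bB; rewrite !tensor_evE // scalerA. Qed.
Let tscale1 : left_id 1 tscale.
Proof. by move=> x; apply/tensorP => M B bB; rewrite !tensor_evE // scale1r. Qed.
Let tscaleDr : right_distributive tscale +%R.
Proof. by move=> a x y; apply/tensorP => M B bB; rewrite !tensor_evE // scalerDr. Qed.
Let tscaleDl x : {morph tscale^~ x : a b / a + b}.
Proof. by move=> a b; apply/tensorP => M B bB; rewrite !tensor_evE // scalerDl. Qed.
HB.instance Definition _ := GRing.Zmodule_isLmodule.Build K tensor
  tscaleA tscale1 tscaleDr tscaleDl.

Definition tens (u : U) (w : W) : tensor := \pi_tensor [:: (u, w)].

Lemma tensor_ev_tens (M : lmodType K) (B : U -> W -> M) u w :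
  bilin B -> tensor_ev B (tens u w) = B u w.
Proof. by move=> bB; rewrite tensor_ev_pi // /bsum big_seq1. Qed.

Lemma tensor_ev_linear (M : lmodType K) (B : U -> W -> M) :
  bilin B -> linear (tensor_ev B).
Proof. by move=> bB k x y; rewrite !tensor_evE. Qed.

Lemma tens_bilin : bilin tens.
Proof.
split=> [w|u] k a b; apply/tensorP => M B bB.
  by rewrite (tensor_ev_linear bB) !tensor_ev_tens // bB.1.
by rewrite (tensor_ev_linear bB) !tensor_ev_tens // bB.2.
Qed.

Definition tlift (M : lmodType K) (B : U -> W -> M) (bB : bilin B) :
  {linear tensor -> M} := mklin (tensor_ev_linear bB).

Lemma tliftE (M : lmodType K) (B : U -> W -> M) (bB : bilin B) u w :
  tlift bB (tens u w) = B u w.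
Proof. exact: tensor_ev_tens. Qed.

Lemma tensor_sum (x : tensor) : x = \sum_(p <- repr x) tens p.1 p.2.
Proof.
apply/tensorP => M B bB; rewrite -[LHS]/(bsum B _) -[RHS]/(tlift bB _) linear_sum.
by apply: eq_bigr => p _; rewrite tliftE.
Qed.

Lemma tensor_linext (M : lmodType K) (f g : {linear tensor -> M}) :
  (forall u w, f (tens u w) = g (tens u w)) -> f = g.
Proof.
move=> fg; apply: linext => x; rewrite [x]tensor_sum !linear_sum.
by apply: eq_bigr => p _; exact: fg.
Qed.
End Tensor.
Arguments tensor {K} U W.
Arguments tlift : simpl never.
Notation "u *t w" := (tens u w) (at level 40, left associativity).

Section TensorMap.
Context {K : fieldType} {U W U' W' : lmodType K}.

Let tmap_bilin (f : {linear U -> U'}) (g : {linear W -> W'}) :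
  bilin (fun u w => f u *t g w).
Proof.
by split=> [w|u] k a b; rewrite linearP ?(tens_bilin.1 (g w)) ?(tens_bilin.2 (f u)).
Qed.

(* No sign: this is the tensor product of maps only when g is even.          *)
Definition tmap f g : {linear tensor U W -> tensor U' W'} :=
  tlift (tmap_bilin f g).

Lemma tmapE f g u w : tmap f g (u *t w) = f u *t g w.
Proof. exact: tliftE. Qed.

Lemma tmap_bilinear : bilin tmap.
Proof.
split=> [g|f] k a b; apply: tensor_linext => u w; rewrite linDE linZE !tmapE.
  exact: tens_bilin.1.
exact: tens_bilin.2.
Qed.
End TensorMap.
Arguments tmap : simpl never.

Section SuperTensor.
Context {K : fieldType} {U W : superType K}.

Let sprl (V : superType K) i : {linear V -> V} := @spr K V i.
Let tspr i : {linear tensor U W -> tensor U W} :=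
  tmap (sprl U false) (sprl W i) + tmap (sprl U true) (sprl W (~~ i)).
Let tsprE i u w :
  tspr i (u *t w) = spr false u *t spr i w + spr true u *t spr (~~ i) w.
Proof. by rewrite linDE !tmapE. Qed.
Let tspr_linear i : linear (tspr i). Proof. exact: linearP. Qed.
Let tens0l (w : W) : (0 : U) *t w = 0.
Proof. by have /= := linear0 (mklin ((@tens_bilin K U W).1 w)). Qed.
Let tens0r (u : U) : u *t (0 : W) = 0.
Proof. by have /= := linear0 (mklin ((@tens_bilin K U W).2 u)). Qed.
Let tsprK i j x : tspr i (tspr j x) = if i == j then tspr j x else 0.
Proof.
have E : (tspr i \o tspr j : {linear _ -> _}) = if i == j then tspr j else 0.
  apply: tensor_linext => u w; rewrite -[LHS]/(tspr i (tspr j (u *t w))).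
  rewrite tsprE linearD !tsprE !sprK.
  rewrite (fun_if (fun f : {linear _ -> _} => f (u *t w))) tsprE lin0E.
  by case: i j => [] [] /=; rewrite ?tens0l ?tens0r ?add0r ?addr0.
by rewrite -[LHS]/((tspr i \o tspr j : {linear _ -> _}) x) E; case: eqP.
Qed.
Let tspr_sum x : tspr false x + tspr true x = x.
Proof.
have E : tspr false + tspr true = (idfun : {linear tensor U W -> tensor U W}).
  apply: tensor_linext => u w; rewrite linDE !tsprE /= addrACA.
  rewrite [X in _ + X]addrC -(linearD (mklin ((@tens_bilin K U W).2 (spr false u)))).
  rewrite -(linearD (mklin ((@tens_bilin K U W).2 (spr true u)))) !spr_sum.
  by rewrite -(linearD (mklin ((@tens_bilin K U W).1 w))) /= spr_sum.
by rewrite -linDE E.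
Qed.
HB.instance Definition _ :=
  isSuper.Build K (tensor U W) tspr_linear tsprK tspr_sum.
End SuperTensor.

Section TensorOperators.
Context {K : fieldType}.

Section Assoc.
Context {U V W : lmodType K}.

Let tensl (V' W' : lmodType K) (w : W') : {linear V' -> tensor V' W'} :=
  mklin (tens_bilin.1 w).
Let tensr (V' W' : lmodType K) (v : V') : {linear W' -> tensor V' W'} :=
  mklin (tens_bilin.2 v).

Let tassoc_bilin :
  bilin (fun (t : tensor U V) (w : W) => tmap (idfun : {linear U -> U}) (tensl V w) t).
Proof.
split=> [w|t] k a b; first exact: linearP.
have -> : tensl V (k *: a + b) = k *: tensl V a + tensl V b.
  by apply: linext => v; exact: tens_bilin.2.
by rewrite tmap_bilinear.2.
Qed.

(* (u *t v) *t w |-> u *t (v *t w), and its inverse *)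
Definition tassoc : {linear tensor (tensor U V) W -> tensor U (tensor V W)} :=
  tlift tassoc_bilin.

Let tunassoc_bilin :
  bilin (fun (u : U) (t : tensor V W) => tmap (tensr V u) (idfun : {linear W -> W}) t).
Proof.
split=> [t|u] k a b; last exact: linearP.
have -> : tensr V (k *: a + b) = k *: tensr V a + tensr V b.
  by apply: linext => v; exact: tens_bilin.1.
by rewrite tmap_bilinear.1.
Qed.

Definition tunassoc : {linear tensor U (tensor V W) -> tensor (tensor U V) W} :=
  tlift tunassoc_bilin.

Lemma tassocE u v w : tassoc ((u *t v) *t w) = u *t (v *t w).
Proof. by rewrite tliftE tmapE. Qed.
Lemma tunassocE u v w : tunassoc (u *t (v *t w)) = (u *t v) *t w.
Proof. by rewrite tliftE tmapE. Qed.
End Assoc.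

Let tflip_bilin (U W : lmodType K) : bilin (fun (u : U) (w : W) => w *t u).
Proof. by split=> [w|u] k a b; [exact: tens_bilin.2|exact: tens_bilin.1]. Qed.

(* P (u *t w) = (-1)^(p(u) p(w)) w *t u, with i = p(u) and j = p(w) *)
Definition tswap {U W : superType K} : {linear tensor U W -> tensor W U} :=
  \sum_(i : bool) \sum_(j : bool) (-1) ^+ (i && j) *:
    lcomp (tlift (tflip_bilin U W))
      (tmap (spr i : {linear U -> U}) (spr j : {linear W -> W})).

Lemma tswapE (U W : superType K) i j (u : U) (w : W) :
  has_parity i u -> has_parity j w ->
  tswap (u *t w) = (-1) ^+ (i && j) *: (w *t u).
Proof.
move=> iu jw.
have E k l : lcomp (tlift (tflip_bilin U W))
    (tmap (spr k : {linear U -> U}) (spr l : {linear W -> W})) (u *t w) =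
  spr l w *t spr k u.
  by rewrite lcompE tmapE tliftE.
rewrite /tswap !big_bool !linDE !linZE !E -iu -jw !sprK.
have z0 (x : U) : (0 : W) *t x = 0.
  exact: (linear0 (mklin (tens_bilin.1 x))).
have z1 (x : W) : x *t (0 : U) = 0.
  exact: (linear0 (mklin (tens_bilin.2 x))).
by case: i j {iu jw} => [] [] /=; rewrite ?z0 ?z1 ?scaler0 ?addr0 ?add0r.
Qed.

Section Act.
Context {U : superType K}.
Local Notation End_U := {linear U -> U}.

(* (phi (x) psi) (a *t b) = (-1)^(p(psi) p(a)) phi a *t psi b, with           *)
(* i = p(psi) and j = p(a)                                                   *)
Definition smap (phi psi : End_U) : {linear tensor U U -> tensor U U} :=
  \sum_(i : bool) \sum_(j : bool) (-1) ^+ (i && j) *: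
    tmap (lcomp phi (spr j : End_U)) (spr i psi).

Lemma smapE i j (phi psi : End_U) a b :
  has_parity i psi -> has_parity j a ->
  smap phi psi (a *t b) = (-1) ^+ (i && j) *: (phi a *t psi b).
Proof.
move=> ip ja.
have F k : spr k psi = if k == i then psi else 0 by rewrite -{1}ip sprK ip.
have G k : (spr k : End_U) a = if k == j then a else 0.
  by rewrite -[LHS]/(spr k a) -{1}ja sprK ja.
rewrite /smap !big_bool !linDE !linZE !tmapE !lcompE !F !G.
have z0 (x : U) : (0 : U) *t x = 0.
  exact: (linear0 (mklin (tens_bilin.1 x))).
have z1 (x : U) : x *t (0 : U) = 0.
  exact: (linear0 (mklin (tens_bilin.2 x))).
by case: i j {ip ja F G} => [] [] /=;
  rewrite ?linear0 ?lin0E ?z0 ?z1 ?scaler0 ?addr0 ?add0r.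
Qed.

Let smap_bilin : bilin smap.
Proof.
split=> [psi|phi] k a b; rewrite /smap scaler_sumr -big_split; apply: eq_bigr => i _;
  rewrite scaler_sumr -big_split; apply: eq_bigr => j _ /=.
  by rewrite (lcomp_bilin _ _ _).1 tmap_bilinear.1 scalerDr !scalerA mulrC.
by rewrite linearP tmap_bilinear.2 scalerDr !scalerA mulrC.
Qed.

(* the action of End(U) (x) End(U) on U (x) U *)
Definition tact : {linear tensor End_U End_U -> {linear tensor U U -> tensor U U}} :=
  tlift smap_bilin.

Lemma tactE phi psi : tact (phi *t psi) = smap phi psi.
Proof. exact: tliftE. Qed.

(* X (x) I and I (x) X on U^(x)3, the latter for X even *)
Definition leg12 (X : {linear tensor U U -> tensor U U}) :
    {linear tensor (tensor U U) U -> tensor (tensor U U) U} :=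
  tmap X (idfun : End_U).
Definition leg23 (X : {linear tensor U U -> tensor U U}) :
    {linear tensor (tensor U U) U -> tensor (tensor U U) U} :=
  lcomp tunassoc (lcomp (tmap (idfun : End_U) X) tassoc).
Definition leg13 (X : {linear tensor U U -> tensor U U}) :
    {linear tensor (tensor U U) U -> tensor (tensor U U) U} :=
  lcomp (leg23 tswap) (lcomp (leg12 X) (leg23 tswap)).

(* The supercommutators are commutators because S is even. *)
Record braiding_map (s : tensor End_U End_U) : Prop := BraidingMap {
  braiding_even : has_parity false s;
  braiding_swap : forall x, tact s (tswap x) = tswap (tact s x);
  braiding_12_23 : forall x,
    leg12 (tact s) (leg23 (tact s) x) = leg23 (tact s) (leg12 (tact s) x);
  braiding_13_23 : forall x,
    leg13 (tact s) (leg23 (tact s) x) = leg23 (tact s) (leg13 (tact s) x);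
  braiding_12_13 : forall x,
    leg12 (tact s) (leg13 (tact s) x) = leg13 (tact s) (leg12 (tact s) x)
}.
End Act.
End TensorOperators.

Section LogLaurent.
Context {K : fieldType} {V : superType K}.

(* f k n is the coefficient of zeta^k z^n                                    *)
Definition llpred : {pred (nat -> int -> V)} := fun f =>
  `[< exists N : nat, forall k n,
        (N <= k)%N || (n < - N%:Z) -> f k n = 0 >].

Record loglaurent := LogLaurent { llcoef :> nat -> int -> V; _ : llcoef \in llpred }.
HB.instance Definition _ := [isSub for llcoef].
HB.instance Definition _ := [Choice of loglaurent by <:].

Let llpred_closed : subsemimod_closed llpred.
Proof.
split; first (split=> [|f g /asboolP[N fN] /asboolP[M gM]]; apply/asboolP).
- by exists 0%N.
- exists (maxn N M) => k n kn; rewrite !addrfctE fN ?gM ?addr0 //.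
    move: kn => /orP[h|h]; apply/orP; [left|right].
      by rewrite (leq_trans _ h) // leq_maxr.
    by rewrite (lt_le_trans h) // lerN2 lez_nat leq_maxr.
  move: kn => /orP[h|h]; apply/orP; [left|right].
    by rewrite (leq_trans _ h) // leq_maxl.
  by rewrite (lt_le_trans h) // lerN2 lez_nat leq_maxl.
- move=> a f /asboolP[N fN]; apply/asboolP; exists N => k n kn.
  by rewrite !scalrfctE fN ?scaler0.
Qed.
HB.instance Definition _ := GRing.SubChoice_isSubLmodule.Build K (nat -> int -> V)
  llpred loglaurent llpred_closed.

Lemma llext (f g : loglaurent) : (forall k n, f k n = g k n) -> f = g.
Proof. by move=> fg; apply/val_inj/funext => k; apply/funext => n; exact: fg. Qed.
Lemma ll_linE a (f g : loglaurent) k n : (a *: f + g) k n = a *: f k n + g k n.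
Proof. by rewrite -[llcoef]/(val) linearP. Qed.

Let coef_linear k n : linear (fun f : loglaurent => f k n).
Proof. by move=> a f g; exact: ll_linE. Qed.
Definition llcoef_lin k n : {linear loglaurent -> V} := mklin (coef_linear k n).

Let llmap_sub (phi : {linear V -> V}) (f : loglaurent) :
  (fun k n => phi (f k n)) \in llpred.
Proof.
case: f => f /= /asboolP[N fN]; apply/asboolP; exists N => k n kn.
by rewrite fN // linear0.
Qed.
Let llmap_linear (phi : {linear V -> V}) :
  linear (fun f => LogLaurent (llmap_sub phi f)).
Proof. by move=> a f g; apply: llext => k n; rewrite ll_linE /= linearP. Qed.
Definition llmap (phi : {linear V -> V}) : {linear loglaurent -> loglaurent} :=
  mklin (llmap_linear phi).

Let llspr i := llmap (spr i : {linear V -> V}).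
Let llspr_linear i : linear (llspr i). Proof. exact: linearP. Qed.
Let llsprK i j f : llspr i (llspr j f) = if i == j then llspr j f else 0.
Proof. by apply: llext => k n /=; rewrite sprK; case: eqP. Qed.
Let llspr_sum f : llspr false f + llspr true f = f.
Proof.
apply: llext => k n; rewrite -[llspr false f]scale1r ll_linE scale1r /=.
exact: spr_sum.
Qed.
HB.instance Definition _ :=
  isSuper.Build K loglaurent llspr_linear llsprK llspr_sum.

(* D_z = d/dz + z^-1 d/dzeta *)
Let llD_sub (f : loglaurent) :
  (fun k n => (n + 1)%:~R *: f k (n + 1) + k.+1%:R *: f k.+1 (n + 1)) \in llpred.
Proof.
case: f => f /= /asboolP[N fN]; apply/asboolP; exists N.+1 => k n kn.
have kn' : (N <= k)%N || (n + 1 < - N%:Z).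
  case/orP: kn => [/ltnW->//|h]; apply/orP; right.
  by move: h; rewrite -addn1 PoszD opprD ltrBrDr.
rewrite !fN ?scaler0 ?addr0 //.
by case/orP: kn' => [h|->]; rewrite ?orbT // (leqW h).
Qed.
Let llD_linear : linear (fun f => LogLaurent (llD_sub f)).
Proof.
move=> a f g; apply: llext => k n; rewrite ll_linE /= !scalerDr !scalerA.
by rewrite ![a * _]mulrC addrACA.
Qed.
Definition llD : {linear loglaurent -> loglaurent} := mklin llD_linear.
End LogLaurent.
Arguments loglaurent {K} V.

Notation LF V := {linear V -> loglaurent V}.

Section LogField.
Context {K : fieldType} {V : superType K}.
Local Notation End_V := {linear V -> V}.
Local Notation LFV := (LF V).

Let Dz_linear : linear (fun a : LFV => lcomp llD a).
Proof. by move=> k a b; apply: linext => v; exact: linearP. Qed.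
Definition Dz : {linear LFV -> LFV} := mklin Dz_linear.

(* phi a - (-1)^(p(phi) p(a)) a phi, with phi acting on the coefficients,     *)
(* i = p(phi) and j = p(a)                                                   *)
Definition scomm (phi : End_V) (a : LFV) : LFV :=
  lcomp (llmap phi) a -
  \sum_(i : bool) \sum_(j : bool) (-1) ^+ (i && j) *:
    lcomp (spr j a : LFV) (spr i phi : End_V).

Let scomm_linr phi : linear (scomm phi).
Proof.
move=> k a b; rewrite /scomm ((lcomp_bilin _ _ _).2 (llmap phi)) scalerBr.
rewrite addrACA; congr (_ + _).
rewrite -opprD; congr (- _); rewrite scaler_sumr -big_split.
apply: eq_bigr => i _; rewrite scaler_sumr -big_split; apply: eq_bigr => j _ /=.
by rewrite linearP (lcomp_bilin _ _ _).1 scalerDr !scalerA mulrC.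
Qed.
Let ad_subproof : linear (fun phi => mklin (scomm_linr phi)).
Proof.
move=> k phi psi; apply: linext => a; rewrite linDE linZE /= /scomm.
have -> : llmap (k *: phi + psi) = k *: llmap phi + llmap psi.
  by apply: linext => f; apply: llext => m n; rewrite linDE linZE ll_linE.
rewrite (lcomp_bilin _ _ _).1 scalerBr addrACA; congr (_ + _).
rewrite -opprD; congr (- _); rewrite scaler_sumr -big_split.
apply: eq_bigr => i _; rewrite scaler_sumr -big_split; apply: eq_bigr => j _ /=.
by rewrite linearP (lcomp_bilin _ _ _).2 scalerDr !scalerA mulrC.
Qed.
Definition ad : {linear End_V -> {linear LFV -> LFV}} := mklin ad_subproof.

Definition adad (s : tensor End_V End_V) :
    tensor {linear LFV -> LFV} {linear LFV -> LFV} := tmap ad ad s.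
End LogField.

Section Series2.
Context {K : fieldType} {V : lmodType K}.

(* f n1 n2 k1 k2 is the coefficient of z1^n1 z2^n2 zeta1^k1 zeta2^k2          *)
Local Notation series2 := (int -> int -> nat -> nat -> V).
Implicit Type f : series2.

Definition mulz12 f : series2 := fun n1 n2 k1 k2 =>
  f (n1 - 1) n2 k1 k2 - f n1 (n2 - 1) k1 k2.

(* The sums over m below have finitely many nonzero terms as soon as f is     *)
(* bounded below in z2 for theta12, and in z1 for theta21.                   *)
Definition theta12 f : series2 := fun n1 n2 k1 k2 =>
  (if k1 is k.+1 then f n1 n2 k k2 else 0) -
  \sum_(m \in [set m : nat | (0 < m)%N])
     m%:R^-1 *: f (n1 + m%:Z) (n2 - m%:Z) k1 k2.

Definition theta21 f : series2 := fun n1 n2 k1 k2 =>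
  (if k2 is k.+1 then f n1 n2 k1 k else 0) -
  \sum_(m \in [set m : nat | (0 < m)%N])
     m%:R^-1 *: f (n1 - m%:Z) (n2 + m%:Z) k1 k2.

(* sum_r theta^r g_r / r!, for g_r vanishing when r is large: this is         *)
(* e^(theta S) x when g_r is the series S^r x                                *)
Definition exp_theta (theta : series2 -> series2) (g : nat -> series2) :
    series2 := fun n1 n2 k1 k2 =>
  \sum_(r \in [set: nat]) (r`!%:R)^-1 *: iter r theta (g r) n1 n2 k1 k2.

(* D_(z1) = d/dz1 + z1^-1 d/dzeta1 *)
Definition Dz1 f : series2 := fun n1 n2 k1 k2 =>
  (n1 + 1)%:~R *: f (n1 + 1) n2 k1 k2 +
  k1.+1%:R *: f (n1 + 1) n2 k1.+1 k2.

(* D_(z1)^(p) = D_(z1)^p / p! for p >= 0, and 0 for p < 0 *)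
Definition Dz1_div (p : int) f : series2 := fun n1 n2 k1 k2 =>
  if p is Posz q then (q`!%:R)^-1 *: iter q Dz1 f n1 n2 k1 k2 else 0.

(* the coefficient of zeta^k z^n in f at z1 = z2 = z and zeta1 = zeta2 = zeta, *)
(* for f bounded below in z1 and z2                                          *)
Definition diag f (k : nat) (n : int) : V :=
  \sum_(n1 \in [set: int]) \sum_(l < k.+1) f n1 (n - n1) l (k - l)%N.
End Series2.
Notation series2 V := (int -> int -> nat -> nat -> V).

Section Products.
Context {K : fieldType} {V : superType K}.

Let mu12_bilin (v : V) : bilin (fun a b : LF V =>
  (fun n1 n2 k1 k2 => a (b v k2 n2) k1 n1) : series2 V).
Proof.
split=> [b|a] k f g; do 4 apply/funext => ?.
  by rewrite linDE linZE ll_linE.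
by rewrite linDE linZE ll_linE linearP ll_linE.
Qed.

(* a *t b |-> a(z1) b(z2) v *)
Definition mu12 (v : V) : {linear tensor (LF V) (LF V) -> series2 V} :=
  tlift (mu12_bilin v).

Let mu21_bilin (v : V) : bilin (fun a b : LF V =>
  (fun n1 n2 k1 k2 => a (b v k1 n1) k2 n2) : series2 V).
Proof.
split=> [b|a] k f g; do 4 apply/funext => ?.
  by rewrite linDE linZE ll_linE.
by rewrite linDE linZE ll_linE linearP ll_linE.
Qed.

(* a *t b |-> a(z2) b(z1) v *)
Definition mu21 (v : V) : {linear tensor (LF V) (LF V) -> series2 V} :=
  tlift (mu21_bilin v).
End Products.

Section HatLocality.
Context {K : fieldType} {V : superType K} {U : gsub (LF V)}.
Local Notation End_U := {linear U -> U}.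
Variable s : tensor End_U End_U.

(* mu (z12^N e^(theta12 S) x) v for x in a(z1) (x) b(z2), where S = tact s;   *)
(* mu is applied before the scalar series act.                               *)
Definition hat_side12 (N : nat) (x : tensor U U) (v : V) : series2 V :=
  iter N mulz12 (exp_theta theta12
    (fun r => mu12 v (tmap (gincl U) (gincl U) (iter r (tact s) x)))).

Definition hat_side21 (N : nat) (x : tensor U U) (v : V) : series2 V :=
  iter N mulz12 (exp_theta theta21
    (fun r => mu21 v (tmap (gincl U) (gincl U) (iter r (tact s) x)))).

Definition hat_local_at (N : nat) (a b : U) :=
  forall v, hat_side12 N (a *t b) v = hat_side21 N (tswap (a *t b)) v.

(* S-hat is an element of End(U) (x) End(U), so that its components preserve  *)
(* U by their type.                                                          *)
Record hat_local : Prop := HatLocal {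
  hat_local_nilp : forall a b : U,
    exists2 r, (0 < r)%N & iter r (tact s) (a *t b) = 0;
  hat_localP : forall a b : U, exists N, hat_local_at N a b
}.

(* c = a_(n + S-hat) b *)
Definition hat_product (n : int) (a b : U) (c : LF V) :=
  exists2 N : nat, hat_local_at N a b &
    forall v k m,
      c v k m = diag (Dz1_div (N%:Z - 1 - n) (hat_side12 N (a *t b) v)) k m.
End HatLocality.

Section LogVA.
Context {K : fieldType} {V : superType K}.
Variables (vac : V) (T : evenHom V V) (Y : evenHom V (LF V)).
Local Notation End_V := {linear V -> V}.

Record vacuum_axiom : Prop := VacuumAxiom {
  vac_even : has_parity false vac;
  vac_id : forall v k n,
    Y vac v k n = if (k == 0%N) && (n == 0) then v else 0;
  vac_series : forall a k n, (0 < k)%N || (n < 0) -> Y a vac k n = 0;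
  vac_init : forall a, Y a vac 0%N 0 = a;
  vac_T : T vac = 0
}.

Definition covariance := forall a, ad T (Y a) = Dz (Y a).

Definition restricts (W : superType K) (U : gsub W) (f : {linear W -> W})
    (g : {linear U -> U}) :=
  forall u, gincl U (g u) = f (gincl U u).

Let U := image_gsub Y.
Local Notation End_U := {linear U -> U}.

(* The identities of hat_adT, hat_Dz and hat_hexagon involve S-hat on         *)
(* D_z Y(a,z), [T, Y(a,z)] and the products, hence include that these fields  *)
(* lie in Y_z(V).                                                            *)
Record hat_logVA (s : tensor End_U End_U) : Prop := HatLogVA {
  hat_vacuum : vacuum_axiom;
  hat_braiding : braiding_map s;
  hat_adT : exists2 g : End_U, restricts (ad T) g &
    forall x, tmap g (idfun : End_U) (tact s x) =
              tact s (tmap g (idfun : End_U) x);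
  hat_Dz : exists2 g : End_U, restricts Dz g &
    forall x, tmap g (idfun : End_U) (tact s x) =
              tact s (tmap g (idfun : End_U) x);
  hat_covariance : covariance;
  hat_locality : hat_local s;
  hat_hexagon : forall n : int, exists2 mu : {linear tensor U U -> U},
    (forall a b : U, hat_product s n a b (gincl U (mu (a *t b)))) &
    (forall x : tensor (tensor U U) U,
       tact s (tmap mu (idfun : End_U) x) =
       tmap mu (idfun : End_U) (leg13 (tact s) x + leg23 (tact s) x))
}.

Let Ycoef_bilin k n : bilin (fun a b => Y a b k n).
Proof.
split=> [b|a] c f g; first by rewrite linearP linDE linZE ll_linE.
by rewrite linearP ll_linE.
Qed.
(* the coefficient of zeta^k z^n in Y(z) : a *t b |-> Y(a,z)b *)
Definition Ycoef k n : {linear tensor V V -> V} := tlift (Ycoef_bilin k n).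

Let YY12_bilin : bilin (fun (t : tensor V V) (c : V) => mu12 c (tmap Y Y t)).
Proof.
split=> [c|t] k f g; first by rewrite !linearP.
have -> : mu12 (k *: f + g) = k *: mu12 f + mu12 g.
  apply: tensor_linext => a b; rewrite linDE linZE !tliftE.
  by do 4 apply/funext => ?; rewrite ?linearP ll_linE ?linearP ?ll_linE.
by rewrite linDE linZE.
Qed.
(* Y(z1) (I (x) Y(z2)) and Y(z2) (I (x) Y(z1)) *)
Definition YY12 : {linear tensor (tensor V V) V -> series2 V} :=
  tlift YY12_bilin.

Let YY21_bilin : bilin (fun (t : tensor V V) (c : V) => mu21 c (tmap Y Y t)).
Proof.
split=> [c|t] k f g; first by rewrite !linearP.
have -> : mu21 (k *: f + g) = k *: mu21 f + mu21 g.
  apply: tensor_linext => a b; rewrite linDE linZE !tliftE.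
  by do 4 apply/funext => ?; rewrite ?linearP ll_linE ?linearP ?ll_linE.
by rewrite linDE linZE.
Qed.
Definition YY21 : {linear tensor (tensor V V) V -> series2 V} :=
  tlift YY21_bilin.

Record logVA (s : tensor End_V End_V) : Prop := LogVA {
  lva_vacuum : vacuum_axiom;
  lva_braiding : braiding_map s;
  lva_covariance : covariance;
  lva_nilp : forall x : tensor V V, exists r, iter r (tact s) x = 0;
  lva_locality : forall a b : V, exists N : nat, forall c : V,
    iter N mulz12 (exp_theta theta12
      (fun r => YY12 (iter r (leg12 (tact s)) ((a *t b) *t c)))) =
    iter N mulz12 (exp_theta theta21
      (fun r => YY21 (iter r (leg12 (tact s)) (tswap (a *t b) *t c))));
  lva_hexagon : forall k n (x : tensor (tensor V V) V),
    tact s (tmap (Ycoef k n) (idfun : End_V) x) =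
    tmap (Ycoef k n) (idfun : End_V) (leg13 (tact s) x + leg23 (tact s) x)
}.

Let ev_vac_linear : linear (fun a : LF V => a vac 0%N 0).
Proof. by move=> k a b; rewrite linDE linZE ll_linE. Qed.
(* a(z) |-> a(z) vac at z = 0, for a(z) vac in V[[z]] *)
Definition ev_vac : {linear LF V -> V} := mklin ev_vac_linear.
End LogVA.
Arguments hat_logVA {K V} vac T Y s.
Arguments logVA {K V} vac T Y s.

(* Main.v *)
Require Import Defs.
From mathcomp Require Import all_boot all_order all_algebra.
From mathcomp Require Import boolp classical_sets functions fsbigop reals.
From mathcomp Require Import complex zify ring.

Set Implicit Arguments.
Unset Strict Implicit.
Unset Printing Implicit Defensive.
Import Order.TTheory GRing.Theory Num.Theory.
Local Open Scope ring_scope.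

(* The vacuum axioms make a |-> Y(a,z) an even isomorphism of V onto Y_z(V),  *)
(* with inverse a(z) |-> a(z)vac at z = 0, so that S and S-hat determine each *)
(* other by transport, and the braiding, nilpotence and locality axioms match.*)
(* Locality tested on the vacuum shows that Y(z) = X(z) exp(-zeta S), where X *)
(* is free of zeta; hence everything reduces to identities for X, in which    *)
(* z12^N e^(theta12 S) becomes z12^N (1 - z2/z1)^S.                           *)
(* From S-hat to S: at the vacuum and z = 0, the n-th product of Y(a,z) and   *)
(* Y(b,z) is the coefficient X_(-n-1)(a,b), so that the two hexagons agree.   *)
(* From S to S-hat: (1) put delta(phi) a = ad(phi) Y(a,z) - Y(phi a,z); the   *)
(* hexagon, evaluated on V, says that (delta (x) 1)(S) = 0, its mirror image  *)
(* that (1 (x) delta)(S) = 0, and so (ad (x) ad)(S) restricts to S-hat.       *)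
(* (2) Y(X_(-n-1)(a,b),z) is the n-th product of Y(a,z) and Y(b,z): locality  *)
(* moves Y(a,z1) and Y(b,z2) in Y(a,z1) Y(b,z2) c to the right of Y(c,z3),    *)
(* where they act on the vacuum; there translation covariance computes the    *)
(* derivatives on the diagonal, and locality of X_(-n-1)(a,b) and c moves the *)
(* result back.                                                               *)

(** * Tensor products of superspaces *)

(** The vacuum axioms make [corestr Y] an even bijection onto [image_gsub Y] with inverse
    [ev_field]. Conjugation by it ([conjt]) turns either braiding map into the other and carries
    braiding, nilpotence and locality along. What needs an argument is the hexagon and, from S to
    S-hat, also the compatibility with T and D_z and the identification with (ad (x) ad)(S).

    Logarithms are eliminated first. On the vacuum, the z2^0 part of e^(theta12 S) Y(z1) Y(z2) vac
    is Y(z1) e^(zeta1 S), and locality shows that it is free of zeta1. Hence d/dzeta Y(z) = - Y(z) S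
    ([Ycoef_log]), and everything reduces to X = [Ycoef Y 0], for which e^(theta12 S12) becomes the
    binomial series (1 - z2/z1)^(S12) ([exp_theta_bet], [locYY_locA]).

    From S-hat to S: at the vacuum and z = 0 the n-th product is X_(-n-1)(a,b) ([diag_vac]), so the
    hexagon for products is the hexagon for X. Higher powers of zeta follow because S12 commutes
    with S13 and S23.

    From S to S-hat, the core is [hat_formula]: the n-th product of Y(a,z) and Y(b,z) is the field
    of X_(-n-1)(a,b). Its zeta-free form is [locD_diag]. Locality of each of a, b with c turns
    X(a,z1) X(b,z2) c into X(c) applied to F(z1,z2) = z12^N (1 - z2/z1)^S X(a,z1) X(b,z2) vac, with
    binomial factors in S13 and S23 ([locD_cross]). F is a power series on which T acts as d/dz1 +
    d/dz2, so its derivatives on the diagonal are explicit ([dF_diag]). The two binomial factors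
    multiply to one in S13 + S23 ([bet_vandermonde]), the hexagon converts this to S, and locality
    of X_(p-N)(a,b) with c brings the result back.

    Finally put delta(phi) a = ad(phi) Y(a,z) - Y(phi a,z). Evaluations separate tensors
    ([tensor_separated]), so the hexagon and its mirror image say that delta (x) 1 and 1 (x) delta
    kill S ([delta_id0], [id_delta0]); hence (ad (x) ad)(S) restricts to S-hat ([tact_adad]). *)

Definition even_map (K : fieldType) (V W : superType K) (f : {linear V -> W}) :=
  forall i v, f (spr i v) = spr i (f v).

Section TensorBasics.
Context {K : fieldType}.

Definition tensl (U W : lmodType K) (w : W) : {linear U -> tensor U W} :=
  mklin (tens_bilin.1 w).
Definition tensr (U W : lmodType K) (u : U) : {linear W -> tensor U W} :=
  mklin (tens_bilin.2 u).

Lemma tens0l (U W : lmodType K) (w : W) : (0 : U) *t w = 0.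
Proof. exact: (linear0 (tensl U w)). Qed.
Lemma tens0r (U W : lmodType K) (u : U) : u *t (0 : W) = 0.
Proof. exact: (linear0 (tensr W u)). Qed.
Lemma tensDl (U W : lmodType K) (u u' : U) (w : W) :
  (u + u') *t w = u *t w + u' *t w.
Proof. exact: (linearD (tensl U w)). Qed.
Lemma tensDr (U W : lmodType K) (u : U) (w w' : W) :
  u *t (w + w') = u *t w + u *t w'.
Proof. exact: (linearD (tensr W u)). Qed.
Lemma tensZl (U W : lmodType K) k (u : U) (w : W) : (k *: u) *t w = k *: (u *t w).
Proof. exact: (linearZ_LR (tensl U w)). Qed.
Lemma tensZr (U W : lmodType K) k (u : U) (w : W) : u *t (k *: w) = k *: (u *t w).
Proof. exact: (linearZ_LR (tensr W u)). Qed.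
Lemma tensNl (U W : lmodType K) (u : U) (w : W) : (- u) *t w = - (u *t w).
Proof. exact: (linearN (tensl U w)). Qed.
Lemma tensNr (U W : lmodType K) (u : U) (w : W) : u *t (- w) = - (u *t w).
Proof. exact: (linearN (tensr W u)). Qed.

Lemma tensor_ind (U W : lmodType K) (P : tensor U W -> Prop) :
  P 0 -> (forall x y, P x -> P y -> P (x + y)) ->
  (forall u w, P (u *t w)) -> forall x, P x.
Proof.
move=> P0 PD Pt x; rewrite [x]tensor_sum; apply: big_ind => // p _; exact: Pt.
Qed.

Lemma tmap_comp (U W U' W' U'' W'' : lmodType K) (f' : {linear U' -> U''})
    (g' : {linear W' -> W''}) (f : {linear U -> U'}) (g : {linear W -> W'}) x :
  tmap f' g' (tmap f g x) = tmap (lcomp f' f) (lcomp g' g) x.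
Proof.
elim/tensor_ind: x => [|x y IHx IHy|u w]; rewrite ?linear0 // ?linearD ?IHx ?IHy //.
by rewrite !tmapE.
Qed.

Lemma tmap_id (U W : lmodType K) (x : tensor U W) :
  tmap (idfun : {linear U -> U}) (idfun : {linear W -> W}) x = x.
Proof.
elim/tensor_ind: x => [|x y IHx IHy|u w]; rewrite ?linear0 // ?linearD ?IHx ?IHy //.
by rewrite !tmapE.
Qed.

Lemma eq_tmap (U W U' W' : lmodType K) (f f' : {linear U -> U'})
    (g g' : {linear W -> W'}) : f =1 f' -> g =1 g' -> tmap f g =1 tmap f' g'.
Proof. by move=> /linext -> /linext ->. Qed.

Lemma tassocK (U V W : lmodType K) : cancel (@tassoc K U V W) (@tunassoc K U V W).
Proof.
elim/tensor_ind => [|x y IHx IHy|t w]; rewrite ?linear0 // ?linearD ?IHx ?IHy //.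
elim/tensor_ind: t => [|x y IHx IHy|u v]; rewrite ?tens0l ?linear0 //.
  by rewrite tensDl !linearD IHx IHy.
by rewrite tassocE tunassocE.
Qed.

Lemma tunassocK (U V W : lmodType K) : cancel (@tunassoc K U V W) (@tassoc K U V W).
Proof.
elim/tensor_ind => [|x y IHx IHy|u t]; rewrite ?linear0 // ?linearD ?IHx ?IHy //.
elim/tensor_ind: t => [|x y IHx IHy|v w]; rewrite ?tens0r ?linear0 //.
  by rewrite tensDr !linearD IHx IHy.
by rewrite tunassocE tassocE.
Qed.
End TensorBasics.

(** * Parity, the signed swap, and operators on the legs of a triple tensor product *)

Section SuperTensorBasics.
Context {K : fieldType}.
Implicit Types U W V : superType K.

Lemma sprD V i (u v : V) : spr i (u + v) = spr i u + spr i v.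
Proof. exact: (linearD (spr i : {linear V -> V})). Qed.
Lemma sprZ V i k (v : V) : spr i (k *: v) = k *: spr i v.
Proof. exact: (linearZ_LR (spr i : {linear V -> V})). Qed.
Lemma spr0 V i : spr i (0 : V) = 0.
Proof. exact: (linear0 (spr i : {linear V -> V})). Qed.

Lemma has_parity_spr V i (v : V) : has_parity i (spr i v).
Proof. by rewrite /has_parity sprK eqxx. Qed.

Lemma spr_parity V i j (v : V) : has_parity i v -> spr j v = if j == i then v else 0.
Proof. by move=> <-; rewrite sprK. Qed.

Lemma super_ind V (P : V -> Prop) : (forall x y, P x -> P y -> P (x + y)) ->
  (forall i v, has_parity i v -> P v) -> forall v, P v.
Proof. by move=> PD Ph v; rewrite -(spr_sum v); apply: PD; apply: Ph; exact: has_parity_spr. Qed.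

Lemma tensor_ind_hom U W (P : tensor U W -> Prop) :
  P 0 -> (forall x y, P x -> P y -> P (x + y)) ->
  (forall i j u w, has_parity i u -> has_parity j w -> P (u *t w)) -> forall x, P x.
Proof.
move=> P0 PD Pt; apply: tensor_ind => // u w.
move: u; apply: super_ind => [x y Px Py|i u iu]; first by rewrite tensDl; exact: PD.
move: w; apply: super_ind => [x y Px Py|j w jw]; first by rewrite tensDr; exact: PD.
exact: (Pt i j).
Qed.

Lemma tensor3_ind_hom U W V (P : tensor (tensor U W) V -> Prop) :
  P 0 -> (forall x y, P x -> P y -> P (x + y)) ->
  (forall i j k u w v, has_parity i u -> has_parity j w -> has_parity k v ->
     P ((u *t w) *t v)) -> forall x, P x.
Proof.
move=> P0 PD Pt; apply: tensor_ind => // t v.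
move: v; apply: super_ind => [x y Px Py|k v kv]; first by rewrite tensDr; exact: PD.
elim/tensor_ind_hom: t => [|x y Px Py|i j u w iu jw]; first by rewrite tens0l.
  by rewrite tensDl; exact: PD.
exact: (Pt i j k).
Qed.

Lemma spr_tens U W i (u : U) (w : W) :
  spr i (u *t w) = spr false u *t spr i w + spr true u *t spr (~~ i) w.
Proof. by rewrite [LHS]linDE !tmapE. Qed.

Lemma has_parity_tens U W i j (u : U) (w : W) :
  has_parity i u -> has_parity j w -> has_parity (i (+) j) (u *t w).
Proof.
move=> iu jw; rewrite /has_parity spr_tens !(spr_parity _ iu) !(spr_parity _ jw).
by case: i j {iu jw} => [] [] /=; rewrite ?tens0l ?tens0r ?addr0 ?add0r.
Qed.

Lemma even_parity V W (f : {linear V -> W}) i v :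
  even_map f -> has_parity i v -> has_parity i (f v).
Proof. by move=> ef iv; rewrite /has_parity -ef iv. Qed.

Lemma even_lcomp U V W (g : {linear V -> W}) (f : {linear U -> V}) :
  even_map g -> even_map f -> even_map (lcomp g f).
Proof. by move=> eg ef i v; rewrite !lcompE ef eg. Qed.

Lemma even_tmap U W U' W' (f : {linear U -> U'}) (g : {linear W -> W'}) :
  even_map f -> even_map g -> even_map (tmap f g).
Proof.
move=> ef eg i; elim/(@tensor_ind K U W) => [|x y IHx IHy|u w].
  by rewrite spr0 !linear0.
  by rewrite sprD (linearD (tmap f g) (spr _ x)) (linearD (tmap f g) x) sprD IHx IHy.
by rewrite spr_tens linearD !tmapE !ef !eg spr_tens.
Qed.

Lemma tswapK U W : cancel (@tswap K U W) (@tswap K W U).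
Proof.
elim/tensor_ind_hom => [|x y IHx IHy|i j u w iu jw]; rewrite ?linear0 //.
  by rewrite !linearD IHx IHy.
rewrite (tswapE iu jw) linearZ_LR (tswapE jw iu) scalerA andbC -expr2.
by rewrite sqrr_sign scale1r.
Qed.

Lemma tswap_nat U W U' W' (f : {linear U -> U'}) (g : {linear W -> W'}) x :
  even_map f -> even_map g -> tswap (tmap f g x) = tmap g f (tswap x).
Proof.
move=> ef eg; elim/tensor_ind_hom: x => [|x y IHx IHy|i j u w iu jw].
- by rewrite !linear0.
- by rewrite !linearD IHx IHy.
rewrite tmapE (tswapE iu jw) (linearZ_LR (tmap g f)) tmapE.
by rewrite (tswapE (even_parity ef iu) (even_parity eg jw)).
Qed.

Lemma even_tswap U W : even_map (@tswap K U W).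
Proof.
move=> k; elim/(@tensor_ind_hom U W) => [|x y IHx IHy|i j u w iu jw].
- by rewrite spr0 !linear0.
- by rewrite sprD (linearD (@tswap K U W) (spr _ x)) (linearD (@tswap K U W) x) sprD IHx IHy.
rewrite (tswapE iu jw) sprZ (spr_parity _ (has_parity_tens iu jw)).
rewrite (spr_parity _ (has_parity_tens jw iu)) addbC.
by case: eqP; rewrite ?linear0 ?scaler0 // (tswapE iu jw).
Qed.

Lemma leg23E U (X : {linear tensor U U -> tensor U U}) x :
  leg23 X x = tunassoc (tmap (idfun : {linear U -> U}) X (tassoc x)).
Proof. by []. Qed.

Lemma leg13E U (X : {linear tensor U U -> tensor U U}) x :
  leg13 X x = leg23 tswap (leg12 X (leg23 tswap x)).
Proof. by []. Qed.

Lemma leg12K U (X X' : {linear tensor U U -> tensor U U}) :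
  cancel X X' -> cancel (leg12 X) (leg12 X').
Proof.
move=> XK x; rewrite /leg12 tmap_comp -[RHS]tmap_id; exact: eq_tmap.
Qed.

Lemma leg23_comp U (X X' : {linear tensor U U -> tensor U U}) x :
  leg23 X (leg23 X' x) = leg23 (lcomp X X') x.
Proof. by rewrite !leg23E tunassocK tmap_comp. Qed.

Lemma leg12_comp U (X X' : {linear tensor U U -> tensor U U}) x :
  leg12 X (leg12 X' x) = leg12 (lcomp X X') x.
Proof. by rewrite /leg12 tmap_comp. Qed.

Lemma leg23_id U (X : {linear tensor U U -> tensor U U}) x : X =1 id -> leg23 X x = x.
Proof.
move=> XE; rewrite leg23E -[RHS]tassocK; congr (tunassoc _).
by rewrite -[RHS]tmap_id; apply: eq_tmap.
Qed.

Lemma leg23P2 U x : leg23 (@tswap K U U) (leg23 tswap x) = x.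
Proof. by rewrite leg23_comp; apply: leg23_id => t; rewrite lcompE tswapK. Qed.
Lemma leg12P2 U x : leg12 (@tswap K U U) (leg12 tswap x) = x.
Proof. by apply: leg12K; exact: tswapK. Qed.

(** Swapping a pair of factors with a third one is a cyclic permutation, hence two adjacent swaps.
    This is how statements pass from one pair of legs to another. *)
Lemma tswap_l3 U (x : tensor (tensor U U) U) :
  tswap x = tassoc (leg12 tswap (leg23 tswap x)).
Proof.
elim/tensor3_ind_hom: x => [|x y IHx IHy|i j k u v w iu jv kw].
- by rewrite !linear0.
- by rewrite !linearD IHx IHy.
rewrite (tswapE (has_parity_tens iu jv) kw) leg23E tassocE tmapE (tswapE jv kw).
rewrite tensZr (linearZ_LR tunassoc) tunassocE (linearZ_LR (leg12 tswap)).
rewrite /leg12 tmapE (tswapE iu kw).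
rewrite tensZl !(linearZ_LR tassoc) tassocE scalerA; congr (_ *: _).
by case: i j k {iu jv kw} => [] [] [] /=; rewrite ?mulr1 ?mul1r ?mulrNN ?mulr1.
Qed.

Lemma tswap_r3 U (x : tensor (tensor U U) U) :
  tswap (tassoc x) = leg23 tswap (leg12 tswap x).
Proof.
elim/tensor3_ind_hom: x => [|x y IHx IHy|i j k u v w iu jv kw].
- by rewrite !linear0.
- by rewrite !linearD IHx IHy.
rewrite tassocE (tswapE iu (has_parity_tens jv kw)) /leg12 tmapE (tswapE iu jv).
rewrite tensZl (linearZ_LR (leg23 tswap)) leg23E tassocE tmapE (tswapE iu kw).
rewrite tensZr (linearZ_LR tunassoc) tunassocE scalerA; congr (_ *: _).
by case: i j k {iu jv kw} => [] [] [] /=; rewrite ?mulr1 ?mul1r ?mulrNN ?mulr1.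
Qed.

Section Legs.
Variables (U : superType K) (S : {linear tensor U U -> tensor U U}).
Hypotheses (eS : even_map S) (SP : forall x, S (tswap x) = tswap (S x)).
Local Notation P12 := (leg12 (@tswap K U U)).
Local Notation P23 := (leg23 (@tswap K U U)).

Lemma leg12SP x : leg12 S (P12 x) = P12 (leg12 S x).
Proof. by rewrite !leg12_comp; apply: eq_tmap => //; exact: SP. Qed.

Lemma leg23SP x : leg23 S (P23 x) = P23 (leg23 S x).
Proof.
rewrite !leg23_comp !leg23E; congr (tunassoc _); by apply: eq_tmap => //; exact: SP.
Qed.

(** By [tswap_r3] this is naturality of the swap with respect to the even map [S]. *)
Lemma leg12_cyc x : leg12 S (P23 (P12 x)) = P23 (P12 (leg23 S x)).
Proof.
by rewrite -!tswap_r3 leg23E tunassocK tswap_nat.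
Qed.

Lemma leg13_12 x : leg12 S (P23 x) = P23 (leg13 S x).
Proof. by rewrite leg13E leg23P2. Qed.

Lemma leg13E' x : leg13 S x = P12 (leg23 S (P12 x)).
Proof.
by rewrite leg13E -{1}[x]leg12P2 leg12_cyc leg23P2.
Qed.

Lemma leg13_cyc x : leg13 S (P23 (P12 x)) = P23 (P12 (leg12 S x)).
Proof. by rewrite leg13E leg23P2 leg12SP. Qed.

Lemma leg23_cyc13 x : leg23 S (P23 (P12 x)) = P23 (P12 (leg13 S x)).
Proof. by rewrite leg23SP leg13E' leg12P2. Qed.

End Legs.

End SuperTensorBasics.

(** * Transport of braiding maps *)

Section Separation.
Context {K : fieldType}.

(* A subspace maximal among those avoiding w is a hyperplane not containing w. *)
Lemma functional_exists (M : lmodType K) (w : M) : w <> 0 ->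
  exists f : {linear M -> K^o}, f w = 1.
Proof.
move=> w0; pose sub (A : set M) := forall (k : K) u v, A u -> A v -> A (k *: u + v).
have [F PF Ftot|A [[subA Aw] Amax]] := @Zorn_bigcup M (fun A => sub A /\ ~ A w).
  split=> [k u v [A FA Au] [B FB Bv]|[A FA Aw]]; last by case: (PF A FA).
  have [AB|BA] := Ftot A B FA FB.
    by exists B => //; apply: (PF B FB).1 => //; exact: AB.
  by exists A => //; apply: (PF A FA).1 => //; exact: BA.
have A0 : A 0.
  apply: contrapT => nA0; apply: (Amax (fun x => x = 0)).
    split=> [x Ax|h]; last exact/nA0/h.
    by have := subA (-1) x x Ax Ax; rewrite scaleN1r addNr => /nA0.
  by split=> [k u v -> ->|//]; rewrite scaler0 addr0.
have AZ k u : A u -> A (k *: u) by move=> Au; rewrite -[_ *: _]addr0; exact: subA.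
have AD u v : A u -> A v -> A (u + v) by move=> Au Av; rewrite -[u]scale1r; exact: subA.
(* If no such c exists, A + K u is a strictly larger subspace that still avoids w. *)
have dec u : exists c : K, A (u - c *: w).
  apply: contrapT => nu.
  have nAu : ~ A u by move=> Au; apply: nu; exists 0; rewrite scale0r subr0.
  apply: (Amax (fun x => exists2 v, A v & exists c : K, x = v + c *: u)).
    split=> [x Ax|h]; first by exists x => //; exists 0; rewrite scale0r addr0.
    by apply/nAu/h; exists 0 => //; exists 1; rewrite scale1r add0r.
  split=> [k _ _ [v Av [c ->]] [v' Av' [c' ->]]|[v Av [c wE]]].
    exists (k *: v + v'); first exact: subA.
    by exists (k * c + c'); rewrite scalerDr scalerDl scalerA addrACA.
  have c0 : c != 0 by apply/eqP => cz; apply: Aw; rewrite wE cz scale0r addr0.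
  apply: nu; exists c^-1; rewrite wE scalerDr scalerA mulVf // scale1r opprD addrCA.
  by rewrite subrr addr0 -scaleNr; exact: AZ.
have uniq u c c' : A (u - c *: w) -> A (u - c' *: w) -> c = c'.
  move=> h /(AZ (-1)) h'; apply/eqP; rewrite eq_sym -subr_eq0; apply: contrapT => /negP cc.
  apply: Aw; have := AZ (c' - c)^-1 _ (AD _ _ h h').
  rewrite scaleN1r opprB [_ + (c' *: w - u)]addrC addrA subrK -scalerBl scalerA.
  by rewrite mulVf // scale1r.
pose f u : K^o := projT1 (cid (dec u)).
have fP u : A (u - f u *: w) by rewrite /f; case: cid.
have fl : linear f.
  move=> k u v; apply: (uniq (k *: u + v)) => //.
  have -> : k *: u + v - (k *: f u + f v) *: w =
      k *: (u - f u *: w) + (v - f v *: w).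
    by rewrite scalerBr scalerDl opprD addrACA scalerA.
  exact: subA.
exists (mklin fl); apply: (uniq w); first exact: fP.
by rewrite scale1r subrr.
Qed.

Let scal_bilin (M M' : lmodType K) (f : {linear M -> K^o}) :
  bilin (fun (m : M) (m' : M') => (f m : K) *: m').
Proof.
by split=> [m'|m] k a b; rewrite ?linearP /= ?scalerDl ?scalerDr !scalerA // mulrC.
Qed.

(** Induction on the number of terms of x. If the first factor f is nonzero, some functional of some
    e i f equals 1; it expresses g through the other second factors, so that the first term is
    absorbed by the rest. *)
Lemma tensor_separated (F G M M' : lmodType K) (I J : Type)
    (e : I -> {linear F -> M}) (e' : J -> {linear G -> M'}) :
  (forall f, (forall i, e i f = 0) -> f = 0) ->
  (forall g, (forall j, e' j g = 0) -> g = 0) ->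
  forall x : tensor F G, (forall i j, tmap (e i) (e' j) x = 0) -> x = 0.
Proof.
move=> eI e'I x; rewrite [x]tensor_sum; move: (repr x) => r {x}.
have [n] := ubnP (size r); elim: n r => // n IHn [|[f g] r] szr h.
  by rewrite big_nil.
have [ef0|/existsNP[i /functional_exists[l lE]]] := pselect (forall i, e i f = 0).
  move: h; rewrite big_cons (eI f ef0) tens0l add0r => h; exact: IHn.
pose c (p : F * G) : K := l (e i p.1).
have gE : g = - \sum_(p <- r) c p *: p.2.
  apply/eqP; rewrite -addr_eq0; apply/eqP/e'I => j.
  pose G' := lcomp (tlift (scal_bilin M' l)) (tmap (e i) (e' j)).
  have GE a b : G' (a *t b) = (l (e i a) : K) *: e' j b.
    by rewrite /G' lcompE tmapE tliftE.
  have : G' (\sum_(p <- (f, g) :: r) p.1 *t p.2) = 0 by rewrite /G' lcompE h linear0.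
  rewrite (linear_sum G') big_cons GE lE scale1r => E; rewrite -[RHS]E linearD linear_sum.
  by congr (_ + _); apply: eq_bigr => p _; rewrite linearZ_LR GE.
have E : \sum_(p <- (f, g) :: r) p.1 *t p.2 =
    \sum_(p <- [seq (p.1 - c p *: f, p.2) | p <- r]) p.1 *t p.2.
  rewrite big_cons big_map /= gE tensNr -[f *t _]/(tensr _ f _) linear_sum /=.
  rewrite -sumrN -big_split; apply: eq_bigr => p _ /=.
  by rewrite tensDl tensNl tensZl tensZr addrC.
by rewrite E; apply: IHn; rewrite ?size_map // => i' j'; rewrite -E.
Qed.
End Separation.

(** * Parity of operators and even tensors of operators *)

Section EvenTensors.
Context {K : fieldType}.
Implicit Types U V W : superType K.

Lemma spr_homE V W i (f : {linear V -> W}) v :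
  spr i f v = spr i (f (spr false v)) + spr (~~ i) (f (spr true v)).
Proof. by []. Qed.

Lemma hom_parity V W i j (f : {linear V -> W}) v :
  has_parity i f -> has_parity j v -> has_parity (i (+) j) (f v).
Proof.
move=> <- jv; rewrite spr_homE !(spr_parity _ jv).
case: i j {jv} => [] [] /=; rewrite ?linear0 ?spr0 ?addr0 ?add0r; exact: has_parity_spr.
Qed.

Lemma hom_parityI V W i (f : {linear V -> W}) :
  (forall j v, has_parity j v -> has_parity (i (+) j) (f v)) -> has_parity i f.
Proof.
move=> h; apply: linext => v; rewrite spr_homE.
have := h _ _ (has_parity_spr false v); have := h _ _ (has_parity_spr true v).
rewrite addbF addbT => -> ->; rewrite -linearD; congr (f _).
exact: spr_sum.
Qed.

(** An even tensor is its own even part, and the even part of u *t w is a sum of two products of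
    factors of equal parity. *)
Lemma tensor_ind_even U W (P : tensor U W -> Prop) :
  P 0 -> (forall x y, P x -> P y -> P (x + y)) ->
  (forall i u w, has_parity i u -> has_parity i w -> P (u *t w)) ->
  forall x, has_parity false x -> P x.
Proof.
move=> P0 PD Pt x <-; elim/(@tensor_ind K U W): x => [|x y Px Py|u w].
- by rewrite spr0.
- by rewrite sprD; exact: PD.
rewrite spr_tens; apply: PD; apply: (Pt _); exact: has_parity_spr.
Qed.

Lemma even_tact U (s : tensor {linear U -> U} {linear U -> U}) :
  has_parity false s -> even_map (tact s).
Proof.
elim/tensor_ind_even => {s} [|s t IHs IHt|i phi psi iphi ipsi] k x.
- by rewrite (linear0 tact) !lin0E spr0.
- by rewrite (linearD tact) !(linDE (tact s)) IHs IHt sprD.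
elim/(@tensor_ind_hom K U U): x => [|x y IHx IHy|j l u w ju lw].
- by rewrite spr0 !linear0.
- by rewrite sprD (linearD _ (spr _ x)) (linearD _ x) sprD IHx IHy.
have pt := has_parity_tens ju lw.
have pt' := has_parity_tens (hom_parity iphi ju) (hom_parity ipsi lw).
rewrite (spr_parity _ pt) tactE (smapE phi _ ipsi ju) sprZ (spr_parity _ pt').
rewrite addbACA addbb; case: eqP => _; rewrite ?linear0 ?scaler0 //.
by rewrite (smapE phi _ ipsi ju).
Qed.
End EvenTensors.

(** * Conjugation of braiding maps by an even isomorphism *)

Section Transport.
Context {K : fieldType} {V U : superType K}.
Variables (y : {linear V -> U}) (e : {linear U -> V}).
Hypotheses (yev : even_map y) (eev : even_map e) (yK : cancel y e) (eK : cancel e y).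

Let conj_linear : linear (fun phi : {linear V -> V} => lcomp y (lcomp phi e)).
Proof. by move=> k f g; apply: linext => u; rewrite !lcompE !linDE !linZE linearP. Qed.
Definition conjl : {linear {linear V -> V} -> {linear U -> U}} := mklin conj_linear.

Lemma conjlE phi u : conjl phi u = y (phi (e u)). Proof. by []. Qed.

Lemma conjl_parity i phi : has_parity i phi -> has_parity i (conjl phi).
Proof.
move=> iphi; apply: hom_parityI => j v jv; rewrite conjlE.
by apply: even_parity => //; apply: hom_parity => //; apply: even_parity.
Qed.

Variable s : tensor {linear V -> V} {linear V -> V}.
Definition conjt := tmap conjl conjl s.

Lemma tact_conjt x : tact conjt (tmap y y x) = tmap y y (tact s x).
Proof.
rewrite /conjt; elim/(@tensor_ind_hom K {linear V -> V} {linear V -> V}): s => [|t u IHt IHu|i j phi psi iphi jpsi].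
- by rewrite !linear0.
- by rewrite (linearD (tmap _ _)) !(linearD tact) !linDE IHt IHu linearD.
elim/(@tensor_ind_hom K V V): x => [|x z IHx IHz|k l u w ku lw].
- by rewrite !linear0.
- by rewrite !linearD IHx IHz.
rewrite !tmapE !tactE (smapE _ _ jpsi ku) (smapE _ _ (conjl_parity jpsi) (even_parity yev ku)).
by rewrite (linearZ_LR (tmap y y)) tmapE !conjlE !yK.
Qed.

Lemma conjt_even : has_parity false s -> has_parity false conjt.
Proof.
rewrite /conjt; elim/(@tensor_ind_even K {linear V -> V} {linear V -> V}): s / =>
  [|t u IHt IHu|i phi psi iphi ipsi].
- by rewrite /has_parity (linear0 (tmap _ _)) spr0.
- by rewrite /has_parity (linearD (tmap _ _) t) sprD IHt IHu.
by rewrite tmapE -[false](addbb i); apply: has_parity_tens; exact: conjl_parity.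
Qed.

Definition tmap3 : {linear tensor (tensor V V) V -> tensor (tensor U U) U} :=
  tmap (tmap y y) y.

Lemma tmap3_leg12 (X : {linear tensor V V -> tensor V V})
    (X' : {linear tensor U U -> tensor U U}) x :
  (forall t, X' (tmap y y t) = tmap y y (X t)) ->
  leg12 X' (tmap3 x) = tmap3 (leg12 X x).
Proof. by move=> h; rewrite /leg12 !tmap_comp; apply: eq_tmap => // t; exact: h. Qed.

Lemma tmap3_leg23 (X : {linear tensor V V -> tensor V V})
    (X' : {linear tensor U U -> tensor U U}) x :
  (forall t, X' (tmap y y t) = tmap y y (X t)) ->
  leg23 X' (tmap3 x) = tmap3 (leg23 X x).
Proof.
move=> h.
have E z : tassoc (tmap3 z) = tmap y (tmap y y) (tassoc z).
  elim/(@tensor3_ind_hom K V V V): z => [|a b IHa IHb|i j k u w v _ _ _].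
  - by rewrite !linear0.
  - by rewrite !linearD IHa IHb.
  by rewrite tassocE /tmap3 !tmapE tassocE.
rewrite !leg23E -[RHS]tassocK !E tunassocK !tmap_comp; congr (tunassoc _).
by apply: eq_tmap => // t; exact: h.
Qed.

Lemma tmap_tswap t : tswap (tmap y y t) = tmap y y (tswap t).
Proof. exact: tswap_nat. Qed.

Lemma tmap3_leg13 (X : {linear tensor V V -> tensor V V})
    (X' : {linear tensor U U -> tensor U U}) x :
  (forall t, X' (tmap y y t) = tmap y y (X t)) ->
  leg13 X' (tmap3 x) = tmap3 (leg13 X x).
Proof.
by move=> h; rewrite !leg13E !(tmap3_leg23 _ tmap_tswap) (tmap3_leg12 _ h)
  (tmap3_leg23 _ tmap_tswap).
Qed.

Lemma tmap_surj (x : tensor U U) : x = tmap y y (tmap e e x).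
Proof. by rewrite tmap_comp -[LHS]tmap_id; apply: eq_tmap => v; rewrite lcompE eK. Qed.

Lemma tmap3_surj x : x = tmap3 (tmap (tmap e e) e x).
Proof.
by rewrite /tmap3 tmap_comp -[LHS]tmap_id; apply: eq_tmap => v;
  rewrite lcompE -?tmap_surj ?eK.
Qed.

Lemma conjt_braiding : braiding_map s -> braiding_map conjt.
Proof.
case=> se sP h1 h2 h3; split; first exact: conjt_even.
- by move=> x; rewrite [x]tmap_surj tmap_tswap !tact_conjt tmap_tswap sP.
- by move=> x; rewrite [x]tmap3_surj !(tmap3_leg12 _ tact_conjt, tmap3_leg23 _ tact_conjt) h1.
- by move=> x; rewrite [x]tmap3_surj !(tmap3_leg13 _ tact_conjt, tmap3_leg23 _ tact_conjt) h2.
- by move=> x; rewrite [x]tmap3_surj !(tmap3_leg12 _ tact_conjt, tmap3_leg13 _ tact_conjt) h3.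
Qed.
End Transport.

(** * Powers (1 - t)^(A + c) *)

Section Functionals.
Context {K : fieldType} {M : lmodType K}.

(** Functionals separate points, so an identity between linear combinations becomes an identity of
    scalars, within reach of [ring]. The properties of l are passed as rewriting rules. *)
Lemma lin_sep (u v : M) :
  (forall l : M -> K, {morph l : x y / x + y} -> {morph l : x / - x} -> l 0 = 0 ->
     (forall k x, l (k *: x) = k * l x) -> l u = l v) -> u = v.
Proof.
move=> h; apply: contrapT => /eqP; rewrite -subr_eq0 => /eqP/functional_exists[l lE].
have := h l (linearD l) (linearN l) (linear0 l) (linearZ_LR l).
by apply/eqP; rewrite -subr_eq0 -(linearB l) lE oner_eq0.
Qed.
End Functionals.

Lemma eq_from_sub (M : zmodType) (p q a b : M) : p = q -> a - b = p - q -> a = b.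
Proof. by move=> ->; rewrite subrr => /eqP; rewrite subr_eq0 => /eqP. Qed.

Section BinomialOperators.
Context {K : numFieldType} {W : lmodType K}.
Variable A : {linear W -> W}.

(** The recursion is the differential equation (1 - t) f' = - (A + c) f read on coefficients. *)
Fixpoint bet_rec (c : K) (m : nat) : {linear W -> W} :=
  if m is m'.+1 then
    m'.+1%:R^-1 *: ((m'%:R - c) *: bet_rec c m' - lcomp A (bet_rec c m'))
  else idfun.

(* The coefficient of t^m in (1 - t)^(A + c). *)
Definition bet := locked bet_rec.

Lemma bet0 c x : bet c 0 x = x. Proof. by rewrite /bet -lock. Qed.

Lemma betS c m x :
  m.+1%:R *: bet c m.+1 x = (m%:R - c) *: bet c m x - A (bet c m x).
Proof. by rewrite /bet -lock /= scalerA mulfV ?scale1r // pnatr_eq0. Qed.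

Lemma bet_closed (P : W -> Prop) c m x :
  (forall k u v, P u -> P v -> P (k *: u + v)) -> (forall u, P u -> P (A u)) ->
  P x -> P (bet c m x).
Proof.
move=> Plin PA Px; have P0 : P 0 by rewrite -[0](addNr x) -scaleN1r; exact: Plin.
elim: m => [|m IHm]; first by rewrite bet0.
rewrite -[bet _ _ _](@scalerK _ _ (m.+1%:R)) ?pnatr_eq0 // betS -[_ *: _]addr0.
apply: (Plin) => //; apply: (Plin) => //.
by rewrite -scaleN1r -[_ *: _]addr0; apply: Plin => //; exact: PA.
Qed.

(** Multiplication of (1 - t)^(A + c) by 1 - t. *)
Lemma bet_pascal c m x :
  bet (c + 1) m.+1 x = bet c m.+1 x - bet c m x.
Proof.
have neq k : k.+1%:R != 0 :> K by rewrite pnatr_eq0.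
elim: m x => [|m IHm] x.
  have := betS (c + 1) 0 x; have := betS c 0 x; rewrite !scale1r !bet0 => -> ->.
  by rewrite sub0r sub0r opprD scalerDl scaleN1r addrAC.
apply: (scalerI (neq m.+1)); rewrite scalerBr !betS IHm (linearB A).
have E := betS c m x.
apply: lin_sep => l lD lN l0 lZ; have := congr1 l E.
rewrite !(lD, lN, lZ) -[m.+2%:R]natr1 -[m.+1%:R]natr1 => El.
by apply: (eq_from_sub El); ring.
Qed.

(** The derivative of (1 - t)^(A + c) is - (A + c) (1 - t)^(A + c - 1). *)
Lemma bet_shift c m x :
  m.+1%:R *: bet c m.+1 x = - (c *: bet (c - 1) m x + A (bet (c - 1) m x)).
Proof.
elim: m x => [|m IHm] x; first by rewrite betS !bet0 sub0r scaleNr opprD.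
have neq : m.+1%:R != 0 :> K by rewrite pnatr_eq0.
apply: (scalerI neq); rewrite betS scalerBr scalerA mulrC -scalerA -(linearZ_LR A).
rewrite IHm; have E := betS (c - 1) m x; have E' := congr1 A E.
rewrite (linearZ_LR A) (linearB A) (linearZ_LR A) in E'.
rewrite (linearN A) (linearD A) (linearZ_LR A).
apply: lin_sep => l lD lN l0 lZ; have := congr1 l E; have := congr1 l E'.
rewrite !(lD, lN, lZ) -[m.+1%:R]natr1 => El' El.
have := congr2 (fun a b => c * a + b) El El'.
by move=> /eq_from_sub; apply; ring.
Qed.
End BinomialOperators.

Section BinomialOperators2.
Context {K : numFieldType}.

Lemma bet_intertwine (W W' : lmodType K) (A : {linear W -> W}) (A' : {linear W' -> W'})
    (f : {linear W -> W'}) c m x :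
  (forall u, f (A u) = A' (f u)) -> f (bet A c m x) = bet A' c m (f x).
Proof.
move=> fA; elim: m => [|m IHm]; first by rewrite !bet0.
have neq : m.+1%:R != 0 :> K by rewrite pnatr_eq0.
by apply: (scalerI neq); rewrite -(linearZ_LR f) !betS (linearB f) (linearZ_LR f) fA IHm.
Qed.

(** The product (1 - t)^(A + c) (1 - t)^(B + d). Splitting m + 1 as i + (m + 1 - i) in the sum,
    which is the Leibniz rule, gives it the recursion of the right-hand side. *)
Lemma bet_vandermonde (W : lmodType K) (A B : {linear W -> W}) c d m x :
  (forall u, A (B u) = B (A u)) ->
  \sum_(i < m.+1) bet A c i (bet B d (m - i) x) = bet (A + B) (c + d) m x.
Proof.
move=> AB; elim: m => [|m IHm]; first by rewrite big_ord1 !bet0.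
have neq : m.+1%:R != 0 :> K by rewrite pnatr_eq0.
apply: (scalerI neq); rewrite betS linDE -IHm.
have -> : m.+1%:R *: \sum_(i < m.+2) bet A c i (bet B d (m.+1 - i) x) =
    \sum_(i < m.+2) i%:R *: bet A c i (bet B d (m.+1 - i) x) +
    \sum_(i < m.+2) (m.+1 - i)%:R *: bet A c i (bet B d (m.+1 - i) x).
  rewrite -big_split scaler_sumr; apply: eq_bigr => i _ /=.
  by rewrite -scalerDl -natrD subnKC // -ltnS.
have BA u i : B (bet A c i u) = bet A c i (B u).
  by apply: bet_intertwine => v; rewrite AB.
rewrite big_ord_recl scale0r add0r [X in _ + X]big_ord_recr /= subnn scale0r addr0.
rewrite -big_split scaler_sumr (linear_sum A) (linear_sum B).
rewrite -[X in _ - X]big_split -sumrN -big_split; apply: eq_bigr => i _.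
have im : (i <= m)%N by rewrite -ltnS.
rewrite /= /bump leq0n add1n subSS subSn // betS.
have -> : (m - i).+1%:R *: bet A c i (bet B d (m - i).+1 x) =
    bet A c i ((m - i)%:R *: bet B d (m - i) x - d *: bet B d (m - i) x -
               B (bet B d (m - i) x)).
  by rewrite -(linearZ_LR (bet A c i)) betS scalerBl.
rewrite 2!(linearB (bet A c i)) 2!(linearZ_LR (bet A c i)) -BA natrB //.
by apply: lin_sep => l lD lN l0 lZ; rewrite !(lD, lN, lZ); ring.
Qed.
End BinomialOperators2.

(** * Finite sums and iterates of locally nilpotent operators *)

Lemma fsum_nat (M : zmodType) (f : nat -> M) J :
  (forall m, (J <= m)%N -> f m = 0) -> \sum_(m \in [set: nat]) f m = \sum_(m < J) f m.
Proof.
move=> f0; rewrite (fsbigE (iota 0 J)) ?iota_uniq //.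
  rewrite -{1}[J]subn0 -/(index_iota 0 J) big_mkord; apply: eq_bigl => i.
  by rewrite in_setT.
by move=> i _; rewrite mem_iota add0n -leqNgt /=; exact: f0.
Qed.

Lemma sum_widen (M : nmodType) (f : nat -> M) J J' :
  (J <= J')%N -> (forall m, (J <= m)%N -> f m = 0) ->
  \sum_(m < J') f m = \sum_(m < J) f m.
Proof.
move=> JJ f0; rewrite -(subnKC JJ) big_split_ord /= [X in _ + X]big1 ?addr0 // => i _.
by apply: f0; rewrite leq_addr.
Qed.

Lemma iter_lin0 (K : fieldType) (M : lmodType K) (f : {linear M -> M}) r :
  iter r f 0 = 0.
Proof. by elim: r => //= r ->; rewrite linear0. Qed.

Lemma iter_linP (K : fieldType) (M : lmodType K) (f : {linear M -> M}) r k x y :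
  iter r f (k *: x + y) = k *: iter r f x + iter r f y.
Proof. by elim: r => //= r ->; rewrite linearP. Qed.

Lemma iter_linD (K : fieldType) (M : lmodType K) (f : {linear M -> M}) r x y :
  iter r f (x + y) = iter r f x + iter r f y.
Proof. by have := iter_linP f r 1 x y; rewrite !scale1r. Qed.

Lemma iter_nil_le (K : fieldType) (M : lmodType K) (f : {linear M -> M}) r r' x :
  (r <= r')%N -> iter r f x = 0 -> iter r' f x = 0.
Proof. by move=> /subnK <- h; rewrite iterD h iter_lin0. Qed.

Lemma iter_nilD (K : fieldType) (M : lmodType K) (f : {linear M -> M}) x y :
  (exists r, iter r f x = 0) -> (exists r, iter r f y = 0) ->
  exists r, iter r f (x + y) = 0.
Proof.
move=> [r hr] [r' hr']; exists (maxn r r'); rewrite iter_linD.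
by rewrite (iter_nil_le (leq_maxl _ _) hr) (iter_nil_le (leq_maxr _ _) hr') addr0.
Qed.

Lemma iter_intertwine (W W' : Type) (f : W -> W) (f' : W' -> W') (h : W -> W') r x :
  (forall u, h (f u) = f' (h u)) -> h (iter r f x) = iter r f' (h x).
Proof. by move=> fh; elim: r => //= r <-. Qed.

(** Only finitely many powers of a locally nilpotent operator act nontrivially on a vector, so
    bounds found one power at a time become uniform. *)
Lemma iter_bound (P : nat -> nat -> Prop) r :
  (forall i n n', (n <= n')%N -> P n i -> P n' i) -> (forall i, exists n, P n i) ->
  exists n, forall i, (i < r)%N -> P n i.
Proof.
move=> Pm Pe; elim: r => [|r [n nP]]; first by exists 0%N.
have [n' n'P] := Pe r; exists (maxn n n') => i; rewrite ltnS leq_eqVlt => /orP[/eqP->|ir].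
  exact: Pm (leq_maxr _ _) n'P.
exact: Pm (leq_maxl _ _) (nP _ ir).
Qed.

(** * Locality without logarithms *)

Section Locality.
Context {K : numFieldType} {V : superType K}.
Local Notation V2 := (tensor V V).
Local Notation V3 := (tensor (tensor V V) V).
Local Notation idV := (idfun : {linear V -> V}).
Variables (vac : V) (X : int -> {linear V2 -> V}) (S : {linear V2 -> V2}).
Hypothesis Xlow : forall t, exists k : nat, forall n : int, n < - k%:Z -> X n t = 0.
Hypothesis Snil : forall t, exists r, iter r S t = 0.
Hypothesis Seven : even_map S.
Hypothesis SP : forall t, S (tswap t) = tswap (S t).
Local Notation S12 := (leg12 S).
Local Notation S13 := (leg13 S).
Local Notation S23 := (leg23 S).
Local Notation P12 := (leg12 (@tswap K V V)).
Local Notation P23 := (leg23 (@tswap K V V)).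

Definition XX p q : {linear V3 -> V} := lcomp (X p) (lcomp (tmap idV (X q)) tassoc).

Definition Xvac q : {linear V -> V} := lcomp (X q) (tensl V vac).

Lemma nil12 x : exists r, iter r S12 x = 0.
Proof.
elim/(@tensor_ind K V2 V): x => [|x y|t c]; first by exists 0%N.
  exact: iter_nilD.
have [r tr] := Snil t; exists r.
rewrite -(@iter_intertwine _ _ S _ (tensl V2 c)) ?tr ?linear0 // => u.
by rewrite /leg12 tmapE.
Qed.

Lemma nil23 x : exists r, iter r S23 x = 0.
Proof.
have [r h] := nil12 (P23 (P12 x)); exists r.
rewrite -[iter r S23 x]leg12P2 -[P12 (iter r _ _)]leg23P2.
rewrite (@iter_intertwine _ _ _ S12 (fun u => P23 (P12 u))) ?h ?linear0 // => u.
by rewrite leg12_cyc.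
Qed.

Lemma nil13 x : exists r, iter r S13 x = 0.
Proof.
have [r h] := nil12 (P23 x); exists r.
rewrite -[iter r S13 x]leg23P2 (@iter_intertwine _ _ _ S12 P23) ?h ?linear0 // => u.
by rewrite leg13_12.
Qed.

Let lowb (k : nat) (z : V3) :=
  forall q : int, q < - k%:Z -> tmap idV (X q) (tassoc z) = 0.

Let lowb_lin k c z z' : lowb k z -> lowb k z' -> lowb k (c *: z + z').
Proof. by move=> h h' q qk; rewrite !linearP h // h' // scaler0 addr0. Qed.

Let lowb_ex z : exists k, lowb k z.
Proof.
rewrite /lowb; elim/(@tensor_ind K V V2): (tassoc z) => [|x y [k h] [k' h']|a t].
- by exists 0%N => q _; rewrite linear0.
- exists (maxn k k') => q qk; rewrite linearD h ?h' ?addr0 //; lia.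
by have [k h] := Xlow t; exists k => q qk; rewrite tmapE h // tens0r.
Qed.

(** Every [bet S12 c m x] is in the span of the finitely many nonzero [iter i S12 x], hence a bound
    independent of c and m. *)
Lemma XX_low x : exists k : nat, forall c m p (q : int), q < - k%:Z ->
  XX p q (bet S12 c m x) = 0.
Proof.
have [r rx] := nil12 x.
have [k kP] : exists k, forall i, (i < r)%N -> lowb k (iter i S12 x).
  apply: iter_bound => [i n n' nn h q qn|i]; last exact: lowb_ex.
  by apply: h; lia.
exists k => c m p q qk; rewrite !lcompE.
suff h : forall i, lowb k (iter i S12 (bet S12 c m x)) by rewrite (h 0%N) // linear0.
apply: (@bet_closed _ _ _ (fun z => forall i, lowb k (iter i S12 z))).
- by move=> b u v hu hv i; rewrite iter_linP; apply: lowb_lin.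
- by move=> u hu i; rewrite -iterSr.
move=> i; have [ir|ri] := ltnP i r; first exact: kP.
by rewrite (iter_nil_le ri rx) => q' _; rewrite !linear0.
Qed.

(* The coefficient of z1^n1 z2^n2 in z12^N (1 - z2/z1)^(S12) X(z1) X(z2) x. *)
Definition locA (N : nat) (x : V3) (n1 n2 : int) : V :=
  \sum_(m \in [set: nat]) XX (n1 - N%:Z + m%:Z) (n2 - m%:Z) (bet S12 N%:R m x).

Lemma locAE x : exists k : nat, forall N n1 n2 J, n2 + k%:Z < J%:Z ->
  locA N x n1 n2 =
    \sum_(m < J) XX (n1 - N%:Z + m%:Z) (n2 - m%:Z) (bet S12 N%:R m x).
Proof.
have [k kP] := XX_low x; exists k => N n1 n2 J J2.
by apply: fsum_nat => m mJ; apply: kP; lia.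
Qed.

Lemma locA_linear N n1 n2 : linear (fun x => locA N x n1 n2).
Proof.
move=> c x y; have [k kP] := locAE x; have [k' kP'] := locAE y.
have [k'' kP''] := locAE (c *: x + y).
pose J := (maxn (maxn k k') k'' + `|n2|.+1)%N.
rewrite (kP _ _ _ J) ?(kP' _ _ _ J) ?(kP'' _ _ _ J) /J; try lia.
rewrite scaler_sumr -big_split; apply: eq_bigr => m _.
by rewrite (linearP (bet S12 N%:R m)) (linearP (XX _ _)).
Qed.

Lemma locA0 N n1 n2 : locA N 0 n1 n2 = 0.
Proof. exact: (linear0 (mklin (locA_linear N n1 n2))). Qed.

Lemma locAD N n1 n2 x y : locA N (x + y) n1 n2 = locA N x n1 n2 + locA N y n1 n2.
Proof. exact: (linearD (mklin (locA_linear N n1 n2))). Qed.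

(** By [bet_pascal] the series gains a factor 1 - z2/z1, and z1 (1 - z2/z1) = z12. *)
Lemma locA_S N x n1 n2 :
  locA N.+1 x n1 n2 = locA N x (n1 - 1) n2 - locA N x n1 (n2 - 1).
Proof.
have [k kP] := locAE x; pose J := (k + `|n2|.+1)%N.
rewrite (kP N.+1 n1 n2 J.+1) ?(kP N (n1 - 1) n2 J.+1) ?(kP N n1 (n2 - 1) J) /J; try lia.
rewrite big_ord_recl [X in _ = X - _]big_ord_recl !bet0 -[RHS]addrA -sumrB; congr (_ + _).
  by congr (XX _ _ _); lia.
apply: eq_bigr => m _; rewrite !lift0 -natr1 bet_pascal (linearB (XX _ _)).
by congr (XX _ _ _ - XX _ _ _); lia.
Qed.

(** Locality of the zeta-free fields. The right-hand side has z21^N in place of z12^N, whence the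
    sign. *)
Definition loc (N : nat) (t : V2) := forall c n1 n2,
  locA N (t *t c) n1 n2 = (-1) ^+ N *: locA N (tswap t *t c) n2 n1.

Lemma loc_S N t : loc N t -> loc N.+1 t.
Proof.
move=> h c n1 n2; rewrite !locA_S !h -scalerBr exprS mulN1r scaleNr -scalerN.
by rewrite opprB.
Qed.

Lemma loc_mono N N' t : (N <= N')%N -> loc N t -> loc N' t.
Proof. by move=> /subnK <-; elim: (N' - N)%N => // n IHn /IHn/loc_S. Qed.

Lemma loc_lin N k t t' : loc N t -> loc N t' -> loc N (k *: t + t').
Proof.
move=> h h' c n1 n2.
have E u : (k *: u + t') *t c = k *: (u *t c) + t' *t c :> V3.
  by rewrite tensDl tensZl.
rewrite linearP !tensDl !tensZl !locA_linear h h' scalerDr !scalerA.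
by rewrite mulrC.
Qed.

(** The additive span of the t *t c with t local of order N, encoded by its induction principle;
    scalars are absorbed by t. *)
Definition spanned (N : nat) (x : V3) := forall P : V3 -> Prop,
  P 0 -> (forall y z, P y -> P z -> P (y + z)) ->
  (forall t c, loc N t -> P (t *t c)) -> P x.

Lemma spanned_mono N N' x : (N <= N')%N -> spanned N x -> spanned N' x.
Proof.
by move=> NN h P P0 PD Pt; apply: h => // t c /(loc_mono NN); exact: Pt.
Qed.

Lemma spanned_lin N k x y : spanned N x -> spanned N y -> spanned N (k *: x + y).
Proof.
move=> hx hy P P0 PD Pt; apply: (PD); last exact: hy.
apply: (hx (fun z => P (k *: z))) => [|u v Pu Pv|t c lt]; first by rewrite scaler0.
  by rewrite scalerDr; exact: PD.
rewrite -tensZl; apply: Pt; rewrite -[_ *: _]addr0; apply: loc_lin => //.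
by move=> d n1 n2; rewrite linear0 tens0l !locA0 scaler0.
Qed.

Lemma spanned_locA N x n1 n2 : spanned N x ->
  locA N x n1 n2 = (-1) ^+ N *: locA N (P12 x) n2 n1.
Proof.
move=> h; apply: (h (fun x => locA N x n1 n2 = (-1) ^+ N *: locA N (P12 x) n2 n1)).
- by rewrite linear0 !locA0 scaler0.
- by move=> y z hy hz; rewrite linearD !locAD hy hz scalerDr.
by move=> t c lt; rewrite /leg12 tmapE lt.
Qed.

Hypothesis loc_ex : forall t, exists N, loc N t.

Lemma spanned_ex x : exists N, spanned N x.
Proof.
elim/(@tensor_ind K V2 V): x => [|x y [N hN] [N' hN']|t c].
- by exists 0%N.
- exists (maxn N N'); rewrite -[x]scale1r; apply: spanned_lin.
    exact: spanned_mono (leq_maxl _ _) hN.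
  exact: spanned_mono (leq_maxr _ _) hN'.
by have [N hN] := loc_ex t; exists N => P P0 PD; apply.
Qed.

(* The locality order N works for each of the three pairs of legs. *)
Definition good N x :=
  [/\ spanned N x, spanned N (P23 x) & spanned N (P23 (P12 x))].

Lemma good_mono N N' x : (N <= N')%N -> good N x -> good N' x.
Proof. by move=> NN [h h' h'']; split; exact: spanned_mono NN _. Qed.

Lemma good_lin N k x y : good N x -> good N y -> good N (k *: x + y).
Proof. by move=> [h1 h2 h3] [g1 g2 g3]; split; rewrite ?linearP; exact: spanned_lin. Qed.

Lemma good_ex x : exists N, good N x.
Proof.
have [N h1] := spanned_ex x; have [N' h2] := spanned_ex (P23 x).
have [N'' h3] := spanned_ex (P23 (P12 x)); exists (maxn (maxn N N') N'').
split; [apply: spanned_mono h1|apply: spanned_mono h2|apply: spanned_mono h3];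
  by rewrite !leq_max leqnn ?orbT.
Qed.

(** Goodness must survive the series [bet] in S12, S13 and S23, so it is asked of all iterates of
    these operators. *)
Definition stable_good N x :=
  forall i j l, good N (iter i S12 (iter j S13 (iter l S23 x))).

Lemma stable_good_mono N N' x : (N <= N')%N -> stable_good N x -> stable_good N' x.
Proof. by move=> NN h i j l; exact: good_mono NN (h i j l). Qed.

Lemma good0 N : good N 0.
Proof. by split; rewrite ?linear0 => P P0. Qed.

Lemma stable_good_ex x : exists N, stable_good N x.
Proof.
have [r rx] := nil23 x.
have [N NP] : exists N, forall l, (l < r)%N -> forall i j,
    good N (iter i S12 (iter j S13 (iter l S23 x))).
  apply: iter_bound => [l n n' nn h i j|l]; first exact: good_mono nn (h i j).
  move: (iter l S23 x) => y; have [r' r'y] := nil13 y.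
  have [N NP] : exists N, forall j, (j < r')%N -> forall i,
      good N (iter i S12 (iter j S13 y)).
    apply: iter_bound => [j n n' nn h i|j]; first exact: good_mono nn (h i).
    move: (iter j S13 y) => z {r' r'y}; have [r' r'z] := nil12 z.
    have [N NP] : exists N, forall i, (i < r')%N -> good N (iter i S12 z).
      by apply: iter_bound => [i n n' nn h|i]; [exact: good_mono nn h|exact: good_ex].
    exists N => i; have [/NP//|ri] := ltnP i r'.
    by rewrite (iter_nil_le ri r'z); exact: good0.
  exists N => i j; have [/NP//|ri] := ltnP j r'.
  by rewrite (iter_nil_le ri r'y) iter_lin0; exact: good0.
exists N => i j l; have [/NP//|ri] := ltnP l r.
by rewrite (iter_nil_le ri rx) !iter_lin0; exact: good0.
Qed.
End Locality.

(** * Rearrangement of sums, and linearity of tensor products of maps *)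

Section CoreSums.
Lemma fsum_int (M : zmodType) (f : int -> M) lo Q :
  (forall a, a < lo -> f a = 0) -> (forall a, lo + Q%:Z <= a -> f a = 0) ->
  \sum_(a \in [set: int]) f a = \sum_(b < Q) f (lo + b%:Z).
Proof.
move=> f1 f2; rewrite (fsbigE [seq lo + b%:Z | b <- iota 0 Q]) //.
- rewrite big_map -{1}[Q]subn0 -/(index_iota 0 Q) big_mkcond /= big_mkord.
  by apply: eq_bigr => b _; rewrite in_setT.
- by rewrite map_inj_uniq ?iota_uniq // => b c; lia.
move=> a _ an; have [/f1//|loa] := ltP a lo; apply: f2; rewrite leNgt; apply/negP => aQ.
move/negP: an; apply; apply/mapP; exists `|a - lo|%N; last by lia.
by rewrite mem_iota; lia.
Qed.

Lemma sum_triangle (M : nmodType) (g : nat -> nat -> M) Q :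
  (forall i j, (Q <= i + j)%N -> g i j = 0) ->
  \sum_(i < Q) \sum_(j < Q) g i j = \sum_(l < Q) \sum_(i < l.+1) g i (l - i)%N.
Proof.
move=> g0.
have E (l : 'I_Q) : \sum_(i < l.+1) g i (l - i)%N =
    \sum_(i < Q | (i <= l)%N) g i (l - i)%N.
  by rewrite (big_ord_widen_cond _ predT (fun i => g i (l - i)%N) (ltn_ord l)).
rewrite (eq_bigr _ (fun l _ => E l)) [RHS](exchange_big_dep predT) //=.
apply: eq_bigr => i _; rewrite -(big_mkord xpredT (g i)).
rewrite -(big_mkord (fun l => (i <= l)%N) (fun l => g i (l - i)%N)).
rewrite [RHS](big_cat_nat (n := i)) //=; last exact: ltnW.
rewrite [X in _ = X + _]big1_seq ?add0r; last first.
  by move=> l /andP[il]; rewrite mem_index_iota; lia.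
rewrite [LHS](big_cat_nat (n := (Q - i)%N)) ?leq_subr //=.
rewrite [X in _ + X = _]big1_seq ?addr0; last first.
  by move=> j /=; rewrite mem_index_iota => h; apply: g0; lia.
rewrite -[X in index_iota X Q]add0n big_addn; apply: congr_big_nat => // j /andP[_ jQ].
  by rewrite leq_addl.
by rewrite addnK.
Qed.

Lemma lin_sumE (K : fieldType) (U W : lmodType K) (I : Type) (r : seq I) (P : pred I)
    (f : I -> {linear U -> W}) u :
  (\sum_(i <- r | P i) f i) u = \sum_(i <- r | P i) f i u.
Proof. exact: (big_morph (fun g : {linear U -> W} => g u)). Qed.

Lemma tmap_suml (K : fieldType) (U W U' W' : lmodType K) (f : {linear U -> U'})
    (I : Type) (r : seq I) (P : pred I) (g : I -> {linear W -> W'}) x :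
  tmap f (\sum_(i <- r | P i) g i) x = \sum_(i <- r | P i) tmap f (g i) x.
Proof.
rewrite -(lin_sumE r P (fun i => tmap f (g i))).
have h := linear_sum (mklin ((@tmap_bilinear K U W U' W').2 f)) r P g.
exact: (congr1 (fun l : {linear tensor U W -> tensor U' W'} => l x) h).
Qed.

Lemma tmap0r (K : fieldType) (U W U' W' : lmodType K) (f : {linear U -> U'}) x :
  tmap f (0 : {linear W -> W'}) x = 0.
Proof.
have h := linear0 (mklin ((@tmap_bilinear K U W U' W').2 f)).
exact: (congr1 (fun l : {linear tensor U W -> tensor U' W'} => l x) h).
Qed.

Lemma tmap_linr (K : fieldType) (U W U' W' : lmodType K) (f : {linear U -> U'})
    (g h : {linear W -> W'}) k x :
  tmap f (k *: g + h) x = k *: tmap f g x + tmap f h x.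
Proof.
have E := (@tmap_bilinear K U W U' W').2 f k g h.
exact: (congr1 (fun l : {linear tensor U W -> tensor U' W'} => l x) E).
Qed.

Lemma tmapZr (K : fieldType) (U W U' W' : lmodType K) (f : {linear U -> U'})
    (g : {linear W -> W'}) k x : tmap f (k *: g) x = k *: tmap f g x.
Proof. by rewrite -[k *: g]addr0 tmap_linr tmap0r addr0. Qed.

Lemma tassoc_nat (K : fieldType) (U V W W' : lmodType K) (f : {linear W -> W'})
    (x : tensor (tensor U V) W) :
  tassoc (tmap idfun f x) = tmap idfun (tmap idfun f) (tassoc x).
Proof.
elim/(@tensor_ind K (tensor U V) W): x => [|x y IHx IHy|t w]; first by rewrite !linear0.
  by rewrite !linearD IHx IHy.
elim/(@tensor_ind K U V): t => [|x y IHx IHy|u v]; first by rewrite !tens0l !linear0.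
  by rewrite !tensDl !linearD IHx IHy.
by rewrite !tmapE !tassocE !tmapE.
Qed.

Lemma bet_even (K : numFieldType) (W : superType K) (A : {linear W -> W}) c m :
  even_map A -> even_map (bet A c m).
Proof. by move=> eA i v; rewrite -(@bet_intertwine _ _ _ A A (spr i)) // => u; rewrite eA. Qed.
End CoreSums.

(** * Two fields on the vacuum, and locality with a third field *)

Section CoreVacuum.
Context {K : numFieldType} {V : superType K}.
Local Notation V2 := (tensor V V).
Local Notation V3 := (tensor (tensor V V) V).
Local Notation idV := (idfun : {linear V -> V}).
Local Notation idV2 := (idfun : {linear V2 -> V2}).
Variables (vac : V) (X : int -> {linear V2 -> V}) (S : {linear V2 -> V2}).
Hypothesis Xlow : forall t, exists k : nat, forall n : int, n < - k%:Z -> X n t = 0.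
Hypothesis Snil : forall t, exists r, iter r S t = 0.
Hypothesis Seven : even_map S.
Hypothesis SP : forall t, S (tswap t) = tswap (S t).
Hypothesis vac_even : has_parity false vac.
Hypothesis Xeven : forall n, even_map (X n).
Hypothesis Xvac_neg : forall q : int, q < 0 -> Xvac vac X q = 0.
Hypothesis Xvac0 : forall b, Xvac vac X 0 b = b.
Hypothesis S12_23 : forall x, leg12 S (leg23 S x) = leg23 S (leg12 S x).
Hypothesis S13_23 : forall x, leg13 S (leg23 S x) = leg23 S (leg13 S x).
Hypothesis S12_13 : forall x, leg12 S (leg13 S x) = leg13 S (leg12 S x).
Local Notation S12 := (leg12 S).
Local Notation S13 := (leg13 S).
Local Notation S23 := (leg23 S).
Local Notation P12 := (leg12 (@tswap K V V)).
Local Notation P23 := (leg23 (@tswap K V V)).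
Local Notation B := (Xvac vac X).
Local Notation locA := (locA X S).
Local Notation loc := (loc X S).
Local Notation spanned := (spanned X S).
Local Notation stable_good := (stable_good X S).

Definition locF_term (N : nat) (n1 n2 : int) m : {linear V2 -> V} :=
  lcomp (X (n1 - N%:Z + m%:Z)) (lcomp (tmap idV (B (n2 - m%:Z))) (bet S N%:R m)).

(* The coefficient of z1^n1 z2^n2 in z12^N (1 - z2/z1)^S X(z1) X(z2) vac. *)
Definition locF (N : nat) (n1 n2 : int) : {linear V2 -> V} :=
  if n2 is Posz q then \sum_(m < q.+1) locF_term N n1 n2 m else 0.

Lemma locF_term0 N n1 n2 m t : n2 < m%:Z -> locF_term N n1 n2 m t = 0.
Proof.
move=> h; rewrite !lcompE Xvac_neg; last by lia.
by rewrite tmap0r linear0.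
Qed.

Lemma locFE N n1 n2 J t : n2 < J%:Z ->
  locF N n1 n2 t = \sum_(m < J) locF_term N n1 n2 m t.
Proof.
case: n2 => q h; rewrite /locF.
  rewrite lin_sumE; apply/esym/(@sum_widen _ (fun m => locF_term N n1 q m t) q.+1 J).
    by lia.
  by move=> m qm; apply: locF_term0; lia.
by rewrite big1 // => m _; apply: locF_term0; lia.
Qed.

Lemma locF_neg2 N n1 n2 t : n2 < 0 -> locF N n1 n2 t = 0.
Proof. by move=> h; rewrite (@locFE _ _ _ 0%N) ?big_ord0. Qed.

(** The vacuum axiom leaves only the term m = 0 at z2^0: the series F of [locF] determines X. *)
Lemma locF_0 N n t : locF N n 0 t = X (n - N%:Z) t.
Proof.
rewrite (@locFE _ _ _ 1) // big_ord1 !lcompE bet0 addr0 subr0.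
congr (X _ _); rewrite -[RHS]tmap_id; apply: eq_tmap => // b; exact: Xvac0.
Qed.

Lemma XX_tens p q t c : XX X p q (t *t c) = X p (tmap idV (lcomp (X q) (tensl V c)) t).
Proof.
rewrite !lcompE; congr (X _ _).
elim/(@tensor_ind K V V): t => [|x y IHx IHy|a b]; first by rewrite tens0l !linear0.
  by rewrite tensDl !linearD IHx IHy.
by rewrite tassocE !tmapE lcompE.
Qed.

Lemma bet_tens c m t v : bet S12 c m (t *t v) = bet S c m t *t v.
Proof.
rewrite -/(tensl V2 v t) -/(tensl V2 v _); symmetry.
by apply: (@bet_intertwine _ _ _ S S12 (tensl V2 v)) => u; exact/esym/tmapE.
Qed.

Lemma locF_A N t n1 n2 : locA N (t *t vac) n1 n2 = locF N n1 n2 t.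
Proof.
have [k kP] := locAE Xlow Snil (t *t vac).
rewrite (kP _ _ _ (k + `|n2|.+1)%N); last by lia.
rewrite (@locFE _ _ _ (k + `|n2|.+1)%N); last by lia.
by apply: eq_bigr => m _; rewrite bet_tens XX_tens.
Qed.

Lemma locF_sym N t n1 n2 : loc N t ->
  locF N n1 n2 t = (-1) ^+ N *: locF N n2 n1 (tswap t).
Proof. by move=> h; rewrite -!locF_A h. Qed.

(** The swapped series has no negative powers of its second variable, so locality makes F a power
    series in both variables. *)
Lemma locF_neg1 N t n1 n2 : loc N t -> n1 < 0 -> locF N n1 n2 t = 0.
Proof. by move=> /locF_sym -> /locF_neg2 ->; rewrite scaler0. Qed.

(** Skew symmetry: X(a,z)b is the z2^0 part of F on a (x) b, hence is read off the z1^0 part of F on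
    b (x) a, which has no negative powers of z1. *)
Lemma skew N t q i : loc N t ->
  (-1) ^+ N *: locF N (- i%:Z) q (tswap t) = if i == 0%N then X (q - N%:Z) t else 0.
Proof.
move=> h; rewrite -locF_sym //; case: i => [|i]; first by rewrite eqxx oppr0 locF_0.
by rewrite locF_neg2.
Qed.

Lemma even_tensl_vac : even_map (tensl V vac).
Proof.
move=> i v; rewrite /= spr_tens; case: i.
  by rewrite !(spr_parity _ vac_even) /= tens0r add0r.
by rewrite !(spr_parity _ vac_even) /= tens0r addr0.
Qed.

Lemma even_Xvac q : even_map (B q).
Proof. by apply: even_lcomp => //; exact: even_tensl_vac. Qed.

Lemma even_locF N n1 n2 : even_map (locF N n1 n2).
Proof.
have e m : even_map (locF_term N n1 n2 m).
  apply: even_lcomp => //; apply: even_lcomp; last exact: bet_even.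
  by apply: even_tmap => //; exact: even_Xvac.
move=> i t; rewrite !(@locFE _ _ _ `|n2|.+1); try lia.
rewrite (linear_sum (spr i : {linear V -> V})); apply: eq_bigr => m _; exact: e.
Qed.

(** Identities involving a fixed order N hold only on local tensors of that order; they extend to
    one leg more because [spanned] elements are sums of t *t c with t local. *)
Lemma kill12 N (G : {linear V2 -> V}) w :
  (forall t, loc N t -> G t = 0) -> spanned N w -> tmap G idV w = 0.
Proof.
move=> G0 h; apply: (h (fun w => tmap G idV w = 0)) => [|y z hy hz|t c lt].
- by rewrite linear0.
- by rewrite linearD hy hz addr0.
by rewrite tmapE G0 // tens0l.
Qed.

Lemma kill_swap N (G : {linear V2 -> V}) w : even_map G ->
  (forall t, loc N t -> G t = 0) -> spanned N w -> tmap idV G (tswap w) = 0.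
Proof.
move=> eG G0 h; rewrite -(@tswap_nat _ _ _ _ _ G idV) // (kill12 G0 h) linear0 //.
Qed.

Lemma kill23 N (G : {linear V2 -> V}) z : even_map G ->
  (forall t, loc N t -> G t = 0) -> spanned N (P23 (P12 z)) ->
  tmap idV G (tassoc z) = 0.
Proof.
by move=> eG G0 h; rewrite -[tassoc z]tswapK tswap_r3 (kill_swap eG G0 h).
Qed.

(** This is [skew] on the last two legs. The difference of its two sides is an even map that
    vanishes on local tensors, so [kill23] applies. *)
Lemma skew3 L z p q i : spanned L (P23 (P12 z)) ->
  (-1) ^+ L *: X p (tmap idV (lcomp (locF L (- i%:Z) q) tswap) (tassoc z)) =
  if i == 0%N then XX X p (q - L%:Z) z else 0.
Proof.
move=> h; pose f := lcomp (locF L (- i%:Z) q) (@tswap K V V).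
pose g : {linear V2 -> V} := if i == 0%N then X (q - L%:Z) else 0.
have ef : even_map f by apply: even_lcomp; [exact: even_locF|exact: even_tswap].
have eg : even_map g by rewrite /g; case: eqP => // _ b v; rewrite !lin0E spr0.
pose G : {linear V2 -> V} := (-1) ^+ L *: f + -1 *: g.
have eG : even_map G.
  move=> b v; rewrite /G !(linDE _ (-1 *: g)) !linZE ef eg.
  by rewrite sprD !sprZ.
have G0 t : loc L t -> G t = 0.
  move=> lt; rewrite /G (linDE _ (-1 *: g)) !linZE /f lcompE skew // /g.
  by case: eqP; rewrite ?lin0E scaleN1r subrr.
have E : tmap idV g (tassoc z) = (-1) ^+ L *: tmap idV f (tassoc z).
  have := kill23 eG G0 h; rewrite /G tmap_linr -[-1 *: g]addr0 tmap_linr tmap0r addr0.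
  by rewrite scaleN1r => /eqP; rewrite subr_eq0 => /eqP.
rewrite -(linearZ_LR (X p)) -E /g; case: eqP => // _.
by rewrite tmap0r linear0.
Qed.

Lemma stable_good_lin N k x y :
  stable_good N x -> stable_good N y -> stable_good N (k *: x + y).
Proof. by move=> hx hy i j l; rewrite !iter_linP; apply: (good_lin Xlow Snil); [exact: hx|exact: hy]. Qed.

Lemma stable_good_S N x : stable_good N x ->
  [/\ stable_good N (S12 x), stable_good N (S13 x) & stable_good N (S23 x)].
Proof.
move=> h; split=> i j l.
- rewrite -(@iter_intertwine _ _ S23 S23 S12) // -(@iter_intertwine _ _ S13 S13 S12) //.
  by rewrite -iterSr.
- rewrite -(@iter_intertwine _ _ S23 S23 S13) // -[iter j _ _]iterSr; exact: h.
- by rewrite -[iter l _ _]iterSr; exact: h.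
Qed.

Lemma stable_good_bet N x c m : stable_good N x ->
  [/\ stable_good N (bet S12 c m x), stable_good N (bet S13 c m x) &
      stable_good N (bet S23 c m x)].
Proof.
move=> h; have l k u v := @stable_good_lin N k u v.
by split; apply: (@bet_closed _ _ _ (stable_good N)) => // u /stable_good_S[].
Qed.

Lemma stable_goodW N M x : (N <= M)%N -> stable_good N x ->
  [/\ spanned M x, spanned M (P23 x) & spanned M (P23 (P12 x))].
Proof. by move=> NM h; have [] := good_mono Xlow Snil NM (h 0%N 0%N 0%N). Qed.

Lemma spanned_tmap N f x : spanned N x -> spanned N (tmap idV2 f x).
Proof.
move=> h; apply: (h (fun x => spanned N (tmap idV2 f x))) => [|y z hy hz|t c lt].
- by rewrite linear0 => P P0.
- by rewrite linearD -[tmap _ _ y]scale1r; apply: (spanned_lin Xlow Snil).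
by rewrite tmapE => P P0 PD; exact.
Qed.

Lemma locA_large N x n1 n2 : exists I0, forall I, (I0 <= I)%N -> locA N x n1 n2 =
  \sum_(i < I) XX X (n1 - N%:Z + i%:Z) (n2 - i%:Z) (bet S12 N%:R i x).
Proof.
have [k kP] := locAE Xlow Snil x; exists (k + `|n2|.+1)%N => I Ik.
by apply: kP; lia.
Qed.

Lemma tmap_leg12 (f : {linear V -> V}) z : tmap idV2 f (S12 z) = S12 (tmap idV2 f z).
Proof. by rewrite /leg12 !tmap_comp; apply: eq_tmap. Qed.

Lemma tmap_P12 (f : {linear V -> V}) z : tmap idV2 f (P12 z) = P12 (tmap idV2 f z).
Proof. by rewrite /leg12 !tmap_comp; apply: eq_tmap. Qed.

Lemma bet13_12 f c i v :
  tmap idV2 f (P23 (bet S13 c i v)) = bet S12 c i (tmap idV2 f (P23 v)).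
Proof.
apply: (@bet_intertwine _ _ _ S13 S12 (lcomp (tmap idV2 f) P23)) => u.
change (tmap idV2 f (P23 (S13 u)) = S12 (tmap idV2 f (P23 u))).
by rewrite -leg13_12 tmap_leg12.
Qed.

Lemma XX_P12P23 p q f v :
  XX X p q (P12 (tmap idV2 f (P23 v))) =
  X p (tmap idV (lcomp (X q) (tmap idV f)) (tswap v)).
Proof.
rewrite -tmap_P12.
change (X p (tmap idV (X q) (tassoc (tmap idV2 f (P12 (P23 v))))) =
  X p (tmap idV (lcomp (X q) (tmap idV f)) (tswap v))).
rewrite tassoc_nat -tswap_l3; congr (X _ _).
by rewrite tmap_comp; apply: eq_tmap.
Qed.

(** Locality of the first and third legs, applied to the vector X_r(b, vac) made from the second;
    after the swap of legs S13 plays the role of S12. *)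
Lemma cross M v r p q : spanned M (P23 v) -> exists I0, forall I, (I0 <= I)%N ->
  \sum_(i < I) XX X (p - M%:Z + i%:Z) (q - i%:Z)
     (tmap idV2 (B r) (P23 (bet S13 M%:R i v))) =
  (-1) ^+ M *: \sum_(i < I) X (q - M%:Z + i%:Z)
     (tmap idV (lcomp (X (p - i%:Z)) (tmap idV (B r))) (tswap (bet S13 M%:R i v))).
Proof.
move=> h; pose y := tmap idV2 (B r) (P23 v).
have [I0 hI0] := locA_large M y p q; have [I1 hI1] := locA_large M (P12 y) q p.
exists (maxn I0 I1) => I; rewrite geq_max => /andP[/hI0 E0 /hI1 E1].
under eq_bigr do rewrite bet13_12; rewrite -E0.
rewrite (spanned_locA Xlow Snil); last exact: spanned_tmap.
rewrite E1; congr (_ *: _); apply: eq_bigr => i _.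
rewrite -XX_P12P23 bet13_12 -(@bet_intertwine _ _ _ S12 S12 P12) // => u.
by rewrite leg12SP.
Qed.

Lemma bet_comm (A A' : {linear V3 -> V3}) c d i j x :
  (forall u, A (A' u) = A' (A u)) -> bet A c i (bet A' d j x) = bet A' d j (bet A c i x).
Proof.
move=> AA'; apply: (@bet_intertwine _ _ _ A' A' (bet A c i)) => u.
by symmetry; apply: bet_intertwine => w; rewrite AA'.
Qed.

Lemma tmap_locF N n1 n2 J (y : tensor V V2) : n2 < J%:Z ->
  tmap idV (locF N n1 n2) y = \sum_(m < J) tmap idV (locF_term N n1 n2 m) y.
Proof.
move=> h; rewrite -tmap_suml; apply: eq_tmap => // t.
by rewrite lin_sumE; exact: locFE.
Qed.

Lemma bet_tmapr c m (y : tensor V V2) : bet (tmap idV S) c m y = tmap idV (bet S c m) y.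
Proof.
elim/(@tensor_ind K V V2): y => [|y z IHy IHz|a t]; first by rewrite !linear0.
  by rewrite (linearD (bet _ _ _)) (linearD (tmap _ _)) IHy IHz.
rewrite tmapE -/(tensr V2 a t) -/(tensr V2 a _); symmetry.
by apply: (@bet_intertwine _ _ _ S (tmap idV S) (tensr V2 a)) => u; exact/esym/tmapE.
Qed.

Lemma tassoc_bet23 c m z : tassoc (bet S23 c m z) = tmap idV (bet S c m) (tassoc z).
Proof.
rewrite -bet_tmapr; apply: bet_intertwine => u; rewrite leg23E.
exact: tunassocK.
Qed.

Lemma tswap_bet12 c m (z : V3) : tswap (bet S12 c m z) = tmap idV (bet S c m) (tswap z).
Proof.
rewrite -bet_tmapr; apply: bet_intertwine => u.
by rewrite /leg12 tswap_nat.
Qed.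

Lemma tassoc_P23 z : tassoc (P23 z) = tmap idV tswap (tassoc z).
Proof. exact: tunassocK. Qed.

(* Locality of (b, c), then of (a, c), moves Y(a) and Y(b) to the right of     *)
(* Y(c), where they act on the vacuum.                                        *)
Lemma locA_cross N M L x n1 n2 I J : stable_good N x -> (N <= M)%N -> (N <= L)%N ->
  n1 < I%:Z -> n2 < J%:Z ->
  locA N x (n1 - M%:Z) (n2 - L%:Z) = (-1) ^+ (L + M) *:
    \sum_(i < I) \sum_(j < J) X (i%:Z + j%:Z - L%:Z - M%:Z)
      (tmap idV (locF N (n1 - i%:Z) (n2 - j%:Z))
        (tswap (bet S23 L%:R j (bet S13 M%:R i x)))).
Proof.
move=> gx NM NL n1I n2J.
(* The vector c is X(c,z3)vac at z3 = 0, where z13^M z23^L becomes z1^M z2^L; hence the shifts by M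
   and L. *)
pose w m := bet S12 N%:R m x; pose p m : int := n1 - N%:Z + m%:Z.
pose v m j := bet S23 L%:R j (w m).
have gw m : stable_good N (w m) by have [] := stable_good_bet N%:R m gx.
have gv m j : stable_good N (v m j) by have [] := stable_good_bet L%:R j (gw m).
(* The truncation given by [cross] depends on m and j; both are below J, so a common one exists. *)
have [I' [I'I crossI]] : exists I', (I < I')%N /\ forall m j : 'I_J,
    \sum_(i < I') XX X (p m - M%:Z + i%:Z) (j%:Z - L%:Z - i%:Z)
      (tmap idV2 (B (n2 - m%:Z - j%:Z)) (P23 (bet S13 M%:R i (v m j)))) =
    (-1) ^+ M *: \sum_(i < I') X (j%:Z - L%:Z - M%:Z + i%:Z)
      (tmap idV (lcomp (X (p m - i%:Z)) (tmap idV (B (n2 - m%:Z - j%:Z))))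
         (tswap (bet S13 M%:R i (v m j)))).
  have [n nP] : exists n, forall m, (m < J)%N -> forall j, (j < J)%N ->
      forall I', (n <= I')%N ->
      \sum_(i < I') XX X (p m - M%:Z + i%:Z) (j%:Z - L%:Z - i%:Z)
        (tmap idV2 (B (n2 - m%:Z - j%:Z)) (P23 (bet S13 M%:R i (v m j)))) =
      (-1) ^+ M *: \sum_(i < I') X (j%:Z - L%:Z - M%:Z + i%:Z)
        (tmap idV (lcomp (X (p m - i%:Z)) (tmap idV (B (n2 - m%:Z - j%:Z))))
           (tswap (bet S13 M%:R i (v m j)))).
    apply: iter_bound => [m n n' nn h j jJ I' nI'|m]; first exact: h (leq_trans nn nI').
    apply: iter_bound => [j n n' nn h I' nI'|j]; first exact: h (leq_trans nn nI').
    by apply: cross; have [] := stable_goodW NM (gv m j).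
  exists (maxn n I.+1); split=> [|m j]; first by rewrite leq_max ltnSn orbT.
  by apply: nP => //; rewrite leq_maxl.
(* Skew symmetry of b and c. The terms with i > 0 vanish; they are added to build the series in S13
   that [cross] requires. *)
have stepA m : XX X (n1 - M%:Z - N%:Z + m%:Z) (n2 - L%:Z - m%:Z) (w m) =
    (-1) ^+ L *: \sum_(i < I') X (n1 - M%:Z - N%:Z + m%:Z + i%:Z)
      (tmap idV (lcomp (locF L (- i%:Z) (n2 - m%:Z)) tswap)
         (tassoc (bet S13 M%:R i (w m)))).
  case: I' I'I crossI => // I' _ _; rewrite scaler_sumr big_ord_recl.
  have sk i P : (-1) ^+ L *: X P (tmap idV (lcomp (locF L (- i%:Z) (n2 - m%:Z)) tswap)
         (tassoc (bet S13 M%:R i (w m)))) =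
       if i == 0%N then XX X P (n2 - m%:Z - L%:Z) (bet S13 M%:R i (w m)) else 0.
    apply: skew3; have [_ g _] := stable_good_bet M%:R i (gw m).
    by have [] := stable_goodW NL g.
  rewrite sk eqxx big1 => [|i _]; last by rewrite sk.
  by rewrite bet0 addr0; congr (XX _ _ _ _); rewrite /=; lia.
(* Expanding [locF L] produces the series in S23 and the summands of the left-hand side of [cross],
   which moves a past c. *)
have stepB m i : X (n1 - M%:Z - N%:Z + m%:Z + i%:Z)
      (tmap idV (lcomp (locF L (- i%:Z) (n2 - m%:Z)) tswap)
         (tassoc (bet S13 M%:R i (w m)))) =
    \sum_(j < J) XX X (p m - M%:Z + i%:Z) (j%:Z - L%:Z - i%:Z)
      (tmap idV2 (B (n2 - m%:Z - j%:Z)) (P23 (bet S13 M%:R i (v m j)))).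
  set P := n1 - M%:Z - N%:Z + m%:Z + i%:Z.
  rewrite -(tmap_comp idV _ idV) (tmap_locF _ _ (J := J)); last by lia.
  rewrite (linear_sum (X P)); apply: eq_bigr => j _.
  change (X P (tmap idV (locF_term L (- i%:Z) (n2 - m%:Z) j)
      (tmap idV tswap (tassoc (bet S13 M%:R i (w m))))) =
    X (p m - M%:Z + i%:Z) (tmap idV (X (j%:Z - L%:Z - i%:Z)) (tassoc
      (tmap idV2 (B (n2 - m%:Z - j%:Z)) (P23 (bet S13 M%:R i (v m j))))))).
  rewrite tassoc_nat tassoc_P23 /v (bet_comm _ _ _ _ _ S13_23) tassoc_bet23.
  rewrite !tmap_comp /locF_term.
  have -> : p m - M%:Z + i%:Z = P by rewrite /p /P; lia.
  have -> : - i%:Z - L%:Z + j%:Z = j%:Z - L%:Z - i%:Z by lia.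
  congr (X _ _); apply: eq_tmap => // t; rewrite !lcompE.
  by congr (X _ (tmap _ _ _)); symmetry; apply: bet_intertwine => y; rewrite SP.
(* The series in S12, S13 and S23 commute, so the one in S12 can be applied last, where it forms the
   terms of [locF N]. *)
have stepC i j m : tmap idV (lcomp (X (p m - i%:Z)) (tmap idV (B (n2 - m%:Z - j%:Z))))
      (tswap (bet S13 M%:R i (v m j))) =
    tmap idV (locF_term N (n1 - i%:Z) (n2 - j%:Z) m)
      (tswap (bet S23 L%:R j (bet S13 M%:R i x))).
  rewrite /v (bet_comm _ _ _ _ _ S13_23) /w -(bet_comm _ _ _ _ _ S12_13).
  rewrite -(bet_comm _ _ _ _ _ S12_23) tswap_bet12 tmap_comp.
  have -> : p m - i%:Z = n1 - i%:Z - N%:Z + m%:Z by rewrite /p; lia.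
  by have -> : n2 - m%:Z - j%:Z = n2 - j%:Z - m%:Z by lia.
have [I0 hI0] := locA_large N x (n1 - M%:Z) (n2 - L%:Z).
rewrite (hI0 (maxn I0 J)) ?leq_maxl //.
rewrite (@sum_widen _ (fun m => XX X (n1 - M%:Z - N%:Z + m%:Z) (n2 - L%:Z - m%:Z) (w m))
  J) ?leq_maxr //; last first.
  move=> m Jm; rewrite stepA big1 ?scaler0 // => i _.
  rewrite -(tmap_comp idV _ idV) (tmap_locF _ _ (J := 0)) ?big_ord0 ?linear0 //.
  by lia.
under eq_bigr do rewrite stepA.
rewrite -scaler_sumr exprD -scalerA; congr (_ *: _).
have -> : \sum_(m < J) \sum_(i < I') X (n1 - M%:Z - N%:Z + m%:Z + i%:Z)
      (tmap idV (lcomp (locF L (- i%:Z) (n2 - m%:Z)) tswap)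
         (tassoc (bet S13 M%:R i (w m)))) =
    (-1) ^+ M *: \sum_(m < J) \sum_(j < J) \sum_(i < I') X (i%:Z + j%:Z - L%:Z - M%:Z)
      (tmap idV (locF_term N (n1 - i%:Z) (n2 - j%:Z) m)
        (tswap (bet S23 L%:R j (bet S13 M%:R i x)))).
  rewrite scaler_sumr; apply: eq_bigr => m _.
  under eq_bigr do rewrite stepB.
  rewrite exchange_big scaler_sumr; apply: eq_bigr => j _.
  rewrite -[LHS]/(\sum_(i < I') _) crossI; congr (_ *: _); apply: eq_bigr => i _.
  by rewrite stepC; congr (X _ _); lia.
congr (_ *: _); rewrite exchange_big.
under eq_bigr do rewrite exchange_big.
rewrite exchange_big /=.
have E i j : \sum_(m < J) X (i%:Z + j%:Z - L%:Z - M%:Z)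
      (tmap idV (locF_term N (n1 - i%:Z) (n2 - j%:Z) m)
        (tswap (bet S23 L%:R j (bet S13 M%:R i x)))) =
    X (i%:Z + j%:Z - L%:Z - M%:Z) (tmap idV (locF N (n1 - i%:Z) (n2 - j%:Z))
        (tswap (bet S23 L%:R j (bet S13 M%:R i x)))).
  by rewrite (tmap_locF _ _ (J := J)) ?(linear_sum (X _)) //; lia.
under eq_bigr do under eq_bigr do rewrite E.
apply: (@sum_widen _ (fun i => \sum_(j < J) X (i%:Z + j%:Z - L%:Z - M%:Z)
   (tmap idV (locF N (n1 - i%:Z) (n2 - j%:Z))
     (tswap (bet S23 L%:R j (bet S13 M%:R i x)))))); first exact: ltnW.
(* For i >= I the index n1 - i is negative, and F has no such power of z1. *)
move=> i Ii; apply: big1 => j _; rewrite (@kill_swap N) ?linear0 //.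
- exact: even_locF.
- by move=> t lt; rewrite locF_neg1 //; lia.
have [_ g _] := stable_good_bet M%:R i gx; have [_ _ g'] := stable_good_bet L%:R j g.
by have [] := stable_goodW (leqnn N) g'.
Qed.

Fixpoint dF (N p : nat) (n1 n2 : int) : {linear V2 -> V} :=
  if p is p'.+1 then (n1 + 1)%:~R *: dF N p' (n1 + 1) n2 else locF N n1 n2.

(* (d/dz1 - z1^-1 S13)^p applied to locA *)
Fixpoint locD (N p : nat) (x : V3) (n1 n2 : int) : V :=
  if p is p'.+1 then
    (n1 + 1)%:~R *: locD N p' x (n1 + 1) n2 - locD N p' (S13 x) (n1 + 1) n2
  else locA N x n1 n2.

Lemma locDS N p x n1 n2 : locD N p.+1 x n1 n2 =
  (n1 + 1)%:~R *: locD N p x (n1 + 1) n2 - locD N p (S13 x) (n1 + 1) n2.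
Proof. by []. Qed.

Lemma dFS N p n1 n2 t : dF N p.+1 n1 n2 t = (n1 + 1)%:~R *: dF N p (n1 + 1) n2 t.
Proof. by []. Qed.

Lemma locD_linear N p n1 n2 k x y :
  locD N p (k *: x + y) n1 n2 = k *: locD N p x n1 n2 + locD N p y n1 n2.
Proof.
elim: p x y n1 => [|p IHp] x y n1; first exact: (locA_linear Xlow Snil).
rewrite !locDS (linearP S13) !IHp.
by apply: lin_sep => l lD lN l0 lZ; rewrite !(lD, lN, lZ); ring.
Qed.

Lemma even_dF N p n1 n2 : even_map (dF N p n1 n2).
Proof.
elim: p n1 => [|p IHp] n1; first exact: even_locF.
by move=> i t; rewrite !dFS IHp sprZ.
Qed.

Lemma dF_neg1 N p t n1 n2 : loc N t -> n1 < 0 -> dF N p n1 n2 t = 0.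
Proof.
move=> lt; elim: p n1 => [|p IHp] n1 n10; first exact: locF_neg1.
rewrite dFS; have [->|n1N] := eqVneq n1 (-1); first by rewrite addNr scale0r.
by rewrite IHp ?scaler0 //; lia.
Qed.

Lemma dF_neg2 N p t n1 n2 : n2 < 0 -> dF N p n1 n2 t = 0.
Proof.
move=> n20; elim: p n1 => [|p IHp] n1; first exact: locF_neg2.
by rewrite dFS IHp scaler0.
Qed.

Definition cross_term N M L p x (n1 n2 : int) i j :=
  X (i%:Z + j%:Z - L%:Z - M%:Z) (tmap idV (dF N p (n1 - i%:Z) (n2 - j%:Z))
    (tswap (bet S23 L%:R j (bet S13 M%:R i x)))).

Lemma cross_term_neg1 N M L p x n1 n2 i j : stable_good N x -> n1 < i%:Z ->
  cross_term N M L p x n1 n2 i j = 0.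
Proof.
move=> gx n1i; rewrite /cross_term (@kill_swap N) ?linear0 //; first exact: even_dF.
  by move=> t lt; apply: dF_neg1 => //; lia.
have [_ g _] := stable_good_bet M%:R i gx; have [_ _ g'] := stable_good_bet L%:R j g.
by have [] := stable_goodW (leqnn N) g'.
Qed.

(** Induction from [locA_cross] by the Leibniz rule. The derivative of (1 - z1/z3)^(S13 + M) cancels
    the terms in M and S13 by [bet_shift], so that only F is differentiated; each derivative uses up
    one unit of M. *)
Lemma locD_cross N M L p x n1 n2 I J : stable_good N x -> (N + p <= M)%N -> (N <= L)%N ->
  n1 < I%:Z -> n2 < J%:Z ->
  locD N p x (n1 - M%:Z) (n2 - L%:Z) =
  (-1) ^+ (L + M) *: \sum_(i < I) \sum_(j < J) cross_term N M L p x n1 n2 i j.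
Proof.
move=> + + NL + n2J; elim: p M x n1 I => [|p IHp] M x n1 I gx NM n1I.
  by apply: locA_cross => //; lia.
case: M NM => [|M] NM; first by lia.
have [_ gSx _] := stable_good_S gx.
have gx' : stable_good N (M.+1%:R *: x + S13 x) by apply: stable_good_lin.
have NpM : (N + p <= M)%N by lia.
have := IHp M _ n1 I gx' NpM n1I; rewrite locD_linear => E.
have E' := IHp M.+1 x (n1 + 1) I.+1 gx (leqW NpM) ltac:(lia).
have -> : locD N p.+1 x (n1 - M.+1%:Z) (n2 - L%:Z) =
    (n1 + 1)%:~R *: locD N p x (n1 + 1 - M.+1%:Z) (n2 - L%:Z) -
    (M.+1%:R *: locD N p x (n1 - M%:Z) (n2 - L%:Z) + locD N p (S13 x) (n1 - M%:Z) (n2 - L%:Z)).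
  rewrite locDS; have -> : n1 - M.+1%:Z + 1 = n1 - M%:Z by lia.
  have -> : n1 + 1 - M.+1%:Z = n1 - M%:Z by lia.
  have -> : (n1 - M%:Z)%:~R = (n1 + 1)%:~R - M.+1%:R :> K.
    by rewrite -[M.+1%:R]natr1 rmorphB rmorphD /= -[M%:~R]/(M%:R); ring.
  by apply: lin_sep => l lD lN l0 lZ; rewrite !(lD, lN, lZ); ring.
rewrite {}E {}E' addnS exprS mulN1r scaleNr scalerN -opprD scaleNr; congr (- _).
rewrite scalerA mulrC -scalerA -scalerDr; congr (_ *: _).
(* Here n1 + 1 = (n1 - i + 1) + i: the first part differentiates F, the second the power z1^i of the
   binomial series. *)
have -> : (n1 + 1)%:~R *: (\sum_(i < I.+1) \sum_(j < J) cross_term N M.+1 L p x (n1 + 1) n2 i j) =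
  \sum_(i < I.+1) \sum_(j < J) cross_term N M.+1 L p.+1 x n1 n2 i j +
  \sum_(i < I.+1) \sum_(j < J) i%:R *: cross_term N M.+1 L p x (n1 + 1) n2 i j.
  rewrite scaler_sumr -big_split; apply: eq_bigr => i _.
  rewrite scaler_sumr -big_split; apply: eq_bigr => j _.
  rewrite /cross_term; set y := tswap _.
  have -> : n1 + 1 - i%:Z = n1 - i%:Z + 1 by lia.
  have -> : tmap idV (dF N p.+1 (n1 - i%:Z) (n2 - j%:Z)) y =
      (n1 - i%:Z + 1)%:~R *: tmap idV (dF N p (n1 - i%:Z + 1) (n2 - j%:Z)) y.
    exact: tmapZr.
  rewrite (linearZ_LR (X _)) -[X in _ = _ + X]/(i%:R *: _) -scalerDl; congr (_ *: _).
  by rewrite -[i%:R]/(i%:~R) -rmorphD; congr (_%:~R); lia.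
rewrite -addrA [X in _ + X](_ : _ = 0) ?addr0.
  rewrite big_ord_recr /= [X in _ + X]big1 ?addr0 // => j _.
  by apply: cross_term_neg1.
rewrite big_ord_recl big1 ?add0r => [|j _]; last by rewrite scale0r.
apply/eqP; rewrite addr_eq0 -sumrN; apply/eqP; apply: eq_bigr => i _.
rewrite -sumrN; apply: eq_bigr => j _; rewrite lift0 /cross_term.
rewrite -(linearZ_LR (X _)) -(linearZ_LR (tmap _ _)) -(linearZ_LR tswap).
rewrite -(linearZ_LR (bet S23 _ _)) bet_shift.
rewrite -[RHS](linearN (X _)) -(linearN (tmap _ _)) -(linearN tswap) -(linearN (bet S23 _ _)).
have -> : M.+1%:R - 1 = M%:R :> K by rewrite -natr1 addrK.
rewrite (linearD (bet S13 _ _)) (linearZ_LR (bet S13 _ _)).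
rewrite -(@bet_intertwine _ _ _ S13 S13 S13) //.
have -> : n1 + 1 - i.+1%:Z = n1 - i%:Z by lia.
by have -> : i.+1%:Z + j%:Z - L%:Z - M.+1%:Z = i%:Z + j%:Z - L%:Z - M%:Z by lia.
Qed.

Lemma tswap_vac (a : V) : @tswap K V V (a *t vac) = vac *t a.
Proof.
move: a; apply: super_ind => [a b IHa IHb|i a ia].
  by rewrite tensDl tensDr linearD IHa IHb.
by rewrite (tswapE ia vac_even) andbF scale1r.
Qed.

(** * Translation covariance and restriction to the diagonal *)

Section Diagonal.
Variable T : {linear V -> V}.
Hypothesis Tvac : T vac = 0.
Hypothesis Tcov : forall n t, T (X n t) =
  X n (tmap idV T t) + ((n + 1)%:~R *: X (n + 1) t - X (n + 1) (S t)).
Hypothesis Svac : forall b, S (b *t vac) = 0.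
Hypothesis hex : forall n x, S (tmap (X n) idV x) = tmap (X n) idV (S13 x + S23 x).

(** On b (x) vac (x) a the operator S23 vanishes, so the hexagon says that S commutes with X_q(-,
    vac) on the first leg; the swap gives the second leg. *)
Lemma S_Xvac q t : S (tmap idV (B q) t) = tmap idV (B q) (S t).
Proof.
suff h u : S (tmap (B q) idV u) = tmap (B q) idV (S u).
  have eB := even_Xvac q.
  rewrite -[t]tswapK -(@tswap_nat _ _ _ _ _ (B q) idV) // [LHS]SP h.
  by rewrite [in RHS]SP tswap_nat.
pose ins : {linear V2 -> V3} := lcomp P23 (tensl V2 vac).
have insE b a : ins (b *t a) = (b *t vac) *t a.
  change (P23 ((b *t a) *t vac) = (b *t vac) *t a).
  by rewrite leg23E tassocE tmapE tswap_vac tunassocE.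
have insX u' : tmap (X q) idV (ins u') = tmap (B q) idV u'.
  elim/(@tensor_ind K V V): u' => [|x y IHx IHy|b a]; first by rewrite !linear0.
    by rewrite !linearD IHx IHy.
  by rewrite insE !tmapE.
rewrite -!insX hex (linearD (tmap _ _)).
have -> : S13 (ins u) = ins (S u).
  change (S13 (P23 (u *t vac)) = P23 (S u *t vac)).
  by rewrite leg13E leg23P2 /leg12 tmapE.
rewrite [X in _ + X](_ : _ = 0) ?addr0 // -[RHS](linear0 (tmap (X q) idV)); congr (tmap _ _ _).
elim/(@tensor_ind K V V): u => [|x y IHx IHy|b a]; first by rewrite !linear0.
  by rewrite (linearD ins) (linearD S23) IHx IHy addr0.
rewrite insE leg23E tassocE tmapE -tswap_vac SP Svac linear0.
by rewrite tens0r linear0.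
Qed.

Lemma T_Xvac q b : T (B q b) = (q + 1)%:~R *: B (q + 1) b.
Proof.
change (T (X q (b *t vac)) = (q + 1)%:~R *: X (q + 1) (b *t vac)).
by rewrite Tcov Svac linear0 subr0 tmapE Tvac tens0r linear0 add0r.
Qed.

(** T acts on F as d/dz1 + d/dz2: the term - S/z1 in the covariance of X is the effect of d/dz1 +
    d/dz2 on (1 - z2/z1)^S. On coefficients the discrepancy telescopes through [g]. *)
Lemma T_locF N n1 n2 t : T (locF N n1 n2 t) =
  (n1 + 1)%:~R *: locF N (n1 + 1) n2 t + (n2 + 1)%:~R *: locF N n1 (n2 + 1) t.
Proof.
pose J := `|n2|.+2; rewrite !(@locFE _ _ _ J); try by rewrite /J; lia.
pose g m := m%:R *: locF_term N n1 (n2 + 1) m t.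
have g0 : \sum_(m < J) g m = \sum_(m < J) g m.+1.
  have gJ : g J = 0 by rewrite /g locF_term0 ?scaler0 // /J; lia.
  have h : \sum_(m < J.+1) g m = \sum_(m < J) g m by rewrite big_ord_recr /= gJ addr0.
  rewrite -h big_ord_recl [g _]/g scale0r add0r.
  by apply: eq_bigr => i _; rewrite lift0.
have step m : T (locF_term N n1 n2 m t) =
    ((n1 + 1)%:~R *: locF_term N (n1 + 1) n2 m t +
     (n2 + 1)%:~R *: locF_term N n1 (n2 + 1) m t) + (g m.+1 - g m).
  pose u := bet S N%:R m t; pose P := n1 - N%:Z + m%:Z; pose Q := n2 - m%:Z.
  have e1 : locF_term N n1 n2 m t = X P (tmap idV (B Q) u) by [].
  have e2 : locF_term N (n1 + 1) n2 m t = X (P + 1) (tmap idV (B Q) u).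
    by rewrite /P /Q !lcompE; congr (X _ _); lia.
  have e3 : locF_term N n1 (n2 + 1) m t = X P (tmap idV (B (Q + 1)) u).
    by rewrite /P !lcompE; congr (X _ (tmap _ (B _) _)); rewrite /Q; lia.
  have e4 : g m.+1 = (m%:R - N%:R) *: X (P + 1) (tmap idV (B Q) u) -
      X (P + 1) (S (tmap idV (B Q) u)).
    rewrite /g !lcompE; have -> : n1 - N%:Z + m.+1%:Z = P + 1 by rewrite /P; lia.
    have -> : n2 + 1 - m.+1%:Z = Q by rewrite /Q; lia.
    rewrite -!(linearZ_LR (X _)) -(linearZ_LR (tmap _ _)) betS.
    by rewrite (linearB (tmap _ _)) (linearZ_LR (tmap _ _)) -S_Xvac (linearB (X _)).
  rewrite e1 Tcov e2 e4 /g e3 tmap_comp.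
  have -> : tmap (lcomp idV idV) (lcomp T (B Q)) u = (Q + 1)%:~R *: tmap idV (B (Q + 1)) u.
    rewrite -tmapZr; apply: eq_tmap => // b.
    by rewrite linZE -T_Xvac.
  rewrite (linearZ_LR (X _)).
  have -> : (P + 1)%:~R = (n1 + 1)%:~R - N%:R + m%:R :> K.
    by rewrite -[N%:R]/(N%:Z%:~R) -[m%:R]/(m%:Z%:~R) -rmorphB -rmorphD; congr (_%:~R); rewrite /P; lia.
  have -> : (Q + 1)%:~R = (n2 + 1)%:~R - m%:R :> K.
    by rewrite -[m%:R]/(m%:Z%:~R) -rmorphB; congr (_%:~R); rewrite /Q; lia.
  by apply: lin_sep => l lD lN l0 lZ; rewrite !(lD, lN, lZ); ring.
rewrite (linear_sum T); under eq_bigr do rewrite step.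
rewrite big_split -[RHS]addr0.
congr (_ + _); first by rewrite big_split !scaler_sumr.
by rewrite sumrB -g0 subrr.
Qed.

Lemma T_dF N p n1 n2 t : T (dF N p n1 n2 t) =
  (n1 + 1)%:~R *: dF N p (n1 + 1) n2 t + (n2 + 1)%:~R *: dF N p n1 (n2 + 1) t.
Proof.
elim: p n1 => [|p IHp] n1; first exact: T_locF.
rewrite !dFS linearZ_LR IHp scalerDr; congr (_ + _).
by rewrite !scalerA mulrC.
Qed.

Lemma dF_fact N p k n2 t :
  k`!%:R *: dF N p k%:Z n2 t = (p + k)`!%:R *: locF N (p + k)%N%:Z n2 t.
Proof.
elim: p k => [|p IHp] k; first by rewrite add0n.
have E : k%:Z + 1 = k.+1 by lia.
rewrite dFS E addSnnS -IHp scalerA; congr (_ *: _).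
by rewrite factS mulnC natrM.
Qed.

(** On the diagonal d1^p F is p! X(z)(X_(p-N) t) vac: at r = 0 this is [locF_0], and applying T to
    both sides leads from r to r + 1. *)
Lemma dF_diag N p r t :
  \sum_(b < r.+1) dF N p b%:Z (r%:Z - b%:Z) t =
  p`!%:R *: B r%:Z (X (p%:Z - N%:Z) t).
Proof.
elim: r => [|r IHr].
  rewrite big_ord1 subrr Xvac0 -locF_0; have := dF_fact N p 0 0 t.
  by rewrite addn0 fact0 scale1r.
have neq : r.+1%:R != 0 :> K by rewrite pnatr_eq0.
apply: (scalerI neq); have := congr1 T IHr; rewrite linearZ_LR T_Xvac.
have -> : r%:Z + 1 = r.+1 by lia.
rewrite scalerA mulrC -scalerA -[_.+1%:~R]/(r.+1%:R) => <-.
rewrite (linear_sum T); under [RHS]eq_bigr do rewrite T_dF.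
rewrite [RHS]big_split.
have -> : r.+1%:R *: \sum_(b < r.+2) dF N p b (r.+1%:Z - b%:Z) t =
    \sum_(b < r.+2) b%:R *: dF N p b (r.+1%:Z - b%:Z) t +
    \sum_(b < r.+2) (r.+1 - b)%:R *: dF N p b (r.+1%:Z - b%:Z) t.
  rewrite -big_split scaler_sumr; apply: eq_bigr => b _ /=.
  by rewrite -scalerDl -natrD subnKC // -ltnS.
congr (_ + _).
  rewrite big_ord_recl scale0r add0r; apply: eq_bigr => b _; rewrite lift0.
  have -> : b%:Z + 1 = b.+1 by lia.
  by have -> : r.+1%:Z - b.+1%:Z = r%:Z - b%:Z by lia.
rewrite big_ord_recr /= subnn scale0r addr0; apply: eq_bigr => b _.
have -> : r%:Z - b%:Z + 1 = r.+1%:Z - b%:Z by lia.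
have -> : r.+1%:Z - b%:Z = (r.+1 - b)%N by have := ltn_ord b; lia.
by [].
Qed.

Lemma dF_conv N p t q i j : loc N t -> (i <= q)%N -> (j <= q)%N ->
  \sum_(a < q.+1) dF N p (a%:Z - i%:Z) (q%:Z - a%:Z - j%:Z) t =
  p`!%:R *: B (q%:Z - i%:Z - j%:Z) (X (p%:Z - N%:Z) t).
Proof.
move=> lt iq jq; pose f (a : int) := dF N p (a - i%:Z) (q%:Z - a - j%:Z) t.
have E : \sum_(a < q.+1) f a%:Z = \sum_(a \in [set: int]) f a.
  rewrite (@fsum_int _ _ 0 q.+1).
  - by apply: eq_bigr => a _; rewrite add0r.
  - by move=> a a0; apply: dF_neg1 => //; lia.
  by move=> a aq; apply: dF_neg2; lia.
have [qij|qij] := leqP (i + j) q; last first.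
  rewrite big1; last first.
    move=> a _; have [ai|ia] := ltnP a i; first by rewrite dF_neg1 //; lia.
    by rewrite dF_neg2 //; lia.
  by rewrite Xvac_neg ?lin0E ?scaler0 //; lia.
have -> : q%:Z - i%:Z - j%:Z = (q - (i + j))%N%:Z by lia.
rewrite -dF_diag; rewrite -[LHS]/(\sum_(a < q.+1) f a%:Z) E.
rewrite (@fsum_int _ _ i%:Z (q - (i + j)).+1).
- by apply: eq_bigr => b _; rewrite /f; congr (dF _ _ _ _ _); lia.
- by move=> a a0; apply: dF_neg1 => //; lia.
by move=> a aq; apply: dF_neg2; lia.
Qed.

Hypothesis loc_ex : forall t, exists N, loc N t.

(** [locD_cross] with M = L = N + p and an empty range for i or j. *)
Lemma locD_neg N p x (n1 n2 : int) : stable_good N x ->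
  n1 < - (N + p)%N%:Z \/ n2 < - (N + p)%N%:Z -> locD N p x n1 n2 = 0.
Proof.
move=> gx h.
have := @locD_cross N (N + p) (N + p) p x (n1 + (N + p)%N%:Z) (n2 + (N + p)%N%:Z).
rewrite !addrK => E; case: h => h.
  rewrite (E 0%N (`|n2 + (N + p)%N%:Z|.+1)) ?big_ord0 ?scaler0 //; lia.
rewrite (E (`|n1 + (N + p)%N%:Z|.+1) 0%N) //; try lia.
by rewrite big1 ?scaler0 // => i _; rewrite big_ord0.
Qed.

(** [locD_cross] makes the left-hand side a double sum of diagonals of d1^p F. The series in S13 and
    S23 combine, and the hexagon turns them into the series in S of [locF (N + M)] on the swap of y;
    locality of y then gives X_n y. *)
Theorem locD_diag N p x n : stable_good N x ->
  \sum_(n1 \in [set: int]) locD N p x n1 (n - n1) =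
  p`!%:R *: X n (tmap (X (p%:Z - N%:Z)) idV x).
Proof.
move=> gx; pose y := tmap (X (p%:Z - N%:Z)) idV x.
(* N + p is what [locD_cross] asks of M; adding N' makes N + M a locality order for y. *)
have [N' lN'] := loc_ex y; pose M := (N + p + N')%N.
have ly : loc (N + M) y by apply: loc_mono lN' => //; rewrite /M; lia.
have star0 n1 n2 I J : n1 < I%:Z -> n2 < J%:Z ->
    locD N p x (n1 - M%:Z) (n2 - N%:Z) =
    (-1) ^+ (N + M) *: \sum_(i < I) \sum_(j < J) cross_term N M N p x n1 n2 i j.
  by move=> h1 h2; apply: locD_cross => //; rewrite /M; lia.
have D1 n1 n2 : n1 < - M%:Z -> locD N p x n1 n2 = 0.
  move=> h; have := star0 (n1 + M%:Z) (n2 + N%:Z) 0%N (`|n2 + N%:Z|.+1).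
  by rewrite !addrK big_ord0 scaler0; apply; lia.
have D2 n1 n2 : n2 < - N%:Z -> locD N p x n1 n2 = 0.
  move=> h; have := star0 (n1 + M%:Z) (n2 + N%:Z) (`|n1 + M%:Z|.+1) 0%N.
  rewrite !addrK => -> //; try lia.
  by rewrite big1 ?scaler0 // => i _; rewrite big_ord0.
(* For n' < 0 both sides vanish: on the left the poles have orders at most M and N, on the right y
   is local of order N + M. *)
pose n' := n + M%:Z + N%:Z; have [n'0|] := ltP n' 0.
  rewrite fsbig1 => [|n1 _]; last first.
    have [/D1->//|h] := ltP n1 (- M%:Z); apply: D2; move: n'0; rewrite /n'; lia.
  rewrite -/y; have -> : n = n' - (N + M)%N%:Z by rewrite /n'; lia.
  by rewrite -locF_0 locF_neg1 ?scaler0.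
case En' : n' => [q|//] _.
rewrite (@fsum_int _ _ (- M%:Z) q.+1); first last.
- by move=> a aq; apply: D2; move: En'; rewrite /n'; lia.
- by move=> a; exact: D1.
have E (a : 'I_q.+1) : locD N p x (- M%:Z + a%:Z) (n - (- M%:Z + a%:Z)) =
    (-1) ^+ (N + M) *: \sum_(i < q.+1) \sum_(j < q.+1)
      cross_term N M N p x a%:Z (q%:Z - a%:Z) i j.
  rewrite -star0; [|have := ltn_ord a; lia|lia].
  by congr (locD _ _ _ _ _); move: En'; rewrite /n'; lia.
under eq_bigr do rewrite E.
rewrite -scaler_sumr exchange_big.
under eq_bigr do rewrite exchange_big.
pose h i j := X (i%:Z + j%:Z - (N + M)%N%:Z)
  (tmap idV (B (q%:Z - i%:Z - j%:Z)) (tswap (tmap (X (p%:Z - N%:Z)) idV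
     (bet S23 N%:R j (bet S13 M%:R i x))))).
have Eij (i j : 'I_q.+1) : \sum_(a < q.+1) cross_term N M N p x a%:Z (q%:Z - a%:Z) i j =
    p`!%:R *: h i j.
  rewrite /cross_term /h -(linear_sum (X _)) -tmap_suml.
  set z := bet S23 _ _ _.
  have gz : spanned N z.
    have [_ g _] := stable_good_bet M%:R i gx.
    by have [_ _ /(stable_goodW (leqnn N)) []] := stable_good_bet N%:R j g.
  pose G0 : {linear V2 -> V} := lcomp (B (q%:Z - i%:Z - j%:Z)) (X (p%:Z - N%:Z)).
  pose G1 : {linear V2 -> V} :=
    \sum_(a < q.+1) dF N p (a%:Z - i%:Z) (q%:Z - a%:Z - j%:Z).
  have eG0 : even_map G0 by apply: even_lcomp => //; exact: even_Xvac.
  have eG1 : even_map G1.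
    move=> b t; rewrite /G1 !lin_sumE (linear_sum (spr b : {linear V -> V})).
    by apply: eq_bigr => a _; exact: even_dF.
  (* [dF_conv] holds on local tensors only, so it is stated as the vanishing of an even map and
     carried to z by [kill_swap]. *)
  pose G2 := (- p`!%:R) *: G0 + G1.
  have eG2 : even_map G2.
    by move=> b t; rewrite /G2 !(linDE (_ *: G0)) !linZE eG0 eG1 sprD sprZ.
  have G20 t : loc N t -> G2 t = 0.
    move=> lt; rewrite /G2 (linDE (_ *: G0)) linZE /G1 lin_sumE dF_conv //.
    - by rewrite scaleNr addNr.
    - by rewrite -ltnS.
    by rewrite -ltnS.
  have := kill_swap eG2 G20 gz; rewrite /G2 tmap_linr scaleNr addrC => /eqP.
  rewrite subr_eq0 => /eqP K0; rewrite -/G1 K0 (linearZ_LR (X _)).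
  congr (_ *: X _ _); first by lia.
  by rewrite tswap_nat // tmap_comp; apply: eq_tmap.
under eq_bigr do under eq_bigr do rewrite Eij.
rewrite exchange_big /=.
rewrite (@sum_triangle _ (fun j i => p`!%:R *: h i j)); last first.
  move=> j i ij; rewrite /h Xvac_neg; last by lia.
  by rewrite tmap0r linear0 scaler0.
under eq_bigr do rewrite -scaler_sumr.
rewrite -scaler_sumr scalerA mulrC -scalerA -/y; congr (_ *: _).
have -> : n = q%:Z - (N + M)%N%:Z by move: En'; rewrite /n'; lia.
rewrite -locF_0 (locF_sym _ _ ly); congr (_ *: _).
rewrite (@locFE _ _ _ q.+1); last by lia.
apply: eq_bigr => l _.
pose Lm : {linear V3 -> V} := lcomp (X (0 - (N + M)%N%:Z + l%:Z))
  (lcomp (tmap idV (B (q%:Z - l%:Z))) (lcomp tswap (tmap (X (p%:Z - N%:Z)) idV))).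
have LmE z : Lm z = X (0 - (N + M)%N%:Z + l%:Z) (tmap idV (B (q%:Z - l%:Z))
    (tswap (tmap (X (p%:Z - N%:Z)) idV z))) by [].
have hE (i : 'I_l.+1) : h (l - i)%N i = Lm (bet S23 N%:R i (bet S13 M%:R (l - i) x)).
  have il : (i <= l)%N by rewrite -ltnS.
  rewrite /h LmE; have -> : (l - i)%N%:Z + i%:Z - (N + M)%N%:Z = 0 - (N + M)%N%:Z + l%:Z.
    by lia.
  by have -> : q%:Z - (l - i)%N%:Z - i%:Z = q%:Z - l%:Z by lia.
under eq_bigr do rewrite hE.
(* The terms of total degree l form the coefficient of t^l in (1 - t)^(S23 + S13 + N + M). *)
rewrite -(linear_sum Lm) (@bet_vandermonde _ _ S23 S13); last by move=> u; rewrite S13_23.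
rewrite LmE /locF_term -natrD; congr (X _ (tmap _ _ _)).
have -> : tmap (X (p%:Z - N%:Z)) idV (bet (S23 + S13) (N + M)%:R l x) =
    bet S (N + M)%:R l y.
  apply: (@bet_intertwine _ _ _ (S23 + S13) S) => u.
  by rewrite hex (linDE S23) [S13 u + _]addrC.
by apply: bet_intertwine => u; rewrite SP.
Qed.
End Diagonal.
End CoreVacuum.

(** * Series in two variables with logarithms *)

Section Series.
Context {K : numFieldType} {V : lmodType K}.
Local Notation series := (series2 V).
Implicit Types f g : series.

Lemma series_ext f g : (forall n1 n2 k1 k2, f n1 n2 k1 k2 = g n1 n2 k1 k2) -> f = g.
Proof. by move=> h; do 4 apply/funext => ?. Qed.

Definition low2 (k : nat) f :=
  forall n1 n2 k1 k2, n2 < - k%:Z -> f n1 n2 k1 k2 = 0.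

(** Cutting the logarithm after J terms makes the operator linear on all series; for series bounded
    below in z2 it agrees with [theta12] at a given n2 once J is large. *)
Definition theta_trunc J f : series := fun n1 n2 k1 k2 =>
  (if k1 is k.+1 then f n1 n2 k k2 else 0) -
  \sum_(m < J) m.+1%:R^-1 *: f (n1 + m.+1%:Z) (n2 - m.+1%:Z) k1 k2.

Lemma theta_truncP J c f g h :
  (forall n1 n2 k1 k2, h n1 n2 k1 k2 = c *: f n1 n2 k1 k2 + g n1 n2 k1 k2) ->
  forall n1 n2 k1 k2, theta_trunc J h n1 n2 k1 k2 =
    c *: theta_trunc J f n1 n2 k1 k2 + theta_trunc J g n1 n2 k1 k2.
Proof.
move=> hE n1 n2 k1 k2; rewrite /theta_trunc scalerBr addrACA -opprD; congr (_ - _).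
  by case: k1 => [|k1]; rewrite ?scaler0 ?addr0 ?hE.
rewrite scaler_sumr -big_split; apply: eq_bigr => m _ /=.
by rewrite hE scalerDr !scalerA mulrC.
Qed.

Lemma iter_theta_truncP J r c f g h :
  (forall n1 n2 k1 k2, h n1 n2 k1 k2 = c *: f n1 n2 k1 k2 + g n1 n2 k1 k2) ->
  forall n1 n2 k1 k2, iter r (theta_trunc J) h n1 n2 k1 k2 =
    c *: iter r (theta_trunc J) f n1 n2 k1 k2 + iter r (theta_trunc J) g n1 n2 k1 k2.
Proof. by move=> hE; elim: r => // r IHr; rewrite !iterS; exact: theta_truncP. Qed.

Lemma iter_theta_trunc0 J r f : (forall n1 n2 k1 k2, f n1 n2 k1 k2 = 0) ->
  forall n1 n2 k1 k2, iter r (theta_trunc J) f n1 n2 k1 k2 = 0.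
Proof.
move=> f0; elim: r => // r IHr n1 n2 k1 k2; rewrite iterS /theta_trunc big1 => [|m _].
  by rewrite subr0; case: k1.
by rewrite IHr scaler0.
Qed.

Lemma theta12_k2 f r k2 : (forall n1 n2 k1, f n1 n2 k1 k2 = 0) ->
  forall n1 n2 k1, iter r theta12 f n1 n2 k1 k2 = 0.
Proof.
move=> f0; elim: r => //= r IHr n1 n2 k1; rewrite /theta12 fsbig1 ?subr0.
  by case: k1.
by move=> m _; rewrite IHr scaler0.
Qed.

Lemma theta12E k f n1 n2 k1 k2 J : low2 k f -> n2 + k%:Z < J%:Z ->
  theta12 f n1 n2 k1 k2 = theta_trunc J f n1 n2 k1 k2.
Proof.
move=> fk nJ; congr (_ - _); rewrite (fsbigE (iota 1 J)) ?iota_uniq //.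
- have -> : iota 1 J = index_iota 1 J.+1 by rewrite /index_iota subSS subn0.
  rewrite big_add1 big_mkord big_mkcond /=.
  by apply: eq_bigr => m _; rewrite mem_set.
- by move=> m /=; rewrite mem_iota => /andP[].
move=> m /= m0; rewrite mem_iota m0 /= => mJ; rewrite fk ?scaler0 //; lia.
Qed.

Lemma low2_theta12 k f : low2 k f -> low2 k (theta12 f).
Proof.
move=> fk n1 n2 k1 k2 nk; rewrite (@theta12E k _ _ _ _ _ 0) //; last by lia.
rewrite /theta_trunc big_ord0 subr0; case: k1 => // k1; exact: fk.
Qed.

Lemma low2_iter k f r : low2 k f -> low2 k (iter r theta12 f).
Proof. by move=> fk; elim: r => //= r; exact: low2_theta12. Qed.

Lemma iter_theta12E k f r n1 n2 k1 k2 J : low2 k f -> n2 + k%:Z < J%:Z ->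
  iter r theta12 f n1 n2 k1 k2 = iter r (theta_trunc J) f n1 n2 k1 k2.
Proof.
move=> fk; elim: r n1 n2 k1 k2 => // r IHr n1 n2 k1 k2 nJ.
rewrite iterS (theta12E _ _ _ (low2_iter r fk) nJ) iterS /theta_trunc.
congr (_ - _); first by case: k1 => // k1; exact: IHr.
by apply: eq_bigr => m _; rewrite IHr //; lia.
Qed.

Lemma exp_thetaE k (g : nat -> series) r0 J n1 n2 k1 k2 :
  (forall r, (r0 <= r)%N -> g r = 0) -> (forall r, low2 k (g r)) ->
  n2 + k%:Z < J%:Z ->
  exp_theta theta12 g n1 n2 k1 k2 =
  \sum_(r < r0) r`!%:R^-1 *: iter r (theta_trunc J) (g r) n1 n2 k1 k2.
Proof.
move=> g0 gk nJ; rewrite /exp_theta (@fsum_nat _ _ r0) => [|r rr].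
  by apply: eq_bigr => r _; rewrite (iter_theta12E _ _ _ _ (gk r) nJ).
by rewrite g0 // theta12_k2 // scaler0.
Qed.

Definition dzeta1 f : series := fun n1 n2 k1 k2 => k1.+1%:R *: f n1 n2 k1.+1 k2.

Lemma dzeta1_trunc J f n1 n2 k1 k2 : dzeta1 (theta_trunc J f) n1 n2 k1 k2 =
  theta_trunc J (dzeta1 f) n1 n2 k1 k2 + f n1 n2 k1 k2.
Proof.
rewrite /dzeta1 /theta_trunc scalerBr scaler_sumr.
have -> : \sum_(i < J) k1.+1%:R *: (i.+1%:R^-1 *: f (n1 + i.+1%:Z) (n2 - i.+1%:Z) k1.+1 k2) =
   \sum_(m < J) m.+1%:R^-1 *: (k1.+1%:R *: f (n1 + m.+1%:Z) (n2 - m.+1%:Z) k1.+1 k2).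
  by apply: eq_bigr => m _; rewrite !scalerA mulrC.
rewrite addrAC; congr (_ - _); case: k1 => [|k1]; first by rewrite scale1r add0r.
by rewrite -[k1.+2%:R]natr1 scalerDl scale1r.
Qed.

Lemma dzeta1_iter J f r n1 n2 k1 k2 : dzeta1 (iter r (theta_trunc J) f) n1 n2 k1 k2 =
  iter r (theta_trunc J) (dzeta1 f) n1 n2 k1 k2 +
  r%:R *: iter r.-1 (theta_trunc J) f n1 n2 k1 k2.
Proof.
elim: r n1 n2 k1 k2 => [|r IHr] n1 n2 k1 k2; first by rewrite scale0r addr0.
rewrite iterS dzeta1_trunc (@theta_truncP J r%:R (iter r.-1 (theta_trunc J) f)
  (iter r (theta_trunc J) (dzeta1 f))) => [|*]; last by rewrite IHr addrC.
rewrite -[RHS]/(theta_trunc J (iter r (theta_trunc J) (dzeta1 f)) n1 n2 k1 k2 +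
  r.+1%:R *: iter r (theta_trunc J) f n1 n2 k1 k2) [X in X + _ = _]addrC -addrA.
congr (_ + _); case: r {IHr} => [|r]; first by rewrite scale0r add0r scale1r.
by rewrite -[r.+2%:R]natr1 scalerDl scale1r.
Qed.

(** Leibniz rule with d theta12/dzeta1 = 1; the factor S that comes down from the exponential is the
    shift from g r to g r.+1. *)
Lemma exp_theta_dzeta1 k (g : nat -> series) r0 n1 n2 k1 k2 :
  (forall r, (r0 <= r)%N -> g r = 0) -> (forall r, low2 k (g r)) ->
  k1.+1%:R *: exp_theta theta12 g n1 n2 k1.+1 k2 =
  exp_theta theta12 (fun r => dzeta1 (g r) + g r.+1) n1 n2 k1 k2.
Proof.
move=> g0 gk; pose J := (k + `|n2|.+1)%N; have nJ : n2 + k%:Z < J%:Z by rewrite /J; lia.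
rewrite (exp_thetaE _ _ _ g0 gk nJ) (@exp_thetaE k _ r0 J) //; first last.
- move=> r m1 m2 l1 l2 h; rewrite -[LHS]/(_ *: g r _ _ _ _ + g r.+1 _ _ _ _).
  by rewrite !gk // scaler0 addr0.
- move=> r rr; rewrite !g0 //; last exact: leqW.
  by rewrite addr0; apply: series_ext => *; exact: scaler0.
pose h r := r`!%:R^-1 *: (r%:R *: iter r.-1 (theta_trunc J) (g r) n1 n2 k1 k2).
have h0 : \sum_(r < r0) h r = \sum_(r < r0) h r.+1.
  have E : \sum_(r < r0.+1) h r = \sum_(r < r0) h r.
    rewrite big_ord_recr /= [h r0]/h g0 // iter_theta_trunc0 //.
    by rewrite !scaler0 addr0.
  by rewrite -E big_ord_recl [h _]/h scale0r scaler0 add0r;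
    apply: eq_bigr => i _; rewrite lift0.
rewrite scaler_sumr.
have -> : \sum_(r < r0) r`!%:R^-1 *: iter r (theta_trunc J) (dzeta1 (g r) + g r.+1) n1 n2 k1 k2 =
   \sum_(r < r0) (r`!%:R^-1 *: iter r (theta_trunc J) (dzeta1 (g r)) n1 n2 k1 k2 + h r.+1).
  apply: eq_bigr => r _.
  rewrite (@iter_theta_truncP J r 1 (dzeta1 (g r)) (g r.+1)) => [|*]; last by rewrite scale1r.
  rewrite scale1r scalerDr.
  congr (_ + _); rewrite /h scalerA factS natrM invfM mulrAC mulVf ?mul1r //.
  by rewrite pnatr_eq0.
rewrite big_split /= -h0 -big_split; apply: eq_bigr => r _ /=.
rewrite scalerA mulrC -scalerA -scalerDr; congr (_ *: _).
exact: (dzeta1_iter J (g r) r).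
Qed.

(* the truncated series of log (1 - t) *)
Definition logp J : {poly K} := \poly_(m < J.+1) (if m is j.+1 then - j.+1%:R^-1 else 0).

(** With L = [logp J], (1 - 'X) L' = 'X^J - 1, so that (1 - 'X) (L^(r+1))' = - (r + 1) L^r in
    degrees below J. *)
Lemma logp_coef_rec J r m : (m < J)%N ->
  m.+1%:R * (logp J ^+ r.+1)`_m.+1 =
  m%:R * (logp J ^+ r.+1)`_m - r.+1%:R * (logp J ^+ r)`_m.
Proof.
move=> mJ.
have dL i : (logp J)^`()`_i = - (i < J)%:R.
  rewrite coef_deriv coef_poly ltnS; case: ltnP => _; last by rewrite mul0rn oppr0.
  by rewrite mulNrn -(mulr_natr _^-1) mulVf // pnatr_eq0.
have E : (1 - 'X) * (logp J)^`() = 'X^J - 1.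
  apply/polyP => i; rewrite mulrBl mul1r !coefB coefXM coefXn coef1 !dL.
  case: i => [|i].
    by rewrite subr0; case: J {mJ dL} => [|J]; rewrite /= ?oppr0 ?subrr ?sub0r.
  rewrite /= subr0; case: (ltngtP i.+1 J) => _ /=; first by rewrite subrr.
    by rewrite subrr.
  by rewrite oppr0 opprK add0r.
have := congr1 (fun p : {poly K} => ((p * logp J ^+ r) *+ r.+1)`_m) E.
have -> : (1 - 'X) * (logp J)^`() * logp J ^+ r *+ r.+1 =
    (1 - 'X) * (logp J ^+ r.+1)^`() by rewrite deriv_exp mulrnAr mulrA.
rewrite mulrBl mul1r coefB coefXM !coef_deriv coefMn mulrBl mul1r coefB coefXnM mJ.
rewrite sub0r mulNrn !mulr_natl; case: m {mJ} => [|m] /= h.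
  by rewrite mulr0n sub0r -h subr0.
by apply: (eq_from_sub h); rewrite opprK opprB addrA addrAC.
Qed.

Lemma logpX_coef0 J r : (logp J ^+ r)`_0 = (r == 0%N)%:R.
Proof. by rewrite -horner_coef0 horner_exp horner_coef0 coef_poly /= expr0n. Qed.

(** (1 - t)^A = exp (A log (1 - t)): by [logp_coef_rec] both sides satisfy the recursion [betS]. *)
Lemma bet_logp (W : lmodType K) (A : {linear W -> W}) x r0 J m : iter r0 A x = 0 ->
  (m <= J)%N ->
  bet A 0 m x = \sum_(r < r0) (r`!%:R^-1 * (logp J ^+ r)`_m) *: iter r A x.
Proof.
move=> Ax; elim: m => [|m IHm] mJ.
  rewrite bet0; case: r0 Ax => [|r0] Ax; first by rewrite big_ord0.
  rewrite big_ord_recl logpX_coef0 fact0 invr1 mulr1 scale1r big1 ?addr0 // => i _.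
  by rewrite logpX_coef0 lift0 mulr0 scale0r.
have neq : m.+1%:R != 0 :> K by rewrite pnatr_eq0.
apply: (scalerI neq); rewrite betS subr0 IHm; last exact: ltnW.
pose h r : W := r%:R *: ((r`!%:R^-1 * (logp J ^+ r.-1)`_m) *: iter r A x).
have h0 : \sum_(r < r0) h r = \sum_(r < r0) h r.+1.
  have E : \sum_(r < r0.+1) h r = \sum_(r < r0) h r.
    by rewrite big_ord_recr /= [h r0]/h Ax !scaler0 addr0.
  by rewrite -E big_ord_recl [h _]/h scale0r add0r; apply: eq_bigr => i _; rewrite lift0.
have -> : A (\sum_(r < r0) (r`!%:R^-1 * (logp J ^+ r)`_m) *: iter r A x) =
    \sum_(r < r0) h r.+1.
  rewrite (linear_sum A); apply: eq_bigr => r _; rewrite (linearZ_LR A) /h scalerA.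
  rewrite mulrA factS natrM invfM mulrA mulfV ?mul1r // pnatr_eq0 //.
rewrite -h0 !scaler_sumr -sumrB; apply: eq_bigr => r _; rewrite /h !scalerA -scalerBl.
congr (_ *: _); case: (r : nat) => [|r'].
  rewrite !expr0 !coef1 mul0r subr0 /= !mulr0; case: eqP => [->|_]; first by rewrite mul0r.
  by rewrite !mulr0.
have E := congr1 (fun z => r'.+1`!%:R^-1 * z) (logp_coef_rec r' mJ).
by apply: (eq_from_sub (esym E)); rewrite [_.-1]/=; ring.
Qed.

(** On the part free of zeta1, [theta_trunc J] is multiplication by the polynomial [logp J] in
    z2/z1. *)
Lemma iter_trunc0 J r f n1 n2 k2 Q : (size (logp J ^+ r) <= Q)%N ->
  iter r (theta_trunc J) f n1 n2 0 k2 =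
  \sum_(m < Q) (logp J ^+ r)`_m *: f (n1 + m%:Z) (n2 - m%:Z) 0%N k2.
Proof.
elim: r n1 n2 Q => [|r IHr] n1 n2 Q sQ.
  rewrite expr0 size_poly1 in sQ *; case: Q sQ => // Q _.
  rewrite big_ord_recl big1 ?addr0 => [|i _]; last by rewrite coef1 scale0r.
  by rewrite coef1 scale1r; congr (f _ _ _ _); rewrite /=; lia.
pose Q' := (size (logp J) + size (logp J ^+ r) + J.+1)%N.
have -> : iter r.+1 (theta_trunc J) f n1 n2 0 k2 =
    \sum_(j < Q') \sum_(m < Q') ((logp J)`_j * (logp J ^+ r)`_m) *:
       f (n1 + (j + m)%N%:Z) (n2 - (j + m)%N%:Z) 0%N k2.
  have -> : iter r.+1 (theta_trunc J) f n1 n2 0 k2 =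
      \sum_(j < Q') (logp J)`_j *: iter r (theta_trunc J) f (n1 + j%:Z) (n2 - j%:Z) 0%N k2.
    pose e j := (logp J)`_j *: iter r (theta_trunc J) f (n1 + j%:Z) (n2 - j%:Z) 0%N k2.
    rewrite iterS -[LHS]/(0 - _) sub0r -[RHS]/(\sum_(j < Q') e j).
    rewrite (@sum_widen _ e J.+1 Q') ?leq_addl //; last first.
      by move=> j Jj; rewrite /e coef_poly ltnNge Jj scale0r.
    rewrite big_ord_recl [e _]/e coef_poly scale0r add0r -sumrN; apply: eq_bigr => j _.
    by rewrite lift0 /e coef_poly ltnS ltn_ord scaleNr.
  apply: eq_bigr => j _; rewrite (IHr _ _ Q') ?scaler_sumr; last first.
    by rewrite /Q' -addnA addnCA leq_addr.
  apply: eq_bigr => m _; rewrite scalerA; congr (_ *: f _ _ _ _); lia.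
rewrite (@sum_triangle _ (fun j m => ((logp J)`_j * (logp J ^+ r)`_m) *:
       f (n1 + (j + m)%N%:Z) (n2 - (j + m)%N%:Z) 0%N k2)); last first.
  move=> i j ij; have [h|h] := leqP (size (logp J)) i.
    by rewrite nth_default // mul0r scale0r.
  rewrite [X in _ * X]nth_default ?mulr0 ?scale0r // -(leq_add2l (size (logp J))).
  apply: leq_trans (leq_addr J.+1 _) _; apply: leq_trans ij _.
  by rewrite leq_add2r ltnW.
pose e m := (logp J ^+ r.+1)`_m *: f (n1 + m%:Z) (n2 - m%:Z) 0%N k2.
have -> : \sum_(l < Q') \sum_(i < l.+1) ((logp J)`_i * (logp J ^+ r)`_(l - i)) *:
    f (n1 + (i + (l - i))%N%:Z) (n2 - (i + (l - i))%N%:Z) 0%N k2 = \sum_(l < Q') e l.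
  apply: eq_bigr => l _; rewrite /e exprS coefM scaler_suml; apply: eq_bigr => i _.
  by rewrite subnKC // -ltnS.
rewrite -[RHS]/(\sum_(m < Q) e m).
have e0 m : (size (logp J ^+ r.+1) <= m)%N -> e m = 0.
  by move=> h; rewrite /e nth_default // scale0r.
rewrite -(@sum_widen _ e Q' (maxn Q Q')) ?leq_maxr //; last first.
  move=> m Qm; apply: e0; rewrite exprS; apply: leq_trans (size_polyMleq _ _) _.
  apply: leq_trans (leq_pred _) _; exact: leq_trans (leq_addr J.+1 _) Qm.
by rewrite (@sum_widen _ e Q) ?leq_maxl // => m Qm; apply: e0; exact: leq_trans Qm.
Qed.

(** At zeta1^0 the operator e^(theta12 A) is (1 - z2/z1)^A, by [iter_trunc0] and [bet_logp]. *)
Lemma exp_theta_bet (W : lmodType K) (A : {linear W -> W}) (G : {linear W -> series})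
    x r0 k n1 n2 k2 J : iter r0 A x = 0 ->
  (forall r, low2 k (G (iter r A x))) -> n2 + k%:Z < J%:Z ->
  exp_theta theta12 (fun r => G (iter r A x)) n1 n2 0 k2 =
  \sum_(m < J) G (bet A 0 m x) (n1 + m%:Z) (n2 - m%:Z) 0%N k2.
Proof.
move=> Ax Gk nJ; rewrite (@exp_thetaE k _ r0 J) // => [|r rr]; last first.
  by rewrite (iter_nil_le rr Ax) linear0.
have Glin m1 m2 : linear (fun y => G y m1 m2 0%N k2) by move=> a u v; rewrite linearP.
transitivity (\sum_(r < r0) \sum_(m < J) (r`!%:R^-1 * (logp J ^+ r)`_m) *:
   G (iter r A x) (n1 + m%:Z) (n2 - m%:Z) 0%N k2).
  apply: eq_bigr => r _; pose Q := maxn J (size (logp J ^+ r)).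
  rewrite (@iter_trunc0 _ _ _ _ _ _ Q) ?leq_maxr // scaler_sumr.
  under eq_bigr do rewrite scalerA.
  apply: (@sum_widen _ (fun m => (r`!%:R^-1 * (logp J ^+ r)`_m) *:
    G (iter r A x) (n1 + m%:Z) (n2 - m%:Z) 0%N k2)); first exact: leq_maxl.
  by move=> m Jm; rewrite Gk ?scaler0 //; lia.
rewrite exchange_big; apply: eq_bigr => m _.
rewrite (bet_logp Ax (ltnW (ltn_ord m))).
rewrite -[RHS]/(mklin (Glin (n1 + m%:Z) (n2 - m%:Z)) _) linear_sum.
by apply: eq_bigr => r _; rewrite linearZ_LR.
Qed.

Definition flip f : series := fun n1 n2 k1 k2 => f n2 n1 k2 k1.

Lemma iter_theta21 f r : iter r theta21 f = flip (iter r theta12 (flip f)).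
Proof. by elim: r => //= r ->. Qed.

Lemma exp_theta21 (g : nat -> series) :
  exp_theta theta21 g = flip (exp_theta theta12 (fun r => flip (g r))).
Proof.
apply: series_ext => n1 n2 k1 k2; rewrite /flip /exp_theta.
by apply: eq_fsbigr => r _; rewrite iter_theta21.
Qed.

Lemma iter_mulz12_flip N f :
  iter N mulz12 (flip f) = (-1) ^+ N *: flip (iter N mulz12 f).
Proof.
elim: N => [|N IHN]; first by rewrite scale1r.
rewrite !iterS IHN; apply: series_ext => n1 n2 k1 k2.
rewrite -[LHS]/(_ *: _ - _ *: _) -[RHS]/(_ *: (_ - _)) exprS mulN1r scaleNr -scalerN opprB.
by rewrite -scalerBr.
Qed.

Lemma low2_mulz12 k N f : low2 k f -> low2 k (iter N mulz12 f).
Proof.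
move=> fk; elim: N => //= N IHN n1 n2 k1 k2 h.
by rewrite /mulz12 !IHN ?subrr //; lia.
Qed.

End Series.

(** * Derivatives and diagonals of series with logarithms *)

Section Diag.
Context {K : numFieldType} {V : lmodType K}.
Local Notation series := (series2 V).
Implicit Types f g : series.

Definition low12 (k : nat) f := forall (n1 n2 : int) k1 k2,
  n1 < - k%:Z \/ n2 < - k%:Z -> f n1 n2 k1 k2 = 0.

Lemma Dz1_mulz12 f n1 n2 k1 k2 :
  Dz1 (mulz12 f) n1 n2 k1 k2 = mulz12 (Dz1 f) n1 n2 k1 k2 + f n1 n2 k1 k2.
Proof.
rewrite /mulz12 /Dz1 addrK subrK intrD.
by apply: lin_sep => l lD lN l0 lZ; rewrite !(lD, lN, lZ); ring.
Qed.

Lemma Dz1P c f g h :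
  (forall n1 n2 k1 k2, h n1 n2 k1 k2 = c *: f n1 n2 k1 k2 + g n1 n2 k1 k2) ->
  forall n1 n2 k1 k2, Dz1 h n1 n2 k1 k2 = c *: Dz1 f n1 n2 k1 k2 + Dz1 g n1 n2 k1 k2.
Proof.
move=> hE n1 n2 k1 k2; rewrite /Dz1 !hE.
by apply: lin_sep => l lD lN l0 lZ; rewrite !(lD, lZ); ring.
Qed.

Lemma iter_Dz1_mulz12 q f n1 n2 k1 k2 : iter q (@Dz1 K V) (mulz12 f) n1 n2 k1 k2 =
  mulz12 (iter q (@Dz1 K V) f) n1 n2 k1 k2 + q%:R *: iter q.-1 (@Dz1 K V) f n1 n2 k1 k2.
Proof.
elim: q n1 n2 k1 k2 => [|q IHq] n1 n2 k1 k2; first by rewrite scale0r addr0.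
rewrite iterS (@Dz1P q%:R (iter q.-1 (@Dz1 K V) f) (mulz12 (iter q (@Dz1 K V) f)))
  => [|*]; last by rewrite IHq addrC.
rewrite Dz1_mulz12 -[RHS]/(mulz12 (Dz1 (iter q (@Dz1 K V) f)) n1 n2 k1 k2 +
  q.+1%:R *: iter q (@Dz1 K V) f n1 n2 k1 k2).
rewrite addrCA; congr (_ + _); case: q {IHq} => [|q]; first by rewrite scale0r add0r scale1r.
by rewrite -[q.+2%:R]natr1 scalerDl scale1r.
Qed.

(** Leibniz rule for D_z1 z12 = z12 D_z1 + 1. Divided powers of negative exponent being 0, it
    persists for p < 0. *)
Lemma Dz1_div_mulz12 (p : int) f n1 n2 k1 k2 : Dz1_div (p + 1) (mulz12 f) n1 n2 k1 k2 =
  mulz12 (Dz1_div (p + 1) f) n1 n2 k1 k2 + Dz1_div p f n1 n2 k1 k2.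
Proof.
case: p => [q|[|q]].
- have -> : q%:Z + 1 = q.+1 by lia.
  rewrite /mulz12 /Dz1_div iter_Dz1_mulz12 scalerDr -scalerBr; congr (_ + _).
  rewrite scalerA factS natrM invfM mulrAC mulVf ?mul1r //.
  by rewrite pnatr_eq0.
- have -> : Negz 0 + 1 = 0%N by [].
  by rewrite /Dz1_div invr1 !scale1r addr0 /mulz12 /Dz1_div !scale1r.
have -> : Negz q.+1 + 1 = Negz q by lia.
by rewrite /mulz12 /Dz1_div subrr addr0.
Qed.

Lemma low12_iter_Dz1 k q f : low12 k f -> low12 (k + q) (iter q (@Dz1 K V) f).
Proof.
move=> fk; elim: q => [|q IHq]; first by rewrite addn0.
by move=> n1 n2 k1 k2 h; rewrite iterS /Dz1 !IHq ?scaler0 ?addr0 //; lia.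
Qed.

Lemma low12_Dz1_div k p f : low12 k f -> exists k', low12 k' (Dz1_div p f).
Proof.
case: p => [q|q] fk; last by exists 0%N.
exists (k + q)%N => n1 n2 k1 k2 h; rewrite /Dz1_div (@low12_iter_Dz1 k q f fk) //.
exact: scaler0.
Qed.

Definition diag_term f k (n n1 : int) := \sum_(l < k.+1) f n1 (n - n1) l (k - l)%N.

Lemma diagE m f k n Q : low12 m f -> n + m%:Z + m%:Z < Q%:Z ->
  diag f k n = \sum_(b < Q) diag_term f k n (- m%:Z + b%:Z).
Proof.
move=> fm nQ; apply: (@fsum_int _ (diag_term f k n)) => a ha;
  by rewrite /diag_term big1 // => l _; rewrite fm //; lia.
Qed.

Lemma low12_mono m m' f : (m <= m')%N -> low12 m f -> low12 m' f.
Proof. by move=> mm fm n1 n2 k1 k2 h; apply: fm; lia. Qed.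

Lemma diagD m m' f g h k n : low12 m f -> low12 m' g ->
  (forall n1 n2 k1 k2, h n1 n2 k1 k2 = f n1 n2 k1 k2 + g n1 n2 k1 k2) ->
  diag h k n = diag f k n + diag g k n.
Proof.
move=> /(low12_mono (leq_maxl m m')) fm /(low12_mono (leq_maxr m m')) gm hE.
set M := maxn m m' in fm gm.
have hm : low12 M h by move=> n1 n2 k1 k2 ?; rewrite hE fm // gm // addr0.
have nQ : n + M%:Z + M%:Z < (`|n| + M + M).+1%:Z by lia.
rewrite !(diagE _ _ nQ) // -big_split; apply: eq_bigr => b _.
by rewrite /diag_term -big_split; apply: eq_bigr => l _.
Qed.

(** Along the diagonal the differences that define [mulz12] telescope. *)
Lemma diag_mulz12 m f k n : low12 m f -> diag (mulz12 f) k n = 0.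
Proof.
move=> fm; pose Q := (`|n| + m + m).+3.
have fM : low12 m.+1 (mulz12 f).
  by move=> n1 n2 k1 k2 h; rewrite /mulz12 !fm ?subrr //; lia.
rewrite (@diagE m.+1 _ _ _ Q) //; last by rewrite /Q; lia.
pose g b := diag_term f k (n - 1) (- m%:Z - 1 + b%:Z - 1).
have E b : diag_term (mulz12 f) k n (- m.+1%:Z + b%:Z) = g b - g b.+1.
  rewrite /g /diag_term -sumrB; apply: eq_bigr => l _; rewrite /mulz12.
  by congr (f _ _ _ _ - f _ _ _ _); lia.
under eq_bigr do rewrite E.
rewrite sumrB; apply/eqP; rewrite subr_eq0; apply/eqP.
have g0 : g 0 = 0 by rewrite /g /diag_term big1 // => l _; rewrite fm //; lia.
have gQ : g Q = 0 by rewrite /g /diag_term big1 // => l _; rewrite fm // /Q; lia.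
have h1 : \sum_(b < Q.+1) g b = \sum_(b < Q) g b by rewrite big_ord_recr /= gQ addr0.
have h2 : \sum_(b < Q.+1) g b = \sum_(b < Q) g b.+1.
  by rewrite big_ord_recl g0 add0r; apply: eq_bigr => i _; rewrite lift0.
by rewrite -h1 h2.
Qed.

(** Independence of the product from the locality order: each additional factor z12 must be hit by
    one additional derivative to survive on the diagonal. *)
Lemma diag_Dz1_div_mulz12 m f (p : int) d k n : low12 m f ->
  diag (Dz1_div (p + d%:Z) (iter d mulz12 f)) k n = diag (Dz1_div p f) k n.
Proof.
elim: d p => [|d IHd] p fm; first by rewrite addr0.
have gm : low12 (m + d) (iter d mulz12 f).
  elim: d {IHd} => [|d IHd]; first by rewrite addn0.
  by move=> n1 n2 k1 k2 h; rewrite iterS /mulz12 !IHd ?subrr //; lia.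
rewrite iterS; have -> : p + d.+1%:Z = p + d%:Z + 1 by lia.
have [m1 h1] := low12_Dz1_div (p + d%:Z + 1) gm.
have [m2 h2] := low12_Dz1_div (p + d%:Z) gm.
have h1' : low12 m1.+1 (mulz12 (Dz1_div (p + d%:Z + 1) (iter d mulz12 f))).
  by move=> n1 n2 k1 k2 h; rewrite /mulz12 !h1 ?subrr //; lia.
rewrite (diagD _ _ h1' h2 (Dz1_div_mulz12 _ _)) (diag_mulz12 _ _ h1) add0r.
exact: IHd.
Qed.

(** Chain rule: d/dzeta of the diagonal is the diagonal of d/dzeta1 + d/dzeta2. *)
Lemma diag_rule m f g1 g2 k n : low12 m f -> low12 m g1 -> low12 m g2 ->
  (forall n1 n2 k1 k2, k1.+1%:R *: f n1 n2 k1.+1 k2 = - g1 n1 n2 k1 k2) ->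
  (forall n1 n2 k1 k2, k2.+1%:R *: f n1 n2 k1 k2.+1 = - g2 n1 n2 k1 k2) ->
  k.+1%:R *: diag f k.+1 n = - (diag g1 k n + diag g2 k n).
Proof.
move=> fm gm1 gm2 r1 r2.
have nQ : n + m%:Z + m%:Z < (`|n| + m + m).+1%:Z by lia.
rewrite !(diagE _ _ nQ) // scaler_sumr -big_split -sumrN; apply: eq_bigr => b _.
rewrite /diag_term -big_split -sumrN /=; set n1 := - m%:Z + b%:Z.
have -> : k.+1%:R *: \sum_(l < k.+2) f n1 (n - n1) l (k.+1 - l)%N =
    \sum_(l < k.+2) l%:R *: f n1 (n - n1) l (k.+1 - l)%N +
    \sum_(l < k.+2) (k.+1 - l)%:R *: f n1 (n - n1) l (k.+1 - l)%N.
  rewrite -big_split scaler_sumr; apply: eq_bigr => l _ /=.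
  by rewrite -scalerDl -natrD subnKC // -ltnS.
rewrite big_ord_recl scale0r add0r [X in _ + X]big_ord_recr /= subnn scale0r addr0.
rewrite -big_split; apply: eq_bigr => l _ /=; rewrite /bump leq0n add1n subSS r1.
have lk : (l <= k)%N by rewrite -ltnS.
by rewrite subSn // r2 [RHS]opprD.
Qed.
End Diag.

Lemma bilin_series (K : fieldType) (A B V : lmodType K) (F : A -> B -> series2 V) :
  (forall n1 n2 k1 k2, bilin (fun a b => F a b n1 n2 k1 k2)) -> bilin F.
Proof.
move=> bF; split=> [b|a] k f g; do 4 apply/funext => ?; first exact: (bF _ _ _ _).1.
exact: (bF _ _ _ _).2.
Qed.

Lemma bilin_tens (K : fieldType) (A B M : lmodType K) (f : {linear tensor A B -> M}) :
  bilin (fun a b => f (a *t b)).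
Proof.
by split=> [b|a] k u v; rewrite -(linearP f) ?tensDl ?tensZl ?tensDr ?tensZr.
Qed.

(** * Products of logarithmic fields *)

Section Fields.
Context {K : fieldType} {V : superType K}.
Local Notation V2 := (tensor V V).
Local Notation V3 := (tensor (tensor V V) V).
Local Notation idV := (idfun : {linear V -> V}).
Variable Y : evenHom V (LF V).

Lemma YcoefE k n a b : Ycoef Y k n (a *t b) = Y a b k n.
Proof. exact: tliftE. Qed.

Lemma loglaurent_low (f : loglaurent V) :
  exists m : nat, forall k (n : int), n < - m%:Z -> f k n = 0.
Proof.
case: f => f /= /asboolP[N fN]; exists N => k n nN.
by apply: fN; rewrite nN orbT.
Qed.

Lemma Ycoef_low t : exists m : nat, forall k (n : int), n < - m%:Z -> Ycoef Y k n t = 0.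
Proof.
elim/(@tensor_ind K V V): t => [|x y [m h] [m' h']|a b].
- by exists 0%N => k n _; rewrite linear0.
- exists (maxn m m') => k n nm; rewrite linearD h ?h' ?addr0 //; lia.
have [m h] := loglaurent_low (Y a b); exists m => k n nm; rewrite YcoefE; exact: h.
Qed.

Lemma Ycoef_even k n : even_map (Ycoef Y k n).
Proof.
move=> l t; elim/(@tensor_ind_hom K V V): t => [|x y IHx IHy|i j a b ia jb].
- by rewrite spr0 !linear0.
- by rewrite sprD (linearD _ (spr l x)) (linearD _ x) sprD IHx IHy.
rewrite (spr_parity _ (has_parity_tens ia jb)) YcoefE.
have iYa : has_parity i (Y a) by rewrite /has_parity -evenHomP ia.
have p : has_parity (i (+) j) (Y a b k n).
  have h := hom_parity iYa jb.
  by rewrite /has_parity -[LHS]/((spr (i (+) j) (Y a b)) k n) h.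
by rewrite (spr_parity _ p); case: eqP; rewrite ?linear0 ?YcoefE.
Qed.

Lemma tassoc_tens (W : lmodType K) (f : {linear V2 -> W}) t c :
  tmap idV f (tassoc (t *t c)) = tmap idV (lcomp f (tensl V c)) t.
Proof.
elim/(@tensor_ind K V V): t => [|x y IHx IHy|a b]; first by rewrite tens0l !linear0.
  by rewrite tensDl !linearD IHx IHy.
by rewrite tassocE !tmapE lcompE.
Qed.

(* tensor_ev_tens rather than tliftE, which is very slow to unify at series2. *)
Lemma mu12E (a b : LF V) c : mu12 c (a *t b) = fun n1 n2 k1 k2 => a (b c k2 n2) k1 n1.
Proof.
apply: etrans; first (refine (tensor_ev_tens _ _ _)); last by [].
split=> [b'|a'] k f g; do 4 apply/funext => ?; last by rewrite linDE linZE ll_linE linearP ll_linE.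
by rewrite linDE linZE ll_linE.
Qed.

Lemma mu21E (a b : LF V) c : mu21 c (a *t b) = fun n1 n2 k1 k2 => a (b c k1 n1) k2 n2.
Proof.
apply: etrans; first (refine (tensor_ev_tens _ _ _)); last by [].
split=> [b'|a'] k f g; do 4 apply/funext => ?; last by rewrite linDE linZE ll_linE linearP ll_linE.
by rewrite linDE linZE ll_linE.
Qed.

Lemma mu12_YY t c n1 n2 k1 k2 : mu12 c (tmap Y Y t) n1 n2 k1 k2 =
  Ycoef Y k1 n1 (tmap idV (Ycoef Y k2 n2) (tassoc (t *t c))).
Proof.
rewrite tassoc_tens; elim/(@tensor_ind K V V): t => [|x y IHx IHy|a b].
- by rewrite !linear0.
- by rewrite (linearD (tmap Y Y)) (linearD (mu12 c)) !linearD -IHx -IHy.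
by rewrite !tmapE lcompE mu12E !YcoefE.
Qed.

Lemma mu21_YY t c n1 n2 k1 k2 :
  mu21 c (tmap Y Y t) n1 n2 k1 k2 =
  Ycoef Y k2 n2 (tmap idV (Ycoef Y k1 n1) (tassoc (t *t c))).
Proof.
rewrite tassoc_tens; elim/(@tensor_ind K V V): t => [|x y IHx IHy|a b].
- by rewrite !linear0.
- by rewrite (linearD (tmap Y Y)) (linearD (mu21 c)) !linearD -IHx -IHy.
by rewrite !tmapE lcompE mu21E !YcoefE.
Qed.

Let YY_lin k1 n1 k2 n2 : {linear V3 -> V} :=
  lcomp (Ycoef Y k1 n1) (lcomp (tmap idV (Ycoef Y k2 n2)) tassoc).

Lemma YY12_tens t c : YY12 Y (t *t c) = mu12 c (tmap Y Y t).
Proof.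
apply: etrans; first (refine (tensor_ev_tens _ _ _)); last by [].
apply: bilin_series => n1 n2 k1 k2; have -> : (fun t c => mu12 c (tmap Y Y t) n1 n2 k1 k2) =
    fun t c => YY_lin k1 n1 k2 n2 (t *t c) by do 2 apply/funext => ?; exact: mu12_YY.
exact: bilin_tens.
Qed.

Lemma YY21_tens t c : YY21 Y (t *t c) = mu21 c (tmap Y Y t).
Proof.
apply: etrans; first (refine (tensor_ev_tens _ _ _)); last by [].
apply: bilin_series => n1 n2 k1 k2; have -> : (fun t c => mu21 c (tmap Y Y t) n1 n2 k1 k2) =
    fun t c => YY_lin k2 n2 k1 n1 (t *t c) by do 2 apply/funext => ?; exact: mu21_YY.
exact: bilin_tens.
Qed.

Lemma YY12E x n1 n2 k1 k2 :
  YY12 Y x n1 n2 k1 k2 = Ycoef Y k1 n1 (tmap idV (Ycoef Y k2 n2) (tassoc x)).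
Proof.
elim/(@tensor_ind K V2 V): x => [|x y IHx IHy|t c]; first by rewrite !linear0.
  by rewrite (linearD (YY12 Y)) !linearD -IHx -IHy.
by rewrite YY12_tens mu12_YY.
Qed.

Lemma YY21E x n1 n2 k1 k2 : YY21 Y x n1 n2 k1 k2 = YY12 Y x n2 n1 k2 k1.
Proof.
elim/(@tensor_ind K V2 V): x => [|x y IHx IHy|t c]; first by rewrite !linear0.
  by rewrite (linearD (YY21 Y)) (linearD (YY12 Y)) -[LHS]/(_ + _) IHx IHy.
by rewrite YY12_tens YY21_tens mu12_YY; exact: mu21_YY.
Qed.

Lemma YY12P k x y n1 n2 k1 k2 :
  YY12 Y (k *: x + y) n1 n2 k1 k2 = k *: YY12 Y x n1 n2 k1 k2 + YY12 Y y n1 n2 k1 k2.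
Proof. by rewrite !YY12E (linearP tassoc) (linearP (tmap _ _)) (linearP (Ycoef _ _ _)). Qed.

End Fields.

(** * Locality with logarithms and its zeta-free part *)

Section thetaYY.
Context {K : numFieldType} {V : superType K}.
Local Notation V2 := (tensor V V).
Local Notation V3 := (tensor (tensor V V) V).
Local Notation idV := (idfun : {linear V -> V}).
Variable Y : evenHom V (LF V).
Lemma YY12_low x : exists k, low2 k (YY12 Y x).
Proof.
suff [k kP] : exists k : nat, forall l (n : int), n < - k%:Z ->
    tmap idV (Ycoef Y l n) (tassoc x) = 0.
  by exists k => n1 n2 k1 k2 h; rewrite YY12E kP // linear0.
elim/(@tensor_ind K V V2): (tassoc x) => [|y z [k h] [k' h']|a t].
- by exists 0%N => l n _; rewrite linear0.
- exists (maxn k k') => l n nk; rewrite linearD h ?h' ?addr0 //; lia.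
by have [k h] := Ycoef_low Y t; exists k => l n nk; rewrite tmapE h // tens0r.
Qed.

Variable S : {linear V2 -> V2}.
Hypothesis Snil : forall t, exists r, iter r S t = 0.
Local Notation X := (Ycoef Y 0).
Local Notation S12 := (leg12 S).

Lemma X_low t : exists k : nat, forall n : int, n < - k%:Z -> X n t = 0.
Proof. by have [m h] := Ycoef_low Y t; exists m => n; exact: h. Qed.

(* e^(theta12 S12) Y(z1) Y(z2) *)
Definition thetaYY (x : V3) : series2 V :=
  exp_theta theta12 (fun r => YY12 Y (iter r S12 x)).

Lemma thetaYY_data x : exists k r0, [/\ iter r0 S12 x = 0,
  forall r, (r0 <= r)%N -> YY12 Y (iter r S12 x) = 0 &
  forall r, low2 k (YY12 Y (iter r S12 x))].
Proof.
have [r0 r0x] := nil12 Snil x.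
have [k kP] : exists k, forall r, (r < r0)%N -> low2 k (YY12 Y (iter r S12 x)).
  apply: iter_bound => [r k k' kk h n1 n2 k1 k2 nk|r]; last exact: YY12_low.
  by apply: h; lia.
have Y0 r : (r0 <= r)%N -> YY12 Y (iter r S12 x) = 0.
  by move=> rr; rewrite (iter_nil_le rr r0x) linear0.
exists k, r0; split=> // r; have [/kP//|/Y0 ->] := ltnP r r0.
by move=> n1 n2 k1 k2 _.
Qed.

Lemma thetaYY_low x : exists k, low2 k (thetaYY x).
Proof.
have [k [r0 [_ g0 gk]]] := thetaYY_data x; exists k => n1 n2 k1 k2 h.
rewrite /thetaYY /exp_theta fsbig1 // => r _.
by rewrite (low2_iter r (gk r)) // scaler0.
Qed.

Lemma thetaYY_linear n1 n2 k1 k2 : linear (fun x => thetaYY x n1 n2 k1 k2).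
Proof.
move=> c x y /=.
have [k [r [rx _ gx]]] := thetaYY_data x; have [k' [r' [ry _ gy]]] := thetaYY_data y.
have [k'' [r'' [rz _ gz]]] := thetaYY_data (c *: x + y).
pose J := (k + k' + k'' + `|n2|).+1; pose R := (r + r' + r'')%N.
have b z i k0 : iter i S12 z = 0 -> (i <= R)%N ->
    (forall q, low2 k0 (YY12 Y (iter q S12 z))) -> (k0 <= k + k' + k'')%N ->
    thetaYY z n1 n2 k1 k2 = \sum_(q < R) q`!%:R^-1 *:
      iter q (theta_trunc J) (YY12 Y (iter q S12 z)) n1 n2 k1 k2.
  move=> iz iR zk kk; rewrite /thetaYY (@exp_thetaE _ _ k0 _ R J) //; last by rewrite /J; lia.
  by move=> q Rq; rewrite (iter_nil_le (leq_trans iR Rq) iz) linear0.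
rewrite (b _ _ _ rz _ gz) ?(b _ _ _ rx _ gx) ?(b _ _ _ ry _ gy) /R; try lia.
rewrite scaler_sumr -big_split; apply: eq_bigr => q _.
rewrite (@iter_theta_truncP _ _ J q c (YY12 Y (iter q S12 x)) (YY12 Y (iter q S12 y)));
  last by move=> *; rewrite iter_linP YY12P.
by rewrite scalerDr !scalerA mulrC.
Qed.

Definition locYY N x : series2 V := iter N mulz12 (thetaYY x).

Lemma locYYS N x n1 n2 k1 k2 :
  locYY N.+1 x n1 n2 k1 k2 = locYY N x (n1 - 1) n2 k1 k2 - locYY N x n1 (n2 - 1) k1 k2.
Proof. by []. Qed.

(** [exp_theta_bet] for N = 0; then both sides obey the same recursion in N. *)
Lemma locYY_locA N x n1 n2 : locYY N x n1 n2 0 0 = locA X S N x n1 n2.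
Proof.
elim: N n1 n2 => [|N IHN] n1 n2; last first.
  by rewrite locYYS !IHN (locA_S X_low Snil).
have [k [r0 [rx _ gk]]] := thetaYY_data x; have [k' kP] := locAE X_low Snil x.
pose J := (k + k' + `|n2|.+1)%N.
rewrite (kP 0%N n1 n2 J); last by rewrite /J; lia.
rewrite /locYY /= /thetaYY (@exp_theta_bet _ _ _ _ (YY12 Y) x r0 k n1 n2 0 J rx gk);
  last by rewrite /J; lia.
by apply: eq_bigr => m _; rewrite YY12E subr0.
Qed.

Definition natloc N t := forall c, locYY N (t *t c) = (-1) ^+ N *: flip (locYY N (tswap t *t c)).

Lemma natlocE N t c :
  iter N mulz12 (exp_theta theta21 (fun r => YY21 Y (iter r S12 (tswap t *t c)))) =
  (-1) ^+ N *: flip (locYY N (tswap t *t c)).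
Proof.
rewrite exp_theta21 iter_mulz12_flip; congr (_ *: flip (iter N mulz12 _)).
by rewrite /thetaYY; congr exp_theta; apply/funext => r; apply: series_ext => *; exact: YY21E.
Qed.

Lemma natloc_loc N t : natloc N t -> loc X S N t.
Proof.
by move=> h c n1 n2; rewrite -!locYY_locA h.
Qed.
End thetaYY.

(** * Elimination of the logarithms on the vacuum *)

Section VacuumSeries.
Context {K : numFieldType} {V : lmodType K}.
Implicit Type f : series2 V.

(** In the absence of negative powers of z2, only the summand zeta1 of theta12 reaches z2^0. *)
Lemma theta12_at0 f r n1 k1 k2 : low2 0 f ->
  iter r theta12 f n1 0 k1 k2 = if (r <= k1)%N then f n1 0 (k1 - r)%N k2 else 0.
Proof.
move=> f0; elim: r k1 => [|r IHr] k1; first by rewrite subn0.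
rewrite iterS (theta12E _ _ _ (low2_iter r f0) (J := 1)) // /theta_trunc.
rewrite big_ord1 (low2_iter r f0) // scaler0 subr0.
by case: k1 => // k1; rewrite IHr.
Qed.

Lemma mulz12_at0 f N n1 k1 k2 : low2 0 f ->
  iter N mulz12 f n1 0 k1 k2 = f (n1 - N%:Z) 0 k1 k2.
Proof.
move=> f0; elim: N n1 => [|N IHN] n1; first by rewrite subr0.
rewrite iterS /mulz12 [X in _ - X](low2_mulz12 N f0) // subr0 IHN; congr (f _ _ _ _); lia.
Qed.

Lemma mulz12_k2 f N k2 : (forall n1 n2 k1, f n1 n2 k1 k2 = 0) ->
  forall n1 n2 k1, iter N mulz12 f n1 n2 k1 k2 = 0.
Proof. by move=> f0; elim: N => //= N IHN n1 n2 k1; rewrite /mulz12 !IHN subrr. Qed.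
End VacuumSeries.

Section PreVA.
Context {K : numFieldType} {V : superType K}.
Local Notation V2 := (tensor V V).
Local Notation V3 := (tensor (tensor V V) V).
Local Notation idV := (idfun : {linear V -> V}).
Variables (vac : V) (T : evenHom V V) (Y : evenHom V (LF V)).
Variable S : {linear V2 -> V2}.
Hypothesis Hvac : vacuum_axiom vac T Y.
Hypothesis Snil : forall t, exists r, iter r S t = 0.
Hypothesis Hloc : forall a b, exists N, natloc Y S N (a *t b).
Local Notation X := (Ycoef Y 0).
Local Notation S12 := (leg12 S).
Local Notation Theta := (thetaYY Y S).
Local Notation Fn := (locYY Y S).

Lemma Ycoef_vac0 k n : (0 < k)%N || (n < 0) -> lcomp (Ycoef Y k n) (tensl V vac) = 0.
Proof.
by move=> h; apply: linext => b; rewrite lcompE YcoefE (vac_series Hvac).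
Qed.

Lemma Ycoef_vac_id b : Ycoef Y 0 0 (b *t vac) = b.
Proof. by rewrite YcoefE (vac_init Hvac). Qed.

Lemma YY12_vac0 t n1 n2 k1 k2 : (0 < k2)%N || (n2 < 0) ->
  YY12 Y (t *t vac) n1 n2 k1 k2 = 0.
Proof. by move=> h; rewrite YY12E tassoc_tens Ycoef_vac0 // tmap0r linear0. Qed.

Lemma YY12_vac t n1 k1 : YY12 Y (t *t vac) n1 0 k1 0 = Ycoef Y k1 n1 t.
Proof.
rewrite YY12E tassoc_tens; congr (Ycoef _ _ _ _); rewrite -[RHS]tmap_id.
by apply: eq_tmap => // b; exact: Ycoef_vac_id.
Qed.

Lemma iter_S12_tens r t c : iter r S12 (t *t c) = iter r S t *t c.
Proof.
symmetry; apply: (@iter_intertwine _ _ S S12 (tensl V2 c)) => u.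
exact/esym/tmapE.
Qed.

Let g t r := YY12 Y (iter r S12 (t *t vac)).
Let g_low t r : low2 0 (g t r).
Proof.
move=> n1 n2 k1 k2 h; rewrite /g iter_S12_tens YY12_vac0 //.
by rewrite orbC (_ : n2 < 0) //; lia.
Qed.

Lemma thetaYY_vac_low t : low2 0 (Theta (t *t vac)).
Proof.
move=> n1 n2 k1 k2 h; rewrite /thetaYY /exp_theta fsbig1 // => r _.
by rewrite (low2_iter r (g_low t r)) // scaler0.
Qed.

Lemma thetaYY_vac_k2 t n1 n2 k1 k2 : Theta (t *t vac) n1 n2 k1 k2.+1 = 0.
Proof.
rewrite /thetaYY /exp_theta fsbig1 // => r _; rewrite theta12_k2 ?scaler0 //.
by move=> *; rewrite iter_S12_tens YY12_vac0.
Qed.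

(** Locality exchanges the fields: zeta1 then belongs to the field next to the vacuum, which creates
    no logarithm. *)
Lemma thetaYY_vac_log t n1 k : Theta (t *t vac) n1 0 k.+1 0 = 0.
Proof.
elim/(@tensor_ind K V V): t => [|x y IHx IHy|a b].
- by rewrite tens0l; exact: (linear0 (mklin (thetaYY_linear Y Snil n1 0 k.+1 0))).
- by rewrite tensDl; apply: etrans
    (linearD (mklin (thetaYY_linear Y Snil n1 0 k.+1 0)) _ _) _; rewrite /= IHx IHy addr0.
have [N hN] := Hloc a b.
have := congr1 (fun f : series2 V => f (n1 + N%:Z) 0 k.+1 0%N) (hN vac).
rewrite {1}/locYY mulz12_at0 ?addrK; last exact: thetaYY_vac_low.
move=> ->; rewrite -[LHS]/(_ *: _) /flip /locYY mulz12_k2 ?scaler0 //.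
by move=> *; exact: thetaYY_vac_k2.
Qed.

(* Y(z) is exp (- zeta S) applied to its zeta-free part. *)
Lemma Ycoef_log k n t : k.+1%:R *: Ycoef Y k.+1 n t = - Ycoef Y k n (S t).
Proof.
pose Q k t := k.+1%:R *: Ycoef Y k.+1 n t + Ycoef Y k n (S t).
suff h : forall t, Q k t = 0 by apply/eqP; rewrite -addr_eq0; apply/eqP; exact: h.
(* At z2^0 the derivative in zeta1 of Y(z1) e^(zeta1 S) vanishes; its coefficient at zeta1^l is this
   sum of defects. *)
have sumQ l u : \sum_(r < l.+1) r`!%:R^-1 *: Q (l - r)%N (iter r S u) = 0.
  have [k0 [r0 [_ g0 _]]] := thetaYY_data Y Snil (u *t vac).
  have := exp_theta_dzeta1 n 0 l 0 g0 (g_low u).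
  rewrite -[exp_theta _ _ _ _ _ _]/(Theta (u *t vac) n 0 l.+1 0) thetaYY_vac_log scaler0.
  rewrite /exp_theta (@fsum_nat _ _ l.+1) => [E|r lr].
    rewrite [RHS]E; apply: eq_bigr => r _; rewrite theta12_at0; last first.
      move=> n1 n2 k1 k2 h; rewrite -[LHS]/(_ *: g u r _ _ _ _ + g u r.+1 _ _ _ _).
      by rewrite !g_low // scaler0 addr0.
    rewrite -ltnS ltn_ord -[X in _ *: X = _]/(Q _ _); congr (_ *: _).
    rewrite -[RHS]/(_ *: g u r _ _ _ _ + g u r.+1 _ _ _ _) /g !iter_S12_tens !YY12_vac.
    by rewrite /Q iterS.
  rewrite theta12_at0; last first.
    move=> n1 n2 k1 k2 h; rewrite -[LHS]/(_ *: g u r _ _ _ _ + g u r.+1 _ _ _ _).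
    by rewrite !g_low // scaler0 addr0.
  by rewrite leqNgt lr scaler0.
(* The term r = 0 is Q k, the others have a smaller first index, so strong induction isolates it. *)
have [m] := ubnP k; elim: m k => // m IHm k km u.
have := sumQ k u; rewrite big_ord_recl subn0 invr1 scale1r big1 ?addr0 // => i _.
by rewrite IHm ?scaler0 // lift0; have := ltn_ord i; lia.
Qed.
End PreVA.

Lemma iter_linN (K : fieldType) (M : lmodType K) (f : {linear M -> M}) r x :
  iter r f (- x) = - iter r f x.
Proof. by elim: r => //= r ->; rewrite linearN. Qed.

(** * Products of fields: from zeta-free identities to logarithmic fields *)

Section VA.
Context {K : numFieldType} {V : superType K}.
Local Notation V2 := (tensor V V).
Local Notation V3 := (tensor (tensor V V) V).
Local Notation idV := (idfun : {linear V -> V}).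
Variables (vac : V) (T : evenHom V V) (Y : evenHom V (LF V)).
Variable S : {linear V2 -> V2}.
Hypothesis Hvac : vacuum_axiom vac T Y.
Hypothesis Hcov : covariance T Y.
Hypothesis Snil : forall t, exists r, iter r S t = 0.
Hypothesis Hloc : forall a b, exists N, natloc Y S N (a *t b).
Hypothesis Seven : even_map S.
Hypothesis SP : forall t, S (tswap t) = tswap (S t).
Hypothesis S12_23 : forall x, leg12 S (leg23 S x) = leg23 S (leg12 S x).
Hypothesis S13_23 : forall x, leg13 S (leg23 S x) = leg23 S (leg13 S x).
Hypothesis S12_13 : forall x, leg12 S (leg13 S x) = leg13 S (leg12 S x).
Hypothesis hexY : forall k n x, S (tmap (Ycoef Y k n) idV x) =
  tmap (Ycoef Y k n) idV (leg13 S x + leg23 S x).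
Local Notation X := (Ycoef Y 0).
Local Notation S12 := (leg12 S).
Local Notation S13 := (leg13 S).
Local Notation S23 := (leg23 S).
Local Notation P12 := (leg12 (@tswap K V V)).
Local Notation P23 := (leg23 (@tswap K V V)).
Local Notation Theta := (thetaYY Y S).
Local Notation Fn := (locYY Y S).

Lemma tmap_X0_ins u : tmap (X 0) idV (P23 (u *t vac)) = u.
Proof.
elim/(@tensor_ind K V V): u => [|x y IHx IHy|b a]; first by rewrite tens0l !linear0.
  by rewrite tensDl !linearD IHx IHy.
rewrite leg23E tassocE tmapE (tswap_vac (vac_even Hvac)) tunassocE tmapE.
by rewrite (Ycoef_vac_id Hvac).
Qed.

(** On vac (x) vac (x) c the hexagon reads x = x + x with x = S (vac *t c). *)
Lemma S_vacl c : S (vac *t c) = 0.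
Proof.
have Yv u : tmap (X 0) idV (tunassoc (vac *t u)) = u.
  elim/(@tensor_ind K V V): u => [|x y IHx IHy|b a]; first by rewrite tens0r !linear0.
    by rewrite tensDr !linearD IHx IHy.
  by rewrite tunassocE tmapE YcoefE (vac_id Hvac).
have := hexY 0 0 ((vac *t vac) *t c).
rewrite tmapE YcoefE (vac_id Hvac) (linearD (tmap _ _)) leg23E tassocE tmapE Yv.
have -> : S13 ((vac *t vac) *t c) = P23 (S (vac *t c) *t vac).
  rewrite leg13E; congr (P23 _).
  have -> : (vac *t vac) *t c = P23 ((vac *t c) *t vac).
    by rewrite leg23E tassocE tmapE (tswap_vac (vac_even Hvac)) tunassocE.
  by rewrite leg23P2 /leg12 tmapE.
rewrite tmap_X0_ins => /eqP; rewrite -subr_eq0 opprD addrA subrr sub0r oppr_eq0.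
by move=> /eqP.
Qed.

Lemma S_vacr b : S (b *t vac) = 0.
Proof.
by rewrite -[b *t vac]tswapK (tswap_vac (vac_even Hvac)) SP S_vacl linear0.
Qed.

(** The hexagon conjugated by the cyclic permutation of the legs, which takes S13 and S23 to S12 and
    S13. *)
Lemma hexY2 k n x : S (tmap idV (Ycoef Y k n) (tassoc x)) =
  tmap idV (Ycoef Y k n) (tassoc (S12 x + S13 x)).
Proof.
have eY := Ycoef_even Y k n.
rewrite -[tmap _ _ _]tswapK tswap_nat // SP tswap_r3 hexY tswap_nat //.
congr (tmap _ _ _); rewrite (leg13_cyc SP) (leg23_cyc13 Seven SP) -(linearD P23) -(linearD P12).
by rewrite -tswap_r3 tswapK.
Qed.

Local Notation Ylog := (Ycoef_log Hvac Snil Hloc).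

Lemma YY12_zeta1 x n1 n2 k1 k2 : k1.+1%:R *: YY12 Y x n1 n2 k1.+1 k2 =
  - YY12 Y (S12 x + S13 x) n1 n2 k1 k2.
Proof. by rewrite !YY12E Ylog hexY2. Qed.

Lemma YY12_zeta2 x n1 n2 k1 k2 : k2.+1%:R *: YY12 Y x n1 n2 k1 k2.+1 =
  - YY12 Y (S23 x) n1 n2 k1 k2.
Proof.
rewrite !YY12E -(linearZ_LR (Ycoef _ _ _)) -(linearN (Ycoef _ _ _)) -tmapZr.
congr (Ycoef _ _ _ _); have -> : tassoc (S23 x) = tmap idV S (tassoc x) by exact: tunassocK.
rewrite tmap_comp -scaleN1r -tmapZr; apply: eq_tmap => // t.
by rewrite !linZE Ylog lcompE scaleN1r.
Qed.

Lemma ThetaN x n1 n2 k1 k2 : Theta (- x) n1 n2 k1 k2 = - Theta x n1 n2 k1 k2.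
Proof. exact: (linearN (mklin (thetaYY_linear Y Snil n1 n2 k1 k2))). Qed.

Lemma YY12D x y n1 n2 k1 k2 :
  YY12 Y (x + y) n1 n2 k1 k2 = YY12 Y x n1 n2 k1 k2 + YY12 Y y n1 n2 k1 k2.
Proof. by have := YY12P Y 1 x y n1 n2 k1 k2; rewrite !scale1r. Qed.

Lemma YY12N x n1 n2 k1 k2 : YY12 Y (- x) n1 n2 k1 k2 = - YY12 Y x n1 n2 k1 k2.
Proof.
by rewrite !YY12E (linearN tassoc) (linearN (tmap _ _)) (linearN (Ycoef _ _ _)).
Qed.

(** Y(z1) Y(z2) contributes - S12 - S13 and theta12 contributes S12. *)
Lemma thetaYY_zeta1 x n1 n2 k1 k2 : k1.+1%:R *: Theta x n1 n2 k1.+1 k2 =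
  - Theta (S13 x) n1 n2 k1 k2.
Proof.
have [k [r0 [_ g0 gk]]] := thetaYY_data Y Snil x.
rewrite {1}/thetaYY (exp_theta_dzeta1 _ _ _ _ g0 gk) -ThetaN.
congr (exp_theta _ _ n1 n2 k1 k2); apply/funext => r; apply: series_ext => m1 m2 l1 l2.
rewrite -[LHS]/(_ *: YY12 Y _ _ _ _ _ + YY12 Y _ _ _ _ _) YY12_zeta1.
rewrite YY12D iter_linN YY12N -(@iter_intertwine _ _ S12 S12 S13) //.
pose A := YY12 Y (iter r.+1 S12 x) m1 m2 l1 l2.
pose B := YY12 Y (S13 (iter r S12 x)) m1 m2 l1 l2.
rewrite -[LHS]/(- (A + B) + A) -[RHS]/(- B).
by rewrite opprD addrC addrA subrr add0r.
Qed.

Lemma iter_trunc_zeta2 J r (f : series2 V) n1 n2 k1 k2 :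
  k2.+1%:R *: iter r (theta_trunc J) f n1 n2 k1 k2.+1 =
  iter r (theta_trunc J) (fun n1 n2 k1 k2 => k2.+1%:R *: f n1 n2 k1 k2.+1) n1 n2 k1 k2.
Proof.
elim: r n1 n2 k1 => // r IHr n1 n2 k1; rewrite !iterS /theta_trunc scalerBr.
congr (_ - _); first by case: k1 => [|k1]; rewrite ?scaler0 // IHr.
by rewrite scaler_sumr; apply: eq_bigr => m _; rewrite -IHr !scalerA mulrC.
Qed.

Lemma thetaYY_zeta2 x n1 n2 k1 k2 : k2.+1%:R *: Theta x n1 n2 k1 k2.+1 =
  - Theta (S23 x) n1 n2 k1 k2.
Proof.
have [k [r0 [_ g0 gk]]] := thetaYY_data Y Snil x.
rewrite -ThetaN.
have E r : (fun n1 n2 k1 k2 => k2.+1%:R *: YY12 Y (iter r S12 x) n1 n2 k1 k2.+1) =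
    YY12 Y (iter r S12 (- S23 x)).
  apply: series_ext => m1 m2 l1 l2; rewrite YY12_zeta2.
  by rewrite iter_linN YY12N -(@iter_intertwine _ _ S12 S12 S23).
have nJ : n2 + k%:Z < (k + `|n2|.+1)%N%:Z by lia.
rewrite /thetaYY (exp_thetaE _ _ _ g0 gk nJ).
rewrite (@exp_thetaE _ _ k _ r0 (k + `|n2|.+1)%N) //; first last.
- move=> r m1 m2 l1 l2 m2k; rewrite -E gk //; exact: scaler0.
- move=> r rr; rewrite -E; apply: series_ext => m1 m2 l1 l2.
  by rewrite g0 //; exact: scaler0.
rewrite scaler_sumr; apply: eq_bigr => r _; rewrite scalerA mulrC -scalerA.
by rewrite iter_trunc_zeta2 E.
Qed.

Lemma locYY_zeta1 N x n1 n2 k1 k2 : k1.+1%:R *: Fn N x n1 n2 k1.+1 k2 =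
  - Fn N (S13 x) n1 n2 k1 k2.
Proof.
elim: N n1 n2 => [|N IHN] n1 n2; first exact: thetaYY_zeta1.
by rewrite !locYYS scalerBr !IHN opprB opprK addrC.
Qed.

Lemma locYY_zeta2 N x n1 n2 k1 k2 : k2.+1%:R *: Fn N x n1 n2 k1 k2.+1 =
  - Fn N (S23 x) n1 n2 k1 k2.
Proof.
elim: N n1 n2 => [|N IHN] n1 n2; first exact: thetaYY_zeta2.
by rewrite !locYYS scalerBr !IHN opprB opprK addrC.
Qed.

Definition FD N p x : series2 V := iter p (@Dz1 K V) (Fn N x).

Lemma FDE N p x n1 n2 k1 k2 : FD N p.+1 x n1 n2 k1 k2 =
  (n1 + 1)%:~R *: FD N p x (n1 + 1) n2 k1 k2 + k1.+1%:R *: FD N p x (n1 + 1) n2 k1.+1 k2.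
Proof. by []. Qed.

Lemma FD_zeta1 N p x n1 n2 k1 k2 : k1.+1%:R *: FD N p x n1 n2 k1.+1 k2 =
  - FD N p (S13 x) n1 n2 k1 k2.
Proof.
elim: p n1 k1 => [|p IHp] n1 k1; first exact: locYY_zeta1.
rewrite !FDE scalerDr scalerA mulrC -scalerA !IHp opprD scalerN; congr (_ + _).
by rewrite scalerN.
Qed.

Lemma FD_zeta2 N p x n1 n2 k1 k2 : k2.+1%:R *: FD N p x n1 n2 k1 k2.+1 =
  - FD N p (S23 x) n1 n2 k1 k2.
Proof.
elim: p n1 k1 => [|p IHp] n1 k1; first exact: locYY_zeta2.
rewrite !FDE scalerDr !scalerA mulrC [_ * k1.+1%:R]mulrC -!scalerA !IHp.
by rewrite opprD !scalerN.
Qed.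

(** By [FD_zeta1] the part z1^-1 d/dzeta1 of D_z1 acts as - z1^-1 S13, as in [locD]. *)
Lemma FD_locD N p x n1 n2 : FD N p x n1 n2 0 0 = locD X S N p x n1 n2.
Proof.
elim: p x n1 => [|p IHp] x n1; first exact: locYY_locA.
by rewrite FDE FD_zeta1 locDS !IHp.
Qed.

Lemma loc_exT t : exists N, loc X S N t.
Proof.
elim/(@tensor_ind K V V): t => [|x y [N hN] [N' hN']|a b].
- by exists 0%N => c n1 n2; rewrite (linear0 tswap) tens0l !(locA0 (X_low Y) Snil) scaler0.
- exists (maxn N N'); rewrite -[x]scale1r; apply: (loc_lin (X_low Y) Snil).
    exact: (loc_mono (X_low Y) Snil) (leq_maxl _ _) hN.
  exact: (loc_mono (X_low Y) Snil) (leq_maxr _ _) hN'.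
by have [N hN] := Hloc a b; exists N; exact: (natloc_loc Snil).
Qed.

Lemma scomm_T a v k n : ad T (Y a) v k n = T (Y a v k n) - Y a (T v) k n.
Proof.
have eT : even_map T by exact: evenHomP.
have T1 : spr true (T : {linear V -> V}) = 0.
  apply: linext => u; rewrite spr_homE !eT !sprK /=.
  by rewrite addr0.
have T0 : spr false (T : {linear V -> V}) = T.
  by have := spr_sum (T : {linear V -> V}); rewrite T1 addr0.
rewrite -[ad T (Y a)]/(scomm T (Y a)) /scomm.
have -> : \sum_(i : bool) \sum_(j : bool) (-1) ^+ (i && j) *:
    lcomp (spr j (Y a) : LF V) (spr i (T : {linear V -> V})) = lcomp (Y a) T.
  apply: linext => u; rewrite !big_bool !linDE !linZE !lcompE T0 T1 !lin0E.
  rewrite !linear0 ?scaler0 !add0r !scale1r.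
  have := congr1 (fun f : LF V => f (T u)) (spr_sum (Y a)); rewrite linDE => <-.
  exact: addrC.
by rewrite linDE linNE -scaleN1r addrC ll_linE scaleN1r addrC.
Qed.

Lemma cov_coef a b k n : T (Y a b k n) = Y a (T b) k n +
  ((n + 1)%:~R *: Y a b k (n + 1) + k.+1%:R *: Y a b k.+1 (n + 1)).
Proof.
have := congr1 (fun f : LF V => f b k n) (Hcov a).
rewrite scomm_T => /eqP; rewrite subr_eq => /eqP ->; rewrite addrC; congr (_ + _).
Qed.

Lemma T_X n t : T (X n t) =
  X n (tmap idV T t) + ((n + 1)%:~R *: X (n + 1) t - X (n + 1) (S t)).
Proof.
rewrite -Ylog scale1r; elim/(@tensor_ind K V V): t => [|x y IHx IHy|a b].
- by rewrite !linear0 ?scaler0 !addr0.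
- rewrite (linearD (X n)) (linearD T) IHx IHy (linearD (tmap _ _)) !(linearD (Ycoef _ _ _)).
  by apply: lin_sep => l lD lN l0 lZ; rewrite !(lD, lZ); ring.
by rewrite tmapE !YcoefE cov_coef scale1r.
Qed.

Lemma natloc_bound N a b : natloc Y S N (a *t b) ->
  forall v, exists k, low12 k (Fn N ((a *t b) *t v)).
Proof.
move=> h v; have [k hk] := thetaYY_low Y Snil ((a *t b) *t v).
have [k' hk'] := thetaYY_low Y Snil (tswap (a *t b) *t v).
exists (maxn k k') => n1 n2 k1 k2 [h1|h2]; last first.
  by apply: (low2_mulz12 N hk); lia.
by rewrite h -[LHS]/(_ *: _) /flip /locYY (low2_mulz12 N hk') ?scaler0 //; lia.
Qed.

Let diagT N p x n (gx : stable_good X S N x) :=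
  @locD_diag K V vac X S (X_low Y) Snil Seven SP (vac_even Hvac) (Ycoef_even Y 0)
    (fun q h => Ycoef_vac0 Hvac (k := 0) h) (Ycoef_vac_id Hvac) S12_23 S13_23 S12_13
    T (vac_T Hvac) T_X S_vacr (hexY 0) loc_exT N p x n gx.

Let locD0 N p x n1 n2 (gx : stable_good X S N x) :=
  @locD_neg K V vac X S (X_low Y) Snil Seven SP (vac_even Hvac) (Ycoef_even Y 0)
    (fun q h => Ycoef_vac0 Hvac (k := 0) h) (Ycoef_vac_id Hvac) S12_23 S13_23 S12_13
    N p x n1 n2 gx.

Let goodS N x := @stable_good_S K V X S S12_23 S13_23 S12_13 N x.

Lemma FD_low N p x : stable_good X S N x -> low12 (N + p) (FD N p x).
Proof.
have neq k : k.+1%:R != 0 :> K by rewrite pnatr_eq0.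
move=> gx n1 n2 k1 k2 h; elim: k2 x gx => [|k2 IH2] x gx; last first.
  apply: (scalerI (neq k2)); rewrite FD_zeta2 IH2 ?oppr0 ?scaler0 //.
  by have [] := goodS gx.
elim: k1 x gx => [|k1 IH1] x gx; first by rewrite FD_locD; exact: locD0.
apply: (scalerI (neq k1)); rewrite FD_zeta1 IH1 ?oppr0 ?scaler0 //.
by have [] := goodS gx.
Qed.

(** At zeta^0 this is [locD_diag]. Both sides then have the same derivative in zeta, by [diag_rule]
    on the left and by [Ycoef_log] with the hexagon on the right. *)
Lemma FD_diag N p x k n : stable_good X S N x ->
  diag (FD N p x) k n = p`!%:R *: Ycoef Y k n (tmap (X (p%:Z - N%:Z)) idV x).
Proof.
have neq l : l.+1%:R != 0 :> K by rewrite pnatr_eq0.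
elim: k x => [|k IHk] x gx.
  rewrite -(diagT p n gx) /diag; apply: eq_fsbigr => n1 _.
  by rewrite big_ord1 FD_locD.
have [_ g13 g23] := goodS gx; apply: (scalerI (neq k)).
rewrite (diag_rule _ _ (FD_low gx) (FD_low g13) (FD_low g23) (FD_zeta1 _ _ _) (FD_zeta2 _ _ _)).
rewrite !IHk // scalerA mulrC -scalerA Ylog hexY (linearD (tmap _ _)).
by rewrite (linearD (Ycoef _ _ _)) scalerN scalerDr.
Qed.

Theorem hat_formula N0 a b (n : int) : natloc Y S N0 (a *t b) -> forall v k m,
  Ycoef Y k m (X (- n - 1) (a *t b) *t v) =
  diag (Dz1_div (N0%:Z - 1 - n) (Fn N0 ((a *t b) *t v))) k m.
Proof.
move=> lN v k m; pose x := (a *t b) *t v.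
have [N1 gN1] := stable_good_ex (X_low Y) Snil Seven loc_exT x.
(* N is a locality order for all pairs of legs of x, reached from N0 by [diag_Dz1_div_mulz12], and
   large enough for p = N - 1 - n to be nonnegative; p - N is then - n - 1. *)
pose N := (N0 + N1 + `|n|.+1)%N.
have gN : stable_good X S N x.
  by apply: (stable_good_mono (X_low Y) Snil) gN1; rewrite /N; lia.
have [l hl] := natloc_bound lN v.
rewrite -(diag_Dz1_div_mulz12 _ (N - N0) _ _ hl).
have -> : iter (N - N0) mulz12 (Fn N0 x) = Fn N x.
  by rewrite /locYY -iterD subnK // /N; lia.
pose p := absz (N%:Z - 1 - n)%R.
have -> : N0%:Z - 1 - n + (N - N0)%N%:Z = p%:Z by rewrite /p /N; lia.
have -> : diag (Dz1_div p (Fn N x)) k m = p`!%:R^-1 *: diag (FD N p x) k m.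
  have [kk kkP] : exists kk, low12 kk (FD N p x) by exists (N + p)%N; exact: FD_low.
  have kkP' : low12 kk (Dz1_div p (Fn N x)).
    by move=> n1 n2 k1 k2 h; rewrite /Dz1_div -/(FD N p x) kkP ?scaler0.
  have nQ : m + kk%:Z + kk%:Z < (`|m| + kk + kk).+1%:Z by lia.
  rewrite !(diagE _ _ nQ) // scaler_sumr; apply: eq_bigr => i _.
  by rewrite /diag_term scaler_sumr.
rewrite FD_diag // scalerA mulVf ?scale1r; last by rewrite pnatr_eq0 -lt0n fact_gt0.
rewrite tmapE; congr (Ycoef _ _ _ (X _ _ *t _)); rewrite /p /N; lia.
Qed.

Lemma thetaYY_ker x : S12 x = 0 -> Theta x = YY12 Y x.
Proof.
move=> x0; apply: series_ext => n1 n2 k1 k2; rewrite /thetaYY /exp_theta.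
rewrite (@fsum_nat _ _ 1) => [|r r1].
  by rewrite big_ord1 invr1 scale1r.
rewrite theta12_k2 ?scaler0 // => *.
by rewrite (iter_nil_le r1) ?linear0.
Qed.

Lemma T_E a : X 1 (a *t vac) = T a.
Proof.
have := T_X 0 (a *t vac).
rewrite tmapE (vac_T Hvac) tens0r (linear0 (X 0)) S_vacr (linear0 (X _)) subr0 !add0r.
by rewrite scale1r (Ycoef_vac_id Hvac) => ->.
Qed.

Lemma natloc_vac a : natloc Y S 0 (a *t vac).
Proof.
move=> c; apply: series_ext => n1 n2 k1 k2.
rewrite -[RHS]/(1 *: _) scale1r /flip (tswap_vac (vac_even Hvac)) /locYY /=.
rewrite !thetaYY_ker; try by rewrite /leg12 tmapE ?S_vacl ?S_vacr tens0l.
rewrite !YY12E !tassocE !tmapE !YcoefE !(vac_id Hvac).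
by case: ifP => // _; rewrite ?linear0 // lin0E.
Qed.

Lemma tmap_X1_ins u : tmap (X 1) idV (P23 (u *t vac)) = tmap T idV u.
Proof.
elim/(@tensor_ind K V V): u => [|x y IHx IHy|b a]; first by rewrite tens0l !linear0.
  by rewrite tensDl !linearD IHx IHy.
rewrite leg23E tassocE tmapE (tswap_vac (vac_even Hvac)) tunassocE tmapE T_E.
by rewrite tmapE.
Qed.

(** The hexagon on a (x) vac (x) c at z^1, where X_1(a, vac) = T a and S23 vanishes. *)
Lemma S_T x : S (tmap T idV x) = tmap T idV (S x).
Proof.
elim/(@tensor_ind K V V): x => [|x y IHx IHy|a c]; first by rewrite !linear0.
  by rewrite (linearD (tmap _ _)) !(linearD S) (linearD (tmap _ _)) IHx IHy.
have := hexY 0 1 ((a *t vac) *t c).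
rewrite tmapE T_E (linearD (tmap _ _)).
have -> : S23 ((a *t vac) *t c) = 0.
  by rewrite leg23E tassocE tmapE S_vacl tens0r linear0.
have -> : S13 ((a *t vac) *t c) = P23 (S (a *t c) *t vac).
  rewrite leg13E; congr (P23 _).
  have -> : (a *t vac) *t c = P23 ((a *t c) *t vac).
    by rewrite leg23E tassocE tmapE (tswap_vac (vac_even Hvac)) tunassocE.
  by rewrite leg23P2 /leg12 tmapE.
by rewrite tmap_X1_ins (linear0 (tmap _ _)) addr0 tmapE.
Qed.

(** T a is X_1(a, vac), so [hat_formula] with n = -2 and b = vac gives its field; the pair is local
    of order 0, which leaves one derivative. *)
Lemma Y_T a : Y (T a) = Dz (Y a).
Proof.
apply: linext => v; apply: llext => k m.
have := hat_formula (- 2%:Z)%R (natloc_vac a) v k m.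
rewrite (_ : - - _ - 1 = 1) ?T_E ?YcoefE; last by [].
move=> ->; rewrite /diag.
have -> : 0%N%:Z - 1 - - 2%:Z = 1%N by [].
have E n1 n2 k1 k2 : Fn 0 ((a *t vac) *t v) n1 n2 k1 k2 =
    if (k2 == 0%N) && (n2 == 0) then Y a v k1 n1 else 0.
  rewrite /locYY /= thetaYY_ker; last by rewrite /leg12 tmapE S_vacr tens0l.
  rewrite YY12E tassocE !tmapE !YcoefE (vac_id Hvac).
  by case: ifP => // _; rewrite linear0.
have D n1 n2 k1 k2 : Dz1_div 1%N (Fn 0 ((a *t vac) *t v)) n1 n2 k1 k2 =
    if (k2 == 0%N) && (n2 == 0) then Dz (Y a) v k1 n1 else 0.
  rewrite /Dz1_div invr1 scale1r -[LHS]/(Dz1 _ n1 n2 k1 k2) /Dz1 !E.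
  by case: ifP => // _; rewrite !scaler0 addr0.
rewrite -(fsbig_widen [set m]) //; last first.
  move=> n1 [_ n1m]; apply: big1 => l _; rewrite D; have {}n1m : ~ n1 = m := n1m.
  by rewrite [X in _ && X](_ : _ = false) ?andbF //; apply/negbTE; lia.
rewrite fsbig_set1 big_ord_recr big1 ?add0r => [|l _].
  by rewrite D subnn subrr !eqxx; exact: add0r.
rewrite D (_ : (k - _ == 0)%N = false) // subn_eq0; apply/negbTE.
by rewrite -ltnNge; exact: (ltn_ord l).
Qed.
End VA.

(** * The adjoint action *)

Section Ad.
Context {K : fieldType} {V : superType K}.
Local Notation End_V := {linear V -> V}.
Local Notation idV := (idfun : {linear V -> V}).

Lemma ll_spr i (f : loglaurent V) k n : spr i f k n = spr i (f k n).
Proof. by []. Qed.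

Lemma scommE i j (phi : End_V) (a : LF V) v k n :
  has_parity i phi -> has_parity j a ->
  ad phi a v k n = phi (a v k n) - (-1) ^+ (i && j) *: a (phi v) k n.
Proof.
move=> iphi ja; rewrite -[ad phi a]/(scomm phi a) /scomm.
have -> : \sum_(i : bool) \sum_(j : bool) (-1) ^+ (i && j) *:
    lcomp (spr j a : LF V) (spr i phi : End_V) = (-1) ^+ (i && j) *: lcomp a phi.
  have E k' l : lcomp (spr l a : LF V) (spr k' phi : End_V) =
      if (k' == i) && (l == j) then lcomp a phi else 0.
    apply: linext => u; rewrite lcompE (spr_parity _ iphi) (spr_parity _ ja).
    case: (k' == i); case: (l == j); rewrite /= ?lin0E ?linear0 //.
  rewrite !big_bool !E; case: i j {iphi ja E} => [] [] /=;
    by rewrite ?scaler0 ?addr0 ?add0r.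
rewrite linDE linNE linZE -[LHS]/(llcoef_lin k n (_ - _ *: _)).
by rewrite (linearB (llcoef_lin k n)) (linearZ_LR (llcoef_lin k n)).
Qed.

Lemma ad_even i (phi : End_V) : has_parity i phi -> has_parity i (ad phi).
Proof.
move=> iphi; apply: hom_parityI => j a ja; apply: hom_parityI => k v kv.
rewrite /has_parity; apply: llext => l n.
rewrite ll_spr !(scommE _ _ _ iphi ja) -scaleNr sprD sprZ.
have p u m : has_parity m u -> has_parity (j (+) m) (a u l n).
  move=> mu; have := hom_parity ja mu; rewrite /has_parity => {2}<-.
  by rewrite ll_spr.
have p1 := hom_parity iphi (p _ _ kv); have p2 := p _ _ (hom_parity iphi kv).
rewrite addbA in p1; rewrite addbA [j (+) i]addbC in p2.
by rewrite p1 p2.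
Qed.
End Ad.

Lemma tactD (K : fieldType) (U : superType K) (s t : tensor {linear U -> U} {linear U -> U}) x :
  tact (s + t) x = tact s x + tact t x.
Proof. by rewrite (linearD tact). Qed.

Lemma adadD (K : fieldType) (V : superType K) (s t : tensor {linear V -> V} {linear V -> V}) :
  adad (s + t) = adad s + adad t.
Proof. exact: linearD. Qed.

(** * The hexagon as a relation satisfied by S in End(V) (x) End(V) *)

Section AdAd.
Context {K : fieldType} {V : superType K}.
Local Notation V2 := (tensor V V).
Local Notation V3 := (tensor (tensor V V) V).
Local Notation End_V := {linear V -> V}.
Local Notation idV := (idfun : {linear V -> V}).
Local Notation idE := (idfun : {linear End_V -> End_V}).
Variables (Y : evenHom V (LF V)) (s : tensor End_V End_V).
Hypothesis even_s : has_parity false s.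
Local Notation S := (tact s).
Hypothesis hexY : forall k n x, S (tmap (Ycoef Y k n) idV x) =
  tmap (Ycoef Y k n) idV (leg13 S x + leg23 S x).
Hypothesis hexY2 : forall k n x, S (tmap idV (Ycoef Y k n) (tassoc x)) =
  tmap idV (Ycoef Y k n) (tassoc (leg12 S x + leg13 S x)).

Let delta_bilin phi : linear (fun a => ad phi (Y a) - Y (phi a)).
Proof.
move=> k a b; rewrite (linearP phi) !(linearP Y) (linearP (ad phi)).
by rewrite [in RHS]scalerBr opprD addrACA.
Qed.
Let delta_linear : linear (fun phi : End_V => mklin (delta_bilin phi)).
Proof.
move=> k phi psi; apply: linext => a; rewrite linDE linZE.
have E : ad (k *: phi + psi) (Y a) = k *: ad phi (Y a) + ad psi (Y a).
  by rewrite (linearP ad).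
have F : Y ((k *: phi + psi) a) = k *: Y (phi a) + Y (psi a) by rewrite -(linearP Y).
rewrite -[LHS]/(ad (k *: phi + psi) (Y a) - Y ((k *: phi + psi) a)) E F opprD addrACA.
rewrite -[RHS]/(k *: (ad phi (Y a) - Y (phi a)) + (ad psi (Y a) - Y (psi a))).
by rewrite [in RHS]scalerBr.
Qed.
Let delta : {linear End_V -> {linear V -> LF V}} := mklin delta_linear.

Lemma deltaE i j phi a b k n : has_parity i phi -> has_parity j a ->
  delta phi a b k n = phi (Y a b k n) - Y (phi a) b k n - (-1) ^+ (i && j) *: Y a (phi b) k n.
Proof.
move=> iphi ja; have jYa : has_parity j (Y a) by rewrite /has_parity -evenHomP ja.
rewrite -[delta phi a]/(ad phi (Y a) - Y (phi a)) linDE linNE -[LHS]/(llcoef_lin k n (_ - _)).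
rewrite (linearB (llcoef_lin k n)) -![llcoef_lin k n _]/(_ k n) (scommE _ _ _ iphi jYa).
by rewrite addrAC.
Qed.

Lemma S_hom i j phi psi (a b : V) : has_parity i psi -> has_parity j a ->
  tact (phi *t psi) (a *t b) = (-1) ^+ (i && j) *: (phi a *t psi b).
Proof. by move=> ip ja; rewrite tactE (smapE _ _ ip ja). Qed.

Lemma leg23_hom i j phi psi (a b c : V) : has_parity i psi -> has_parity j b ->
  leg23 (tact (phi *t psi)) ((a *t b) *t c) = (-1) ^+ (i && j) *: ((a *t phi b) *t psi c).
Proof.
by move=> ip jb; rewrite leg23E tassocE tmapE (S_hom _ _ ip jb) tensZr
  (linearZ_LR tunassoc) tunassocE.
Qed.

Lemma leg12_hom i j phi psi (a b c : V) : has_parity i psi -> has_parity j a ->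
  leg12 (tact (phi *t psi)) ((a *t b) *t c) = (-1) ^+ (i && j) *: ((phi a *t psi b) *t c).
Proof. by move=> ip jb; rewrite /leg12 tmapE (S_hom _ _ ip jb) tensZl. Qed.

Lemma leg23_swap i j (a b c : V) : has_parity i b -> has_parity j c ->
  leg23 tswap ((a *t b) *t c) = (-1) ^+ (i && j) *: ((a *t c) *t b).
Proof.
by move=> ib jc; rewrite leg23E tassocE tmapE (tswapE ib jc) tensZr
  (linearZ_LR tunassoc) tunassocE.
Qed.

Lemma leg13_hom i j k phi psi (a b c : V) :
  has_parity i phi -> has_parity i psi -> has_parity j a -> has_parity k b ->
  leg13 (tact (phi *t psi)) ((a *t b) *t c) =
  (-1) ^+ (i && (j (+) k)) *: ((phi a *t b) *t psi c).
Proof.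
move=> iphi ipsi ja kb; move: c; apply: super_ind => [x y IHx IHy|l c lc].
  by rewrite !tensDr (linearD (leg13 _)) IHx IHy linearD tensDr scalerDr.
rewrite leg13E (leg23_swap _ kb lc) (linearZ_LR (leg12 _)) (leg12_hom _ _ _ ipsi ja).
rewrite !(linearZ_LR (leg23 _)) (leg23_swap _ (hom_parity ipsi lc) kb) !scalerA.
by congr (_ *: _); case: i j k l {iphi ipsi ja kb lc} => [] [] [] [] /=; rewrite ?expr0 ?expr1; ring.
Qed.

Let ev_linear a b k n : linear (fun f : {linear V -> LF V} => f a b k n).
Proof. by move=> c f g; exact: (ll_linE c (f a b) (g a b)). Qed.
Let ev a b k n : {linear {linear V -> LF V} -> V} := mklin (ev_linear a b k n).
Let evV_linear c : linear (fun f : End_V => f c).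
Proof. by []. Qed.
Let evV c : {linear End_V -> V} := mklin (evV_linear c).

Lemma leg12D (t u : tensor End_V End_V) x :
  leg12 (tact (t + u)) x = leg12 (tact t) x + leg12 (tact u) x.
Proof.
have E : tact t + tact u = 1 *: tact t + tact u by rewrite scale1r.
rewrite (linearD tact) /leg12 E.
by rewrite tmap_bilinear.1 linDE linZE scale1r.
Qed.

Lemma leg23D (t u : tensor End_V End_V) x :
  leg23 (tact (t + u)) x = leg23 (tact t) x + leg23 (tact u) x.
Proof.
rewrite (linearD tact) !leg23E -(linearD tunassoc); congr (tunassoc _).
have -> : tact t + tact u = 1 *: tact t + tact u by rewrite scale1r.
by rewrite tmap_bilinear.2 linDE linZE scale1r.
Qed.

Lemma leg13D (t u : tensor End_V End_V) x :
  leg13 (tact (t + u)) x = leg13 (tact t) x + leg13 (tact u) x.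
Proof. by rewrite !leg13E leg12D (linearD (leg23 _)). Qed.

Lemma leg12_0 x : leg12 (tact (0 : tensor End_V End_V)) x = 0.
Proof.
have /eqP := leg12D 0 0 x; rewrite addr0 -subr_eq0 opprD addrA subrr sub0r oppr_eq0.
by move/eqP.
Qed.

Lemma leg23_0 x : leg23 (tact (0 : tensor End_V End_V)) x = 0.
Proof.
have /eqP := leg23D 0 0 x; rewrite addr0 -subr_eq0 opprD addrA subrr sub0r oppr_eq0.
by move/eqP.
Qed.

Lemma leg13_0 x : leg13 (tact (0 : tensor End_V End_V)) x = 0.
Proof. by rewrite leg13E leg12_0 linear0. Qed.

Lemma LF_hom_ext (f : {linear V -> LF V}) :
  (forall i j a b k n, has_parity i a -> has_parity j b -> f a b k n = 0) -> f = 0.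
Proof.
move=> f0; apply: linext => a; apply: linext => b; apply: llext => k n.
move: a; apply: super_ind => [x y IHx IHy|i a ia].
  by rewrite (linearD f) -[LHS]/(llcoef_lin k n (f x b + f y b))
    (linearD (llcoef_lin k n)) -![llcoef_lin k n _]/(_ k n) IHx IHy addr0.
move: b; apply: super_ind => [x y IHx IHy|j b jb]; last exact: f0 ia jb.
by rewrite (linearD (f a)) -[LHS]/(llcoef_lin k n (f a x + f a y))
  (linearD (llcoef_lin k n)) -![llcoef_lin k n _]/(_ k n) IHx IHy addr0.
Qed.

Lemma End_hom_ext (f : End_V) :
  (forall i a l, has_parity i a -> spr l (f a) = 0) -> f = 0.
Proof.
move=> f0; apply: linext; apply: super_ind => [x y IHx IHy|i a ia].
  by rewrite linearD IHx IHy lin0E addr0.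
by rewrite -(spr_sum (f a)) !(f0 _ _ _ ia) addr0.
Qed.

Lemma Y_hom i j a b k n : has_parity i a -> has_parity j b ->
  has_parity (i (+) j) (Y a b k n).
Proof.
move=> ia jb; rewrite -YcoefE; apply: even_parity; first exact: Ycoef_even.
exact: has_parity_tens.
Qed.

(** The hexagon on a (x) b (x) c says that all evaluations at a, b and c kill this tensor, and such
    evaluations separate tensors. *)
Lemma delta_id0 : tmap delta idE s = 0.
Proof.
pose I := {q : V * V * bool * bool * nat * int |
  has_parity q.1.1.1.2 q.1.1.1.1.1 /\ has_parity q.1.1.2 q.1.1.1.1.2}.
pose J := {q : V * bool * bool | has_parity q.1.2 q.1.1}.
apply: (@tensor_separated _ _ _ _ _ I J
  (fun q => ev (sval q).1.1.1.1.1 (sval q).1.1.1.1.2 (sval q).1.2 (sval q).2)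
  (fun q => lcomp (spr (sval q).2 : End_V) (evV (sval q).1.1))).
- move=> f f0; apply: LF_hom_ext => i j a b k n ia jb.
  exact: (f0 (exist _ (a, b, i, j, k, n) (conj ia jb))).
- move=> f f0; apply: End_hom_ext => i a l ia.
  exact: (f0 (exist _ (a, i, l) ia)).
case=> [[[[[[a b] i] j] k] n] [/= ia jb]] [[[c m] l] /= mc].
(* Projecting psi c to parity l fixes the parity of psi, so the Koszul sign is the same for all
   terms of t and can be factored out. *)
have E t : has_parity false t ->
  tmap idV (spr l : End_V) (tact t (Y a b k n *t c) -
    tmap (Ycoef Y k n) idV (leg13 (tact t) ((a *t b) *t c) + leg23 (tact t) ((a *t b) *t c))) =
  (-1) ^+ ((l (+) m) && (i (+) j)) *:
    tmap (ev a b k n) (lcomp (spr l : End_V) (evV c)) (tmap delta idE t).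
  elim/(@tensor_ind_even K End_V End_V): t / => [|t u IHt IHu|q phi psi qphi qpsi].
  - rewrite (linear0 (tmap _ _)) (linear0 (tmap (ev _ _ _ _) _)) scaler0.
    by rewrite leg13_0 leg23_0 addr0 (linear0 tact) lin0E (linear0 (tmap _ _)) subr0 linear0.
  - rewrite (linearD (tmap delta _)) (linearD (tmap (ev _ _ _ _) _)) scalerDr -IHt -IHu.
    rewrite -(linearD (tmap _ _)); congr (tmap _ _ _).
    rewrite leg13D leg23D tactD !(linearD (tmap (Ycoef Y k n) idV)).
    by apply: lin_sep => h hD hN h0 hZ; rewrite !(hD, hN, hZ); ring.
  rewrite (S_hom _ _ qpsi (Y_hom k n ia jb)) (leg13_hom _ qphi qpsi ia jb).
  rewrite (leg23_hom _ _ _ qpsi jb) (linearD (tmap (Ycoef Y k n) idV)).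
  rewrite !(linearZ_LR (tmap (Ycoef Y k n) idV)) !tmapE !YcoefE.
  rewrite lcompE -[ev a b k n _]/(delta phi a b k n) -[evV c psi]/(psi c).
  have -> : (-1) ^+ (q && (i (+) j)) *: (phi (Y a b k n) *t psi c) -
      ((-1) ^+ (q && (i (+) j)) *: (Y (phi a) b k n *t psi c) +
       (-1) ^+ (q && j) *: (Y a (phi b) k n *t psi c)) =
      (-1) ^+ (q && (i (+) j)) *: (delta phi a b k n *t psi c).
    rewrite (deltaE _ _ _ qphi ia) !tensDl !tensNl tensZl.
    apply: lin_sep => h hD hN h0 hZ; rewrite !(hD, hN, hZ).
    by case: q i j {ia jb qphi qpsi} => [] [] [] /=; rewrite ?expr0 ?expr1; ring.
  rewrite (linearZ_LR (tmap _ _)) tmapE.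
  rewrite -[(spr l : End_V) _]/(spr l _) (spr_parity _ (hom_parity qpsi mc)).
  by case: eqP => [->|_]; rewrite ?tens0r ?scaler0 // addbK.
have := E s even_s; rewrite -YcoefE.
have -> : tact s (Ycoef Y k n (a *t b) *t c) -
    tmap (Ycoef Y k n) idV (leg13 S ((a *t b) *t c) + leg23 S ((a *t b) *t c)) = 0.
  by rewrite -hexY tmapE subrr.
rewrite linear0 => /esym/eqP; rewrite scaler_eq0 signr_eq0 => /eqP; exact.
Qed.

(** The argument of [delta_id0] applied to the mirror hexagon [hexY2]. *)
Lemma id_delta0 : tmap idE delta s = 0.
Proof.
pose J := {q : V * V * bool * bool * nat * int |
  has_parity q.1.1.1.2 q.1.1.1.1.1 /\ has_parity q.1.1.2 q.1.1.1.1.2}.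
pose I := {q : V * bool * bool | has_parity q.1.2 q.1.1}.
apply: (@tensor_separated _ _ _ _ _ I J
  (fun q => lcomp (spr (sval q).2 : End_V) (evV (sval q).1.1))
  (fun q => ev (sval q).1.1.1.1.1 (sval q).1.1.1.1.2 (sval q).1.2 (sval q).2)).
- move=> f f0; apply: End_hom_ext => i a l ia.
  exact: (f0 (exist _ (a, i, l) ia)).
- move=> f f0; apply: LF_hom_ext => i j a b k n ia jb.
  exact: (f0 (exist _ (a, b, i, j, k, n) (conj ia jb))).
case=> [[[a i] l] /= ia] [[[[[[b c] j] m] k] n] [/= jb mc]].
have E t : has_parity false t ->
  tmap (spr l : End_V) idV (tact t (a *t Y b c k n) -
    tmap idV (Ycoef Y k n)
      (tassoc (leg12 (tact t) ((a *t b) *t c) + leg13 (tact t) ((a *t b) *t c)))) =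
  (-1) ^+ ((l (+) i) && i) *:
    tmap (lcomp (spr l : End_V) (evV a)) (ev b c k n) (tmap idE delta t).
  elim/(@tensor_ind_even K End_V End_V): t / => [|t u IHt IHu|q phi psi qphi qpsi].
  - rewrite (linear0 (tmap _ _)) (linear0 (tmap (lcomp _ _) _)) scaler0.
    by rewrite leg13_0 leg12_0 addr0 (linear0 tact) lin0E (linear0 tassoc)
      (linear0 (tmap _ _)) subr0 linear0.
  - rewrite (linearD (tmap idE _)) (linearD (tmap (lcomp _ _) _)) scalerDr -IHt -IHu.
    rewrite -(linearD (tmap _ _)); congr (tmap _ _ _).
    rewrite leg13D leg12D tactD !(linearD tassoc) !(linearD (tmap idV (Ycoef Y k n))).
    by apply: lin_sep => h hD hN h0 hZ; rewrite !(hD, hN, hZ); ring.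
  rewrite (S_hom _ _ qpsi ia) (leg13_hom _ qphi qpsi ia jb) (leg12_hom _ _ _ qpsi ia).
  rewrite (linearD tassoc) !(linearZ_LR tassoc) !tassocE (linearD (tmap idV (Ycoef Y k n))).
  rewrite !(linearZ_LR (tmap idV (Ycoef Y k n))) !tmapE !YcoefE.
  rewrite lcompE -[ev b c k n _]/(delta psi b c k n) -[evV a phi]/(phi a).
  have -> : (-1) ^+ (q && i) *: (phi a *t psi (Y b c k n)) -
      ((-1) ^+ (q && i) *: (phi a *t Y (psi b) c k n) +
       (-1) ^+ (q && (i (+) j)) *: (phi a *t Y b (psi c) k n)) =
      (-1) ^+ (q && i) *: (phi a *t delta psi b c k n).
    rewrite (deltaE _ _ _ qpsi jb) !tensDr !tensNr tensZr.
    apply: lin_sep => h hD hN h0 hZ; rewrite !(hD, hN, hZ).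
    by case: q i j {ia jb qphi qpsi} => [] [] [] /=; rewrite ?expr0 ?expr1; ring.
  rewrite (linearZ_LR (tmap _ _)) tmapE.
  rewrite -[(spr l : End_V) _]/(spr l _) (spr_parity _ (hom_parity qphi ia)).
  by case: eqP => [->|_]; rewrite ?tens0l ?scaler0 // addbK.
have := E s even_s; rewrite -YcoefE.
have -> : tact s (a *t Ycoef Y k n (b *t c)) -
    tmap idV (Ycoef Y k n) (tassoc (leg12 S ((a *t b) *t c) + leg13 S ((a *t b) *t c))) = 0.
  by rewrite -hexY2 tassocE tmapE subrr.
rewrite linear0 => /esym/eqP; rewrite scaler_eq0 signr_eq0 => /eqP; exact.
Qed.

Let evl_linear a : linear (fun f : {linear V -> LF V} => f a).
Proof. by []. Qed.
Let evl a : {linear {linear V -> LF V} -> LF V} := mklin (evl_linear a).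
Let evLF_linear (a : LF V) : linear (fun f : {linear LF V -> LF V} => f a).
Proof. by []. Qed.
Let evLF (a : LF V) : {linear {linear LF V -> LF V} -> LF V} := mklin (evLF_linear a).
(** A linear map that inserts the Koszul sign for an operator passing a vector of parity i. *)
Let sg (i : bool) : {linear End_V -> End_V} :=
  (spr false : {linear End_V -> End_V}) + (-1) ^+ i *: (spr true : {linear End_V -> End_V}).

Let sgE i q phi : has_parity q phi -> sg i phi = (-1) ^+ (q && i) *: phi.
Proof.
move=> qphi; rewrite -[LHS]/(spr false phi + (-1) ^+ i *: spr true phi) !(spr_parity _ qphi).
by case: q {qphi}; rewrite ?scaler0 ?addr0 ?add0r ?scale1r.
Qed.

(** The difference of ad(phi) Y(a) (x) ad(psi) Y(b) and Y(phi a) (x) Y(psi b) is delta(phi) a (x)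
    ad(psi) Y(b) + Y(phi a) (x) delta(psi) b; summed over s with signs, both parts vanish. *)
Theorem tact_adad x : tact (adad s) (tmap Y Y x) = tmap Y Y (S x).
Proof.
elim/(@tensor_ind_hom K V V): x => [|x y IHx IHy|i j a b ia jb].
- by rewrite !linear0.
- by rewrite (linearD (tmap Y Y)) (linearD (tact _)) (linearD S) (linearD (tmap Y Y)) IHx IHy.
have E t : has_parity false t ->
  tact (adad t) (tmap Y Y (a *t b)) = tmap Y Y (tact t (a *t b)) +
    (tmap (evl a) (lcomp (evLF (Y b)) (lcomp ad (sg i))) (tmap delta idE t) +
     tmap (lcomp Y (lcomp (evV a) (sg i))) (evl b) (tmap idE delta t)).
  elim/(@tensor_ind_even K End_V End_V): t / => [|t u IHt IHu|q phi psi qphi qpsi].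
  - rewrite /adad (linear0 (tmap ad ad)) !(linear0 tact) !lin0E (linear0 (tmap Y Y)).
    by rewrite (linear0 (tmap delta _)) (linear0 (tmap idE _)) !linear0 !addr0.
  - rewrite adadD !tactD IHt IHu.
    rewrite (linearD (tmap Y Y)) (linearD (tmap delta _)) (linearD (tmap idE _)).
    rewrite (linearD (tmap (evl a) _)) (linearD (tmap (lcomp Y _) _)).
    by apply: lin_sep => h hD hN h0 hZ; rewrite !(hD, hN, hZ); ring.
  have iYa : has_parity i (Y a) by rewrite /has_parity -evenHomP ia.
  rewrite /adad !tmapE !tactE (smapE _ _ (ad_even qpsi) iYa) (smapE _ _ qpsi ia).
  rewrite !lcompE !(sgE _ qphi) !(sgE _ qpsi) (linearZ_LR (tmap Y Y)) tmapE.
  rewrite (linearZ_LR (evV a)) (linearZ_LR Y) (linearZ_LR ad) (linearZ_LR (evLF _)).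
  rewrite tensZl tensZr -!scalerDr; congr (_ *: _).
  rewrite -[evl a _]/(ad phi (Y a) - Y (phi a)) -[evl b _]/(ad psi (Y b) - Y (psi b)).
  rewrite -[evLF _ _]/(ad psi (Y b)) -[evV a phi]/(phi a).
  move: (ad phi (Y a)) (ad psi (Y b)) (Y (phi a)) (Y (psi b)) => A B P Q.
  rewrite tensDl tensNl tensDr tensNr.
  by apply: lin_sep => h hD hN h0 hZ; rewrite !(hD, hN, hZ); ring.
by rewrite (E s even_s) delta_id0 id_delta0 !linear0 !addr0.
Qed.
End AdAd.

(** * The two notions *)

Section VacuumProduct.
Context {K : numFieldType} {V : superType K}.
Local Notation V2 := (tensor V V).
Variables (vac : V) (T : evenHom V V) (Y : evenHom V (LF V)).
Variable S : {linear V2 -> V2}.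
Hypothesis Hvac : vacuum_axiom vac T Y.
Hypothesis Snil : forall t, exists r, iter r S t = 0.
Local Notation X := (Ycoef Y 0).
Local Notation Fn := (locYY Y S).

Lemma locYY_vac_low N t : low2 0 (Fn N (t *t vac)).
Proof. by apply: low2_mulz12; exact: (thetaYY_vac_low _ Hvac). Qed.

Lemma locYY_vac_k2 N t n1 n2 k1 k2 : Fn N (t *t vac) n1 n2 k1 k2.+1 = 0.
Proof.
by rewrite /locYY mulz12_k2 // => *; exact: (thetaYY_vac_k2 _ Hvac).
Qed.

Lemma locYY_vac0 N t n : Fn N (t *t vac) n 0 0 0 = X (n - N%:Z) t.
Proof.
rewrite /locYY mulz12_at0; last exact: (thetaYY_vac_low _ Hvac).
rewrite /thetaYY /exp_theta (@fsum_nat _ _ 1) => [|r r1].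
  by rewrite big_ord1 invr1 scale1r -[LHS]/(YY12 Y (t *t vac) _ _ _ _) (YY12_vac Hvac).
case: r r1 => // r _; rewrite theta12_at0; first by rewrite ltn0 scaler0.
by move=> n1 n2 k1 k2 h; rewrite iter_S12_tens (YY12_vac0 Hvac) //; apply/orP; right; lia.
Qed.

(* On the vacuum the fields of a local pair have no log and no poles. *)
Lemma diag_vac N t p : natloc Y S N t ->
  diag (Dz1_div p (Fn N (t *t vac))) 0 0 = X (p - N%:Z) t.
Proof.
move=> lN; pose G := Fn N (t *t vac).
have GE : G = (-1) ^+ N *: flip (Fn N (tswap t *t vac)) by exact: lN.
have G1 n1 n2 k1 k2 : n1 < 0 -> G n1 n2 k1 k2 = 0.
  by move=> n10; rewrite GE -[LHS]/(_ *: _) /flip locYY_vac_low ?scaler0 //; lia.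
have Gk n1 n2 k1 k2 : G n1 n2 k1.+1 k2 = 0.
  by rewrite GE -[LHS]/(_ *: _) /flip locYY_vac_k2 scaler0.
have G2 n1 n2 k1 k2 : n2 < 0 -> G n1 n2 k1 k2 = 0.
  by move=> n20; apply: locYY_vac_low; lia.
case: p => q; last first.
  by rewrite -locYY_vac0 -/G G1 // /diag fsbig1 // => n1 _; rewrite big_ord1.
pose H q : series2 V := iter q (@Dz1 K V) G.
have HS r n1 n2 k1 k2 : H r.+1 n1 n2 k1 k2 =
  (n1 + 1)%:~R *: H r (n1 + 1) n2 k1 k2 + k1.+1%:R *: H r (n1 + 1) n2 k1.+1 k2 by [].
have Hk r n1 n2 k1 k2 : H r n1 n2 k1.+1 k2 = 0.
  elim: r n1 k1 => [|r IHr] n1 k1; first exact: Gk.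
  by rewrite HS !IHr !scaler0 addr0.
have H2 r n1 n2 k1 k2 : n2 < 0 -> H r n1 n2 k1 k2 = 0.
  move=> n20; elim: r n1 k1 => [|r IHr] n1 k1; first exact: G2.
  by rewrite HS !IHr !scaler0 addr0.
have H1 r n1 n2 k1 k2 : n1 < 0 -> H r n1 n2 k1 k2 = 0.
  elim: r n1 => [|r IHr] n1 n10; first exact: G1.
  rewrite HS Hk scaler0 addr0; have [->|n1N] := eqVneq (n1 + 1) 0; first exact: scale0r.
  by rewrite IHr ?scaler0 //; lia.
have H0 r m : m`!%:R *: H r m%:Z 0 0 0 = (m + r)`!%:R *: G (m + r)%N%:Z 0 0 0.
  elim: r m => [|r IHr] m; first by rewrite addn0.
  have m1 : m%:Z + 1 = m.+1%:Z by lia.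
  by rewrite HS Hk scaler0 addr0 scalerA -addSnnS -IHr factS natrM mulrC m1.
rewrite /diag -(fsbig_widen [set 0]) //; last first.
  move=> n1 [_ n10]; have {}n10 : n1 <> 0 := n10.
  apply: big1 => l _; rewrite /Dz1_div -/(H q); have [?|?] : n1 < 0 \/ 0 - n1 < 0 by lia.
    by rewrite H1 ?scaler0.
  by rewrite H2 ?scaler0.
rewrite fsbig_set1 big_ord1 /Dz1_div -/(H q) subr0.
have := H0 q 0%N; rewrite fact0 scale1r => ->.
by rewrite scalerA mulVf ?scale1r /G ?locYY_vac0 // pnatr_eq0 -lt0n fact_gt0.
Qed.
End VacuumProduct.

(** * Passage between V and the space of fields Y_z(V) *)

Section Transfer.
Context {K : numFieldType} {V : superType K}.
Local Notation V2 := (tensor V V).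
Local Notation End_V := {linear V -> V}.
Local Notation idV := (idfun : {linear V -> V}).
Variables (vac : V) (T : evenHom V V) (Y : evenHom V (LF V)).
Hypothesis Hvac : vacuum_axiom vac T Y.
Local Notation U := (image_gsub Y).
Local Notation idU := (idfun : {linear U -> U}).
Local Notation y := (corestr Y).
Local Notation inc := (gincl U).

Definition ev_field : {linear U -> V} := lcomp (ev_vac vac) (gincl U).
Local Notation e := ev_field.

Lemma gincl_corestr a : inc (y a) = Y a. Proof. by []. Qed.

Lemma corestrK : cancel y e.
Proof. by move=> a; rewrite -[LHS]/(Y a vac 0%N 0) (vac_init Hvac). Qed.

Lemma corestr_surj u : exists a, u = y a.
Proof. by case: u => u uU; have /asboolP[a aE] := uU; exists a; apply: val_inj. Qed.

Lemma ev_fieldK : cancel e y.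
Proof. by move=> u; have [a ->] := corestr_surj u; rewrite corestrK. Qed.

Lemma corestr_even : even_map y.
Proof. by move=> i a; apply: val_inj; exact: evenHomP. Qed.

Lemma ev_field_even : even_map e.
Proof. by move=> i u; have [a ->] := corestr_surj u; rewrite -corestr_even !corestrK. Qed.

Lemma tmap_gincl x : tmap inc inc (tmap y y x) = tmap Y Y x.
Proof. by rewrite tmap_comp; apply: eq_tmap. Qed.

Lemma tmap_corestrK : cancel (tmap y y) (tmap e e).
Proof. by move=> x; rewrite -(tmap_surj corestrK). Qed.

Lemma tmap_ev_fieldK : cancel (tmap e e) (tmap y y).
Proof. by move=> x; rewrite -(tmap_surj ev_fieldK). Qed.

Section Sides.
Variables (s : tensor End_V End_V) (shat : tensor {linear U -> U} {linear U -> U}).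
Hypothesis shatE : forall x, tact shat (tmap y y x) = tmap y y (tact s x).
Local Notation S := (tact s).

Lemma iter_tact_transport r x : iter r (tact shat) (tmap y y x) = tmap y y (iter r S x).
Proof. by elim: r => //= r ->; rewrite shatE. Qed.

Lemma hat_side12E N x v : hat_side12 shat N (tmap y y x) v = locYY Y S N (x *t v).
Proof.
rewrite /hat_side12 /locYY; congr (iter N mulz12 (exp_theta theta12 _)); apply/funext => r.
by rewrite iter_tact_transport tmap_gincl iter_S12_tens YY12_tens.
Qed.

Lemma hat_side21E N x v : hat_side21 shat N (tswap (tmap y y x)) v =
  (-1) ^+ N *: flip (locYY Y S N (tswap x *t v)).
Proof.
rewrite -natlocE /hat_side21; congr (iter N mulz12 (exp_theta theta21 _)); apply/funext => r.
by rewrite (tmap_tswap corestr_even) iter_tact_transport tmap_gincl iter_S12_tens YY21_tens.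
Qed.

Lemma hat_local_atE N a b : hat_local_at shat N (y a) (y b) <-> natloc Y S N (a *t b).
Proof.
by split=> h v; have := h v; rewrite -tmapE hat_side12E hat_side21E.
Qed.
End Sides.

Section OfHat.
Variables (s : tensor End_V End_V) (shat : tensor {linear U -> U} {linear U -> U}).
Hypothesis shatE : forall x, tact shat (tmap y y x) = tmap y y (tact s x).
Hypothesis brS : braiding_map s.
Hypothesis H : hat_logVA vac T Y shat.
Local Notation S := (tact s).

Let Snil t : exists r, iter r S t = 0.
Proof.
elim/(@tensor_ind K V V): t => [|t u|a b].
- by exists 0%N.
- exact: iter_nilD.
have [r _ r0] := hat_local_nilp (hat_locality H) (y a) (y b).
exists r; have := iter_tact_transport shatE r (a *t b); rewrite tmapE r0 => E.
by rewrite -[iter r S _]tmap_corestrK -E linear0.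
Qed.

Let Hloc a b : exists N, natloc Y S N (a *t b).
Proof.
have [N hN] := hat_localP (hat_locality H) (y a) (y b).
by exists N; have [h _] := hat_local_atE shatE N a b; exact: h.
Qed.

(** By [diag_vac] the product of index - n - 1, taken at the vacuum and z = 0, is [Ycoef Y 0 n]; so
    the hexagon for [mu] is the transported one. *)
Let hex0 n x : S (tmap (Ycoef Y 0 n) idV x) =
  tmap (Ycoef Y 0 n) idV (leg13 S x + leg23 S x).
Proof.
have [mu muP muhex] := hat_hexagon H (- n - 1).
have muE : lcomp e (lcomp mu (tmap y y)) = Ycoef Y 0 n.
  apply: tensor_linext => a b; rewrite !lcompE tmapE.
  have [N lN muN] := muP (y a) (y b).
  rewrite -[LHS]/(inc (mu (y a *t y b)) vac 0%N 0) muN -tmapE (hat_side12E shatE).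
  rewrite (diag_vac Hvac); first by congr (Ycoef Y 0 _ _); lia.
  by have [h _] := hat_local_atE shatE N a b; exact: h.
have muT z : tmap y y (tmap (Ycoef Y 0 n) idV z) = tmap mu idU (tmap3 y z).
  rewrite /tmap3 !tmap_comp; apply: eq_tmap => // t.
  by rewrite -muE !lcompE ev_fieldK.
apply: (can_inj tmap_corestrK); rewrite -shatE !muT muhex (linearD (tmap3 y)).
by rewrite (tmap3_leg13 corestr_even _ shatE) (tmap3_leg23 _ shatE).
Qed.

(** [Ycoef_log] raises the power of zeta by means of S12, which commutes with S13 + S23. *)
Let hex k n x : S (tmap (Ycoef Y k n) idV x) =
  tmap (Ycoef Y k n) idV (leg13 S x + leg23 S x).
Proof.
elim: k x => [|k IHk] x; first exact: hex0.
have E z : k.+1%:R *: tmap (Ycoef Y k.+1 n) idV z = - tmap (Ycoef Y k n) idV (leg12 S z).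
  elim/(@tensor_ind K V2 V): z => [|z w IHz IHw|t c].
  - by rewrite (linear0 (leg12 S)) (linear0 (tmap (Ycoef Y k.+1 n) idV))
      (linear0 (tmap (Ycoef Y k n) idV)) scaler0 oppr0.
  - by rewrite (linearD (leg12 S)) (linearD (tmap (Ycoef Y k.+1 n) idV))
      (linearD (tmap (Ycoef Y k n) idV)) scalerDr opprD IHz IHw.
  by rewrite /leg12 !tmapE -tensZl -tensNl (Ycoef_log Hvac Snil Hloc).
apply: (scalerI (_ : k.+1%:R != 0)); first by rewrite pnatr_eq0.
rewrite -(linearZ_LR S) !E (linearN S) IHk; congr (- tmap _ _ _).
by rewrite (linearD (leg12 S)) (braiding_12_13 brS) (braiding_12_23 brS).
Qed.

Theorem logVA_of_hat : logVA vac T Y s.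
Proof.
split=> //; first exact: hat_covariance H.
move=> a b; have [N hN] := Hloc a b; exists N => c.
by rewrite natlocE; exact: hN.
Qed.
End OfHat.

Section OfLogVA.
Variables (s : tensor End_V End_V) (shat : tensor {linear U -> U} {linear U -> U}).
Hypothesis shatE : forall x, tact shat (tmap y y x) = tmap y y (tact s x).
Hypothesis brshat : braiding_map shat.
Hypothesis H : logVA vac T Y s.
Local Notation S := (tact s).

Let Snil t : exists r, iter r S t = 0 := lva_nilp H t.

Let Hloc a b : exists N, natloc Y S N (a *t b).
Proof.
have [N hN] := lva_locality H a b; exists N => c.
by rewrite -natlocE; exact: hN.
Qed.

Let Seven : even_map S := even_tact (braiding_even (lva_braiding H)).
Let SP := braiding_swap (lva_braiding H).

Let hexS2 := hexY2 Seven SP (lva_hexagon H).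
Let hcov := lva_covariance H.
Let S12_23 := braiding_12_23 (lva_braiding H).
Let S13_23 := braiding_13_23 (lva_braiding H).
Let S12_13 := braiding_12_13 (lva_braiding H).
Let YT := Y_T Hvac hcov Snil Hloc Seven SP S12_23 S13_23 S12_13 (lva_hexagon H).
Let ST := S_T Hvac hcov Snil Hloc SP (lva_hexagon H).
Let YX := hat_formula Hvac hcov Snil Hloc Seven SP S12_23 S13_23 S12_13 (lva_hexagon H).

Let T_shat x : tmap (conjl y e T) idU (tact shat x) = tact shat (tmap (conjl y e T) idU x).
Proof.
have TE z : tmap (conjl y e T) idU (tmap y y z) = tmap y y (tmap T idV z).
  rewrite !tmap_comp; apply: eq_tmap => // a.
  by rewrite -[LHS]/(y (T (e (y a)))) corestrK.
by rewrite -[x]tmap_ev_fieldK shatE !TE shatE ST.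
Qed.

Theorem tmap_gincl_shat x :
  tmap inc inc (tact shat x) = tact (adad s) (tmap inc inc x).
Proof.
rewrite -[x]tmap_ev_fieldK shatE !tmap_gincl.
by rewrite (tact_adad (braiding_even (lva_braiding H)) (lva_hexagon H) hexS2).
Qed.

Theorem hat_of_logVA : hat_logVA vac T Y shat.
Proof.
have gT u : inc (conjl y e T u) = Y (T (e u)) by [].
split=> //.
- exists (conjl y e T); last exact: T_shat.
  by move=> u; rewrite gT -{2}[u]ev_fieldK gincl_corestr hcov.
- exists (conjl y e T); last exact: T_shat.
  by move=> u; rewrite gT -{2}[u]ev_fieldK gincl_corestr YT.
- split=> u v; have [a ->] := corestr_surj u; have [b ->] := corestr_surj v.
    (* [hat_local] requires a positive exponent, hence r.+1. *)
    have [r r0] := Snil (a *t b); exists r.+1 => //.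
    by rewrite iterS -tmapE (iter_tact_transport shatE) r0 !linear0.
  by have [N hN] := Hloc a b; exists N; have [_ h] := hat_local_atE shatE N a b; exact: h.
(* By [hat_formula] the n-th product of Y(a,z) and Y(b,z) is the field of X_(-n-1)(a,b), hence lies
   in Y_z(V). *)
move=> n; pose mu := lcomp y (lcomp (Ycoef Y 0 (- n - 1)) (tmap e e)).
exists mu => [u v|x].
  have [a ->] := corestr_surj u; have [b ->] := corestr_surj v; have [N hN] := Hloc a b.
  exists N; first by have [_ h] := hat_local_atE shatE N a b; exact: h.
  move=> w k m; rewrite -tmapE (hat_side12E shatE).
  rewrite -(YX _ hN) YcoefE -[inc _]/(Y (Ycoef Y 0 (- n - 1) (tmap e e _))).
  by rewrite tmapE tmapE !corestrK.
have muT z : tmap mu idU (tmap3 y z) = tmap y y (tmap (Ycoef Y 0 (- n - 1)) idV z).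
  rewrite /tmap3 !tmap_comp; apply: eq_tmap => // t.
  by rewrite !lcompE tmap_corestrK.
rewrite (tmap3_surj ev_fieldK x) (tmap3_leg13 corestr_even _ shatE) (tmap3_leg23 _ shatE).
by rewrite -(linearD (tmap3 y)) !muT shatE (lva_hexagon H).
Qed.
End OfLogVA.
End Transfer.

(** * Construction of each braiding map from the other *)

Section Equivalence.
Context {K : numFieldType} {V : superType K}.
Variables (vac : V) (T : evenHom V V) (Y : evenHom V (LF V)).
Local Notation y := (corestr Y).
Local Notation e := (ev_field vac Y).
Local Notation inc := (gincl (image_gsub Y)).

Theorem exists_logVA shat : hat_logVA vac T Y shat ->
  exists2 s, (forall a b, tact s (a *t b) = tmap (ev_vac vac) (ev_vac vac)
    (tmap inc inc (tact shat (y a *t y b)))) & logVA vac T Y s.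
Proof.
move=> H; have Hvac := hat_vacuum H.
have ye := @corestr_even _ _ Y; have ee := ev_field_even Hvac; have eyK := corestrK Hvac; have yeK := ev_fieldK Hvac.
have sE := tact_conjt ee ye yeK shat.
have br := conjt_braiding ee ye yeK eyK (hat_braiding H).
exists (conjt e y shat) => [a b|].
  rewrite tmap_comp; have -> : lcomp (ev_vac vac) inc = e by [].
  by rewrite -sE tmapE !eyK.
apply: (logVA_of_hat Hvac _ br H) => x.
by rewrite -[x in RHS](tmap_corestrK Hvac) sE (tmap_ev_fieldK Hvac).
Qed.

Theorem exists_hat_logVA s : logVA vac T Y s ->
  exists2 shat, (forall x, tmap inc inc (tact shat x) = tact (adad s) (tmap inc inc x)) &
    hat_logVA vac T Y shat.
Proof.
move=> H; have Hvac := lva_vacuum H.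
have ye := @corestr_even _ _ Y; have ee := ev_field_even Hvac; have eyK := corestrK Hvac; have yeK := ev_fieldK Hvac.
have sE := tact_conjt ye ee eyK s.
have br := conjt_braiding ye ee eyK yeK (lva_braiding H).
exists (conjt y e s); first exact: (tmap_gincl_shat Hvac sE H).
exact: (hat_of_logVA Hvac sE br H).
Qed.
End Equivalence.

(* Stated up to an equality of fields so that, for R[i], the two paths from   *)
(* the numeric structure to the field structure are compared only once.       *)
Lemma logVA_equivalence (K : fieldType) (F : numFieldType) : F = K :> fieldType ->
  forall (V : superType K) (vac : V) (T : evenHom V V) (Y : evenHom V (LF V)),
  (forall shat, hat_logVA vac T Y shat ->
     exists2 s, (forall a b, tact s (a *t b) = tmap (ev_vac vac) (ev_vac vac)
       (tmap (gincl (image_gsub Y)) (gincl (image_gsub Y))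
         (tact shat (corestr Y a *t corestr Y b)))) & logVA vac T Y s) /\
  (forall s, logVA vac T Y s ->
     exists2 shat, (forall x, tmap (gincl (image_gsub Y)) (gincl (image_gsub Y)) (tact shat x) =
       tact (adad s) (tmap (gincl (image_gsub Y)) (gincl (image_gsub Y)) x)) &
       hat_logVA vac T Y shat).
Proof. by case: K /; split; [exact: exists_logVA | exact: exists_hat_logVA]. Qed.

Theorem proposition3p16 (R : realType) (V : superType R[i]) (vac : V)
    (T : evenHom V V) (Y : evenHom V (LF V)) :
  (forall shat : tensor {linear image_gsub Y -> image_gsub Y}
                        {linear image_gsub Y -> image_gsub Y},
     hat_logVA vac T Y shat ->
     exists2 s : tensor {linear V -> V} {linear V -> V},
       (forall a b : V,
          tact s (a *t b) =
          tmap (ev_vac vac) (ev_vac vac)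
            (tmap (gincl (image_gsub Y)) (gincl (image_gsub Y))
               (tact shat (corestr Y a *t corestr Y b)))) &
       logVA vac T Y s)
  /\
  (forall s : tensor {linear V -> V} {linear V -> V},
     logVA vac T Y s ->
     exists2 shat : tensor {linear image_gsub Y -> image_gsub Y}
                           {linear image_gsub Y -> image_gsub Y},
       (forall x : tensor (image_gsub Y) (image_gsub Y),
          tmap (gincl (image_gsub Y)) (gincl (image_gsub Y)) (tact shat x) =
          tact (adad s)
            (tmap (gincl (image_gsub Y)) (gincl (image_gsub Y)) x)) &
       hat_logVA vac T Y shat).
Proof. exact: (@logVA_equivalence R[i] R[i] erefl V vac T Y). Qed.
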